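(* Let $(X_0,X_1)$ be a compatible couple and $1<q\le\infty$. Let $a\in SV(0,\infty)$ satisfy $$\int_0^\infty t^{-1}a^{-q'}(t)\,dt<\infty .$$ Let $\alpha\in SV(0,\infty)$ be such that $$\int_0^x t^{-1}\alpha^{-q'}(t)\,dt<\infty\ \text{ for all } x>0,\qquad \int_0^\infty t^{-1}\alpha^{-q'}(t)\,dt=\infty,$$ let $A\in SV(0,\infty)$ be given by $$A(x):=a(x)\ \text{ if } x\in(0,1],\qquad A(x)\approx\alpha(x)\ \text{ if } x\in(1,\infty),$$ and put $$B(x):=A^{-q'/q}(x)\left(\int_0^x t^{-1}A^{-q'}(t)\,dt\right)^{-1}\quad\text{for all } x>0$$ (so $B(x)=\left(\int_0^x t^{-1}A^{-1}(t)\,dt\right)^{-1}$ if $q=\infty$). Then $$(X_0,X_1)_{0,q,a;J}=X_0\cap(X_0,X_1)_{0,q,A;J}=X_0\cap(X_0,X_1)_{0,q,B;K}.$$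
   Context: A pair $(X_0,X_1)$ of Banach spaces is a compatible couple if there is a Hausdorff topological vector space in which both $X_0$ and $X_1$ are continuously embedded. The intersection $X\cap Y$ of two Banach spaces embedded in a common space carries the norm $\max\{\|f\|_{X},\|f\|_{Y}\}$, and $X_0+X_1$ carries the norm $\inf\{\|f_0\|_{X_0}+\|f_1\|_{X_1}: f=f_0+f_1\}$. For $t>0$, $$K(f,t;X_0,X_1):=\inf\{\|f_0\|_{X_0}+t\|f_1\|_{X_1}: f=f_0+f_1,\ f_0\in X_0,\ f_1\in X_1\}\quad (f\in X_0+X_1),$$ $$J(f,t;X_0,X_1):=\max\{\|f\|_{X_0},t\|f\|_{X_1}\}\quad (f\in X_0\cap X_1).$$ For $1\le q\le\infty$, $\|\cdot\|_{q,(c,d)}$ is the $L_q$-norm on $(c,d)$, $1/q+1/q'=1$, and $1/\infty=0$. For a weight $v$ on $(0,\infty)$ (non-negative, measurable, finite a.e.): - $(X_0,X_1)_{0,q,v;K}$ is the set of $f\in X_0+X_1$ with $\|f\|_{0,q,v;K}:=\|t^{-1/q}v(t)K(f,t;X_0,X_1)\|_{q,(0,\infty)}<\infty$. - $(X_0,X_1)_{0,q,v;J}$ is the set of $f\in X_0+X_1$ for which there is a strongly measurable $u:(0,\infty)\to X_0\cap X_1$ with $f=\int_0^\infty u(s)\,\frac{ds}{s}$ (convergence in $X_0+X_1$) and for which $\|f\|_{0,q,v;J}:=\inf\|t^{-1/q}v(t)J(u(t),t;X_0,X_1)\|_{q,(0,\infty)}$ is finite, the infimum being over all such representations of $f$.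 Equality of two spaces means that they are equal as sets and their norms are equivalent. For non-negative expressions, $\mathcal A\approx\mathcal B$ means that each is bounded by a positive constant multiple of the other, the constants being independent of the significant quantities (here, of $x$). $SV(0,\infty)$ is the set of slowly varying functions: positive, finite, Lebesgue-measurable functions $b$ on $(0,\infty)$ such that for each $\varepsilon>0$, $t^{\varepsilon}b(t)$ is equivalent ($\approx$) to a non-decreasing function on $(0,\infty)$ and $t^{-\varepsilon}b(t)$ is equivalent to a non-increasing function on $(0,\infty)$. *)

(* Defs.v *)
From HB Require Import structures.
From mathcomp Require Import all_boot all_order all_algebra.
From mathcomp Require Import all_classical all_reals all_analysis.

Set Implicit Arguments.
Unset Strict Implicit.
Unset Printing Implicit Defensive.

Import Order.TTheory GRing.Theory Num.Theory.
Import numFieldNormedType.Exports.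

Local Open Scope classical_set_scope.
Local Open Scope ring_scope.

(** ** Lebesgue measure on the half-line *)

(* [lebesgue_measure] lives on the Borel sets.  [leb] is its completion, on the
   real line with the sigma-algebra of Lebesgue measurable sets: [lebR R] is
   convertible to [R]. *)
Notation leb R := (@completed_lebesgue_measure R).
Notation lebR R := (caratheodory_type (wlength (@idfun R))^*%mu).

Definition half_line (R : realType) : set R := `]0, +oo[.
Arguments half_line R : clear implicits.

(* The L_q norm over (0, +oo), for q in [1, +oo]; the patch [f \_ _] extends [f]
   by 0. *)
Definition Lq_norm (R : realType) (q : \bar R) (f : R -> \bar R) : \bar R :=
  Lnorm (leb R) q (f \_ (half_line R)).

(* 1/q as a real number, with 1/oo = 0 *)
Definition recip (R : realType) (q : \bar R) : R := fine (q^-1)%E.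

(* The conjugate exponent q'; it is finite for 1 < q <= +oo. *)
Definition conj_exp (R : realType) (q : \bar R) : R :=
  fine (hoelder_conjugate q).

(* \int_D t^-1 b^-q'(t) dt *)
Definition weight_integral (R : realType) (q : \bar R) (b : R -> R) (D : set R)
    : \bar R :=
  (\int[leb R]_(t in D) (t^-1 * b t `^ (- conj_exp q))%:E)%E.

(** ** Slowly varying functions *)

Definition equiv_on (R : realType) (D : set R) (f g : R -> R) : Prop :=
  exists c C : R, [/\ 0 < c, 0 < C &
    forall x, D x -> c * g x <= f x /\ f x <= C * g x].

Definition slowly_varying (R : realType) (b : R -> R) : Prop :=
  [/\ forall t : R, 0 < t -> 0 < b t,
      measurable_fun (half_line R : set (lebR R)) (b : lebR R -> R) &
      forall eps : R, 0 < eps ->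
        (exists2 g : R -> R,
           forall s t : R, 0 < s -> s <= t -> g s <= g t &
           equiv_on (half_line R) (fun t => t `^ eps * b t) g) /\
        (exists2 g : R -> R,
           forall s t : R, 0 < s -> s <= t -> g t <= g s &
           equiv_on (half_line R) (fun t => t `^ (- eps) * b t) g)].

(** ** Spaces inside an ambient vector space *)

(* A space is a set of vectors with a functional on it, its norm; the values of
   [snorm] outside [carrier] are irrelevant. *)
Record space (R : realType) (V : Type) := Space {
  carrier :> V -> Prop;
  snorm : V -> \bar R }.

Section spaces.
Context {R : realType} {V : topologicalLmodType R}.
Implicit Types X Y : space R V.

Definition space_cap X Y : space R V :=
  Space (carrier X `&` carrier Y) (fun f => Order.max (snorm X f) (snorm Y f)).

Definition space_sum X Y : space R V :=
  Space [set f | exists f0 f1, [/\ X f0, Y f1 & f = f0 + f1]]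
    (fun f => ereal_inf [set k | exists f0 f1,
      [/\ X f0, Y f1, f = f0 + f1 & k = (snorm X f0 + snorm Y f1)%E]]).

(* equality as sets with equivalence of the norms *)
Definition space_eq X Y : Prop :=
  (forall f, X f <-> Y f) /\
  exists c C : R, [/\ 0 < c, 0 < C & forall f, X f ->
    (c%:E * snorm Y f <= snorm X f)%E /\ (snorm X f <= C%:E * snorm Y f)%E].

(** ** The Bochner integral over (0, +oo) with respect to ds/s *)

Definition haar (A : set R) : \bar R := (\int[leb R]_(s in A) (s^-1)%:E)%E.

Definition level_set (s : R -> V) (v : V) : set R :=
  half_line R `&` s @^-1` [set v].

Definition simple_fun X (s : R -> V) : Prop :=
  [/\ forall t : R, 0 < t -> X (s t),
      finite_set (s @` half_line R) &
      forall v, measurable (level_set s v : set (lebR R))].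

Definition integrable_simple_fun X (s : R -> V) : Prop :=
  simple_fun X s /\ forall v, v != 0 -> (haar (level_set s v) < +oo)%E.

Definition simple_integral (s : R -> V) : V :=
  \sum_(v \in s @` half_line R) fine (haar (level_set s v)) *: v.

Definition strongly_measurable X (u : R -> V) : Prop :=
  (forall t : R, 0 < t -> X (u t)) /\
  exists s_ : nat -> R -> V, (forall n, simple_fun X (s_ n)) /\
    {ae leb R, forall t : R, 0 < t ->
      snorm X (u t - s_ n t) @[n --> \oo] --> 0%E}.

(* [u] is Bochner integrable in [X] and [f] is its integral. *)
Definition bochner_integral X (u : R -> V) (f : V) : Prop :=
  [/\ X f, strongly_measurable X u &
  exists s_ : nat -> R -> V, [/\ forall n, integrable_simple_fun X (s_ n),
    (\int[leb R]_(t in half_line R) ((t^-1)%:E * snorm X (u t - s_ n t)%R))%E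
      @[n --> \oo] --> 0%E &
    snorm X (f - simple_integral (s_ n)) @[n --> \oo] --> 0%E]].

End spaces.

(** ** Compatible couples and real interpolation spaces *)

Record compatible_couple (R : realType) := CompatibleCouple {
  banach0 : completeNormedModType R;
  banach1 : completeNormedModType R;
  ambient : topologicalLmodType R;
  ambient_hausdorff : hausdorff_space ambient;
  emb0 : {linear banach0 -> ambient};
  emb1 : {linear banach1 -> ambient};
  emb0_inj : injective emb0;
  emb1_inj : injective emb1;
  emb0_continuous : continuous emb0;
  emb1_continuous : continuous emb1 }.

(* A Banach space as a space inside the ambient one.  The embedding is
   injective, so the infimum is the norm of the only preimage of [f]. *)
Definition embedded (R : realType) (B : normedModType R)
    (V : topologicalLmodType R) (i : B -> V) : space R V :=
  Space (range i) (fun f => ereal_inf [set `|x|%:E | x in i @^-1` [set f]]).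

Section interpolation.
Context {R : realType} (C : compatible_couple R).
Implicit Types (f : ambient C) (t : R) (q : \bar R) (v : R -> R).

Definition X0 : space R (ambient C) := embedded (emb0 C).
Definition X1 : space R (ambient C) := embedded (emb1 C).

Definition Kfun f t : \bar R :=
  ereal_inf [set k | exists f0 f1,
    [/\ X0 f0, X1 f1, f = f0 + f1 & k = (snorm X0 f0 + t%:E * snorm X1 f1)%E]].

Definition Jfun f t : \bar R := Order.max (snorm X0 f) (t%:E * snorm X1 f)%E.

Definition K_norm q v f : \bar R :=
  Lq_norm q (fun t => (t `^ (- recip q) * v t)%:E * Kfun f t)%E.

Definition K_space q v : space R (ambient C) :=
  Space [set f | space_sum X0 X1 f /\ (K_norm q v f < +oo)%E] (K_norm q v).

Definition J_representation f (u : R -> ambient C) : Prop :=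
  strongly_measurable (space_cap X0 X1) u /\
  bochner_integral (space_sum X0 X1) u f.

Definition J_norm q v f : \bar R :=
  ereal_inf [set Lq_norm q (fun t => (t `^ (- recip q) * v t)%:E * Jfun (u t) t)%E
            | u in J_representation f].

(* The infimum of the empty set is +oo, so a finite [J_norm] provides a
   representation. *)
Definition J_space q v : space R (ambient C) :=
  Space [set f | space_sum X0 X1 f /\ (J_norm q v f < +oo)%E] (J_norm q v).

End interpolation.

(* B(x) = A^(-q'/q)(x) (\int_0^x t^-1 A^-q'(t) dt)^-1 *)
Definition dual_weight (R : realType) (q : \bar R) (A : R -> R) (x : R) : R :=
  A x `^ (- (conj_exp q * recip q)) *
  (fine (weight_integral q A `]0, x[))^-1.

(* Main.v *)
Require Import Defs.
From mathcomp Require Import all_boot all_order all_algebra.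
From mathcomp Require Import all_classical all_reals all_analysis.
From mathcomp Require Import measurable_realfun ess_sup_inf ring lra.

Set Implicit Arguments.
Unset Strict Implicit.
Unset Printing Implicit Defensive.

Import Order.TTheory GRing.Theory Num.Theory.
Import numFieldNormedType.Exports.

Local Open Scope classical_set_scope.
Local Open Scope ring_scope.

(** Let [p = q'], and for a weight [v] let [w(t) = t^-1 v(t)^-p], with primitive
    [Phi(x) = \int_0^x w].

    The first equality.  Let [f] be the integral of [u(s) ds/s], with finite
    weighted norm of [J(u(t), t)].  By Hoelder's inequality the part over [[0, 1[]
    converges in [X_0], since [Phi(1)] is finite, and the part [g] over [[1, oo[]
    converges in [X_1], since a slowly varying weight does not compete with
    [t^-1].  If [f] is in [X_0], then so is the difference [g], which therefore
    lies in both spaces and can be moved: spreading [g] over [[1, 2[] gives another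
    representation of [f], whose norm depends on the weight on [[0, 2[] only
    ([J_norm_change_weight]).  So inside [X_0] the weights [a] and [A], which agree
    on [[0, 1]], give the same space.  Moreover the whole integral converges in
    [X_0] when that of [t^-1 a^-p] is finite ([J_space_sub_X0]).

    The second equality, from J to K.  Cutting a representation at [t] yields
    [K(f, t) <= \int_0^t J ds/s + t \int_t^oo J/s ds/s].  Now
    [t^(-1/q) B(t) = w(t)^(1/q) / Phi(t)], and the two terms are controlled by
    weighted Hardy inequalities, both of which follow from Schur's test
    ([hardy_dual_below], [hardy_dual_above], [K_norm_le_J_norm]).

    The second equality, from K to J ([J_norm_le_K_norm]).  Choose points [tau_k]
    with [Phi(tau_k) = 2^-k Phi(1)] and decompositions [f = f0_k + f1_k] that are
    optimal at [tau_k] up to a factor [2].  The differences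
    [d_k = f0_(k+1) - f0_(k+2) = f1_(k+2) - f1_(k+1)] lie in both spaces, and their
    sum telescopes to [f0_1], because the norm of [f] forces [K(f, tau_k)] to tend
    to [0].  Spreading [d_k] over [[tau_(k+3), tau_(k+2)[] with the density [A^-p]
    makes the weighted value of [J] there comparable with [w^(1/q) K(f, tau_(k+1))]
    divided by the mass of the interval; as the masses of neighbouring intervals
    are comparable and [K(f, -)] is non-decreasing, the norm of this
    representation is bounded by the K-norm of [f] ([Lq_norm_level_shift]).  The
    remainder [f1_1] lies in both spaces when [f] is in [X_0], and is spread over
    [[1, 2[] as before.

    The vector-valued part rests on a few facts about the Bochner integral: a
    strongly measurable function with integrable norm has an integral in a
    complete space ([bochner_exists]), integrals do not change when the space is
    enlarged ([bochner_sub_space]), and they are unique ([bochner_unique]).  The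
    integral in [X_0 + X_1] is unique because that space is normed, which is where
    the Hausdorff ambient space enters ([Kfun_eq0]). *)

#[local] Arguments snorm {R V} s _%_ring_scope.

(** * Integrals over the half-line *)

Section monotone_integral.
Context d (T : measurableType d) {R : realType} (mu : {measure set T -> \bar R}).
Local Open Scope ereal_scope.

(** The integral of a non-negative function is a supremum over the simple
    functions below it, whence a monotonicity that asks for no measurability. *)
Lemma le_integral_subset (A B : set T) (f g : T -> \bar R) :
  A `<=` B -> (forall x, A x -> 0 <= f x) -> (forall x, B x -> 0 <= g x) ->
  (forall x, A x -> f x <= g x) ->
  \int[mu]_(x in A) f x <= \int[mu]_(x in B) g x.
Proof.
move=> AB f0 g0 fg; rewrite !ge0_integralE//.
apply: le_ereal_sup => _ [h /= hf <-]; exists h => //= x.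
apply: (le_trans (hf x)); rewrite /patch.
case: ifPn => [/set_mem xA|_].
  by rewrite ifT ?fg//; apply/mem_set/AB.
by case: ifPn => // /set_mem /g0.
Qed.

Lemma le_integral_on (D : set T) (f g : T -> \bar R) :
  (forall x, D x -> 0 <= f x) -> (forall x, D x -> f x <= g x) ->
  \int[mu]_(x in D) f x <= \int[mu]_(x in D) g x.
Proof.
move=> f0 fg; apply: le_integral_subset => // x Dx.
exact: le_trans (f0 _ Dx) (fg _ Dx).
Qed.

End monotone_integral.

Section lebesgue_measurable.
Context {R : realType}.
Notation T := (lebR R).
Notation mu := (leb R).

Lemma measurable_leb (A : set R) : measurable A -> measurable (A : set T).
Proof. exact: sub_caratheodory. Qed.

Lemma measurable_leb_itv (i : interval R) : measurable ([set` i] : set T).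
Proof. by apply: measurable_leb; exact: measurable_itv. Qed.

Lemma measurable_half_line : measurable (half_line R : set T).
Proof. exact: measurable_leb_itv. Qed.

Lemma measurable_leb_id (D : set T) : measurable_fun D (id : T -> R).
Proof.
move=> mD Y mY; apply: measurableI => //.
by rewrite preimage_id; exact: measurable_leb.
Qed.

Lemma measurable_leb_comp (D : set T) (f : R -> R) :
  measurable_fun setT f -> measurable_fun D (f : T -> R).
Proof. by move=> mf; exact: (measurable_comp measurableT _ mf (@measurable_leb_id D)). Qed.

Lemma measurable_leb_powR (D : set T) (c : R) :
  measurable_fun D ((fun t => t `^ c) : T -> R).
Proof. exact: (measurable_leb_comp (measurable_powR c)). Qed.

Lemma measurable_leb_inv (D : set T) : D `<=` half_line R ->
  measurable_fun D ((fun t => t^-1) : T -> R).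
Proof.
move=> DH; apply: (eq_measurable_fun (fun t : T => (t : R) `^ (-1))).
  move=> t /set_mem /DH; rewrite /half_line/= in_itv/= andbT => t0.
  by rewrite powR_inv1// ltW.
exact: measurable_leb_powR.
Qed.

Lemma half_lineP (t : R) : half_line R t <-> 0 < t.
Proof. by rewrite /half_line/= in_itv/= andbT. Qed.

Lemma leb_itv (i : interval R) :
  mu ([set` i] : set T) = (if i.1 < i.2 then (i.2 : \bar R) - i.1 else 0)%E.
Proof. exact: (lebesgue_measure_itv i). Qed.

Lemma leb_itvco (x y : R) : x <= y -> mu (`[x, y[%classic : set T) = (y - x)%:E.
Proof.
move=> xy; rewrite leb_itv/= lte_fin; case: ltP => // yx.
by rewrite (@le_anti _ _ x y) ?subrr// xy yx.
Qed.

End lebesgue_measurable.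
Arguments measurable_half_line {R}.
#[global] Hint Resolve measurable_half_line : core.

(** * Schur's test *)

Lemma powRD_gt0 (R : realType) (x r s : R) :
  0 < x -> x `^ (r + s) = x `^ r * x `^ s.
Proof. by move=> x0; rewrite powRD // (gt_eqF x0) implybT. Qed.

Section schur.
Context d (T : measurableType d) {R : realType}.
Local Open Scope ereal_scope.

Lemma hoelder_ge0 (mu : {measure set T -> \bar R}) (f g : T -> R) (p q : R) :
  measurable_fun setT f -> measurable_fun setT g ->
  (forall x, 0 <= f x)%R -> (forall x, 0 <= g x)%R ->
  (0 < p)%R -> (0 < q)%R -> (p^-1 + q^-1 = 1)%R ->
  \int[mu]_x (f x * g x)%:E <=
    (\int[mu]_x (f x `^ p)%:E) `^ p^-1 * (\int[mu]_x (g x `^ q)%:E) `^ q^-1.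
Proof.
move=> mf mg f0 g0 p0 q0 pq.
have := hoelder mu mf mg p0 q0 pq.
rewrite Lnorm1 unlock.
under eq_integral do rewrite /= ger0_norm ?mulr_ge0//.
move=> /le_trans; apply.
by under eq_integral do rewrite /= ger0_norm//;
   under [X in _ * X `^ _]eq_integral do rewrite /= ger0_norm//.
Qed.

Context (mu : {sigma_finite_measure set T -> \bar R}).

Lemma le_poweR (x y : \bar R) (r : R) :
  (0 <= r)%R -> 0 <= x -> x <= y -> x `^ r <= y `^ r.
Proof.
move=> r0 x0 xy; apply: gt0_ler_poweR => //; rewrite in_itv/= leey andbT//.
exact: le_trans xy.
Qed.

(** Schur's test.  Writing the kernel [k] as
    [(k^(1/p) h(s)) (k^(1/q) h(s)^-1)], Hoelder's inequality in [s] uses up the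
    bound on the rows, and Tonelli's theorem then brings in the columns. *)
Lemma schur_test (D : set (T * T)) (a b h g : T -> R) (p q C : R) :
  (0 < p)%R -> (0 < q)%R -> (p^-1 + q^-1 = 1)%R -> (0 < C)%R ->
  measurable D -> measurable_fun setT a -> measurable_fun setT b ->
  measurable_fun setT h -> measurable_fun setT g ->
  (forall x, 0 <= a x)%R -> (forall x, 0 <= b x)%R ->
  (forall x, 0 < h x)%R -> (forall x, 0 <= g x)%R ->
  let k t s := (b t * a s * \1_D (t, s))%R in
  (forall t, \int[mu]_s (k t s * h s `^ p)%:E <= (C * h t `^ p)%:E) ->
  (forall s, \int[mu]_t (k t s * h t `^ q)%:E <= (C * h s `^ q)%:E) ->
  \int[mu]_t (\int[mu]_s (k t s * g s)%:E) `^ q <=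
    (C `^ q)%:E * \int[mu]_s (g s `^ q)%:E.
Proof.
move=> p0 q0 pq C0 mD ma mb mh mg a0 b0 h0 g0 k row col.
have k0 t s : (0 <= k t s)%R by rewrite !mulr_ge0.
have mpow (f : T -> R) c : measurable_fun setT f ->
    measurable_fun setT (fun x => f x `^ c)%R.
  exact: (measurableT_comp (measurable_powR c)).
have mk2 : measurable_fun setT (fun z : T * T => k z.1 z.2).
  apply: measurable_funM; first apply: measurable_funM.
  - exact: (measurableT_comp mb).
  - exact: (measurableT_comp ma).
  - rewrite (_ : (fun _ => _) = \1_D :> (T * T -> R)); last first.
      by apply/funext => -[].
    exact: measurable_indic.
have mk t : measurable_fun setT (k t).
  exact: (measurable_fun_pair2 t mk2).
have mk' s : measurable_fun setT (k ^~ s).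
  exact: (measurable_fun_pair1 s mk2).
pose G s := (h s `^ (- q) * g s `^ q)%R.
have G0 s : (0 <= G s)%R by rewrite mulr_ge0 ?powR_ge0.
have mG : measurable_fun setT G.
  by apply: measurable_funM; exact: mpow.
have rowE t : (\int[mu]_s (k t s * g s)%:E) `^ q <=
    \int[mu]_s ((C `^ (q / p)) * h t `^ q * (k t s * G s))%:E.
  have := @hoelder_ge0 mu (fun s => k t s `^ p^-1 * h s)%R
    (fun s => k t s `^ q^-1 * (h s `^ (-1) * g s))%R p q.
  have -> : (fun s => (k t s `^ p^-1 * h s *
      (k t s `^ q^-1 * (h s `^ (-1) * g s)))%:E) = (fun s => (k t s * g s)%:E).
    apply/funext => s; congr EFin.
    rewrite mulrACA -powRD; last by rewrite pq oner_eq0.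
    rewrite pq powRr1// powR_inv1 ?(ltW (h0 s))// mulVKf//.
    by rewrite gt_eqF.
  have -> : (fun s => ((k t s `^ p^-1 * h s) `^ p)%:E) =
      (fun s => (k t s * h s `^ p)%:E).
    apply/funext => s; congr EFin.
    rewrite powRM ?powR_ge0 ?(ltW (h0 s))// -powRrM mulVf ?gt_eqF//.
    by rewrite powRr1.
  have -> : (fun s => ((k t s `^ q^-1 * (h s `^ (-1) * g s)) `^ q)%:E) =
      (fun s => (k t s * G s)%:E).
    apply/funext => s; congr EFin.
    rewrite powRM ?powR_ge0// ?mulr_ge0 ?powR_ge0// -powRrM mulVf ?gt_eqF//.
    by rewrite powRr1// powRM ?powR_ge0// -powRrM mulN1r.
  move=> /(_ _ _ _ _ p0 q0 pq) H.
  apply: le_trans.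
    apply: le_poweR (H _ _ _ _).
    - exact: ltW.
    - by apply: integral_ge0 => s _; rewrite lee_fin mulr_ge0.
    - by apply: measurable_funM => //; exact: mpow.
    - apply: measurable_funM; first exact: mpow.
      by apply: measurable_funM => //; exact: mpow.
    - by move=> s; rewrite mulr_ge0 ?powR_ge0 ?(ltW (h0 s)).
    - by move=> s; rewrite !mulr_ge0 ?powR_ge0.
  rewrite poweRM ?poweR_ge0// -!poweRrM mulVf ?gt_eqF// poweRe1; last first.
    by apply: integral_ge0 => s _; rewrite lee_fin mulr_ge0.
  under [in leRHS]eq_integral do rewrite EFinM.
  rewrite ge0_integralZl//; last 3 first.
  - by apply/measurable_EFinP; apply: measurable_funM.
  - by move=> s _; rewrite lee_fin mulr_ge0.
  - by rewrite lee_fin mulr_ge0 ?powR_ge0.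
  apply: lee_wpmul2r.
    by apply: integral_ge0 => s _; rewrite lee_fin mulr_ge0.
  have -> : (C `^ (q / p) * h t `^ q)%R%:E = ((C * h t `^ p)%:E) `^ (p^-1 * q).
    rewrite poweR_EFin powRM ?powR_ge0 ?ltW// -powRrM mulrA divff ?gt_eqF// mul1r.
    by rewrite [(p^-1 * q)%R]mulrC.
  apply: le_poweR (row t).
  - by rewrite mulr_ge0 ?invr_ge0 ?ltW.
  - by apply: integral_ge0 => s _; rewrite lee_fin mulr_ge0 ?powR_ge0.
apply: le_trans.
  apply: le_integral_on => t _; [exact: poweR_ge0|exact: rowE].
rewrite (fubini_tonelli (m1 := mu) (m2 := mu)
  (fun z => (C `^ (q / p) * h z.1 `^ q * (k z.1 z.2 * G z.2))%:E))/=; last 2 first.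
- apply/measurable_EFinP; apply: measurable_funM.
    apply: measurable_funM => //.
    by apply: (measurableT_comp (mpow _ _ mh)).
  apply: measurable_funM => //.
  exact: (measurableT_comp mG).
- by move=> z; rewrite lee_fin !mulr_ge0 ?powR_ge0.
rewrite -ge0_integralZl//; last 3 first.
- by apply/measurable_EFinP; exact: mpow.
- by move=> s _; rewrite lee_fin powR_ge0.
- by rewrite lee_fin powR_ge0.
apply: le_integral_on => s _.
  by apply: integral_ge0 => t _; rewrite lee_fin !mulr_ge0 ?powR_ge0.
under eq_integral.
  move=> t _.
  rewrite (_ : (_ * _ * _)%R = (C `^ (q / p) * G s * (k t s * h t `^ q))%R);
    last by ring.
  rewrite EFinM; over.
rewrite ge0_integralZl//; last 3 first.
- by apply/measurable_EFinP; apply: measurable_funM => //; exact: mpow.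
- by move=> t _; rewrite lee_fin !mulr_ge0 ?powR_ge0.
- by rewrite lee_fin !mulr_ge0 ?powR_ge0.
apply: (le_trans (lee_wpmul2l _ (col s))).
  by rewrite lee_fin !mulr_ge0 ?powR_ge0.
rewrite -!EFinM lee_fin /G.
rewrite (_ : (_ * _ * _)%R = (C `^ (q / p) * C * (h s `^ (- q) * h s `^ q) * g s `^ q)%R);
  last by ring.
rewrite -powRD_gt0// addNr powRr0 mulr1.
rewrite -[X in (_ * X * _)%R]powRr1 ?(ltW C0)// -powRD_gt0//.
suff -> : (q / p + 1 = q)%R by [].
by rewrite -[X in (_ + X)%R](@divff _ q) ?gt_eqF// -mulrDr pq mulr1.
Qed.

End schur.

(** * Conjugate exponents and the L_q norm *)

Section exponents.
Context {R : realType} (q : \bar R) (q1 : (1 < q)%E).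

Lemma exponentP : (exists2 Q : R, 1 < Q & q = Q%:E) \/ q = +oo%E.
Proof.
case: q q1 => [Q|_|//]; last by right.
by rewrite lte_fin => Q1; left; exists Q.
Qed.

Lemma recip_fin (Q : R) : 1 < Q -> recip Q%:E = Q^-1.
Proof. by move=> Q1; rewrite /recip inver gt_eqF ?(lt_trans _ Q1). Qed.

Lemma recip_y : recip (+oo%E : \bar R) = 0.
Proof. by rewrite /recip invey. Qed.

Lemma conj_exp_fin (Q : R) : 1 < Q -> conj_exp Q%:E = Q / (Q - 1).
Proof.
move=> Q1; rewrite /conj_exp /hoelder_conjugate/=.
have Q0 : (Q%:E == 0 :> \bar R) = false.
  by rewrite eqe gt_eqF// (lt_trans _ Q1).
rewrite Q0 -EFinB inver gt_eqF//; by rewrite subr_gt0.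
Qed.

Lemma conj_exp_y : conj_exp (+oo%E : \bar R) = 1.
Proof. by rewrite /conj_exp hoelder_conjugatey. Qed.

Lemma conj_exp_ge1 : 1 <= conj_exp q.
Proof.
case: exponentP => [[Q Q1 ->]|->]; last by rewrite conj_exp_y.
rewrite conj_exp_fin// ler_pdivlMr ?subr_gt0// mul1r.
by rewrite lerBlDr lerDl.
Qed.

Lemma conj_exp_gt0 : 0 < conj_exp q.
Proof. exact: lt_le_trans conj_exp_ge1. Qed.

Lemma conj_expV : (conj_exp q)^-1 + recip q = 1.
Proof.
case: exponentP => [[Q Q1 ->]|->].
  rewrite conj_exp_fin// recip_fin//.
  have Q0 : Q != 0 by rewrite gt_eqF// (lt_trans _ Q1).
  have Q10 : Q - 1 != 0 by rewrite gt_eqF// subr_gt0.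
  by field; rewrite Q0 Q10.
by rewrite conj_exp_y recip_y invr1 addr0.
Qed.

Lemma recip_ge0 : 0 <= recip q.
Proof.
case: exponentP => [[Q Q1 ->]|->]; last by rewrite recip_y.
by rewrite recip_fin// invr_ge0 ltW// (lt_trans _ Q1).
Qed.

Lemma recip_lt1 : recip q < 1.
Proof. by rewrite -conj_expV ltrDr invr_gt0 conj_exp_gt0. Qed.

Lemma recipE : recip q = 1 - (conj_exp q)^-1.
Proof. by rewrite -conj_expV addrC addKr. Qed.

Lemma conj_expMrecip : conj_exp q * recip q = conj_exp q - 1.
Proof. by rewrite recipE mulrBr mulr1 divff// gt_eqF// conj_exp_gt0. Qed.

End exponents.

Section Lq_norm.
Context {R : realType}.
Notation T := (lebR R).
Notation mu := (leb R).
Notation H := (half_line R : set T).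
Local Open Scope ereal_scope.
Implicit Types (f g : T -> \bar R) (q : \bar R).

Lemma leb_setT_gt0 : 0 < mu [set: T].
Proof.
rewrite [ltRHS](_ : _ = +oo)//.
by have := @leb_itv R `]-oo, +oo[; rewrite set_itvE.
Qed.

Lemma Lq_norm_ge0 q f : 0 <= Lq_norm q f.
Proof. exact: Lnorm_ge0. Qed.

Lemma Lq_norm_finite q f : Lq_norm q f != +oo ->
  Lq_norm q f = (fine (Lq_norm q f))%:E /\ (0 <= fine (Lq_norm q f))%R.
Proof.
move=> foo; rewrite fine_ge0 ?Lq_norm_ge0// fineK//.
by rewrite ge0_fin_numE ?Lq_norm_ge0// ltey.
Qed.

(** The patch by [0] and the absolute value disappear from the norm of a
    non-negative function. *)
Lemma Lq_norm_fin (Q : R) f : (1 < Q)%R -> (forall t, H t -> 0 <= f t) ->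
  Lq_norm Q%:E f = (\int[mu]_(t in H) (f t `^ Q)) `^ Q^-1.
Proof.
move=> Q1 f0; rewrite /Lq_norm unlock; congr (_ `^ _).
rewrite [RHS]integral_mkcond; apply: eq_integral => t _.
rewrite /patch; case: ifPn => [/set_mem tH|_].
  by rewrite gee0_abs ?f0.
by rewrite abse0 poweR0r// gt_eqF// (lt_trans _ Q1).
Qed.

Lemma Lq_norm_finP (Q M : R) f : (1 < Q)%R -> (0 <= M)%R ->
  (forall t, H t -> 0 <= f t) ->
  Lq_norm Q%:E f <= M%:E <-> \int[mu]_(t in H) (f t `^ Q) <= (M `^ Q)%:E.
Proof.
move=> Q1 M0 f0; have Q0 : (0 < Q)%R by rewrite (lt_trans _ Q1).
have i0 : 0 <= \int[mu]_(t in H) (f t `^ Q).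
  by apply: integral_ge0 => t _; exact: poweR_ge0.
rewrite Lq_norm_fin//; split => [/(le_poweR (ltW Q0) (poweR_ge0 _ _))|].
  by rewrite -poweRrM mulVf ?gt_eqF// poweRe1// poweR_EFin.
move=> /(@le_poweR _ _ _ Q^-1 _ i0); rewrite invr_ge0 ltW// => /(_ isT).
by rewrite poweR_EFin -powRrM divff ?gt_eqF// powRr1.
Qed.

Lemma Lq_norm_yP y f : 0 <= y -> (forall t, H t -> 0 <= f t) ->
  Lq_norm +oo f <= y <-> {ae mu, forall t, H t -> f t <= y}.
Proof.
move=> y0 f0; rewrite /Lq_norm unlock leb_setT_gt0.
split=> [/ess_supP|ae_f]; last apply/ess_supP.
  apply: filterS => t /= + Ht; rewrite /patch mem_set// gee0_abs//; exact: f0.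
apply: filterS ae_f => t fy /=; rewrite /patch.
case: ifPn => [/set_mem Ht|_]; last by rewrite abse0.
by rewrite gee0_abs ?fy ?f0.
Qed.

Lemma le_Lq_norm q f g : 1 < q -> (forall t, H t -> 0 <= f t) ->
  (forall t, H t -> f t <= g t) -> Lq_norm q f <= Lq_norm q g.
Proof.
move=> q1 f0 fg.
have g0 t : H t -> 0 <= g t by move=> Ht; exact: le_trans (f0 t Ht) (fg t Ht).
case: (exponentP q1) => [[Q Q1 ->]|->].
  rewrite !Lq_norm_fin//; apply: le_poweR.
  - by rewrite invr_ge0 ltW// (lt_trans _ Q1).
  - by apply: integral_ge0 => t _; exact: poweR_ge0.
  apply: le_integral_on => t Ht; first exact: poweR_ge0.
  by apply: le_poweR; rewrite ?f0 ?fg ?ltW// (lt_trans _ Q1).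
apply/Lq_norm_yP => //; first exact: Lq_norm_ge0.
have /(Lq_norm_yP (Lq_norm_ge0 _ _) g0) := lexx (Lq_norm +oo g).
by apply: filterS => t /[swap] Ht /(_ Ht); apply: le_trans; exact: fg.
Qed.

Lemma Lq_normZ q (c : R) f : 1 < q -> (0 <= c)%R -> measurable_fun H f ->
  (forall t, H t -> 0 <= f t) ->
  Lq_norm q (fun t => c%:E * f t) <= c%:E * Lq_norm q f.
Proof.
move=> q1 c0 mf f0.
have cf0 t : H t -> 0 <= c%:E * f t by move=> Ht; rewrite mule_ge0 ?f0.
case: (exponentP q1) => [[Q Q1 ->]|->].
  have Q0 : (0 < Q)%R by rewrite (lt_trans _ Q1).
  rewrite !Lq_norm_fin//.
  under eq_integral => t /set_mem Ht do rewrite poweRM ?f0// poweR_EFin.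
  rewrite ge0_integralZl; last 4 first.
  - exact: measurable_half_line.
  - exact: (measurableT_comp (measurable_poweR Q)).
  - by move=> t Ht; exact: poweR_ge0.
  - by rewrite lee_fin powR_ge0.
  rewrite poweRM ?lee_fin ?powR_ge0//; last first.
    by apply: integral_ge0 => t _; exact: poweR_ge0.
  by rewrite poweR_EFin -powRrM divff ?gt_eqF// powRr1.
apply/Lq_norm_yP => //; first by rewrite mule_ge0 ?Lq_norm_ge0.
have /(Lq_norm_yP (Lq_norm_ge0 _ _) f0) := lexx (Lq_norm +oo f).
by apply: filterS => t /[swap] Ht /(_ Ht); apply: lee_wpmul2l.
Qed.

(** The constant [4 >= 2^(1 + 1/q)] comes from the crude bound
    [(x + y)^q <= 2^q (x^q + y^q)]; the exact value does not matter for equivalent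
    norms. *)
Lemma Lq_normD q f g : 1 < q ->
  measurable_fun H f -> (forall t, H t -> 0 <= f t) ->
  measurable_fun H g -> (forall t, H t -> 0 <= g t) ->
  Lq_norm q (fun t => f t + g t) <= 4%:E * (Lq_norm q f + Lq_norm q g).
Proof.
move=> q1 mf f0 mg g0.
have fg0 t : H t -> 0 <= f t + g t by move=> Ht; rewrite adde_ge0 ?f0 ?g0.
have [->|foo] := eqVneq (Lq_norm q f) +oo.
  rewrite addye ?gt0_muley ?leey// ?lte_fin//.
  by rewrite -ltNye (lt_le_trans _ (Lq_norm_ge0 _ _)).
have [->|goo] := eqVneq (Lq_norm q g) +oo.
  rewrite addey ?gt0_muley ?leey// ?lte_fin//.
  by rewrite -ltNye (lt_le_trans _ (Lq_norm_ge0 _ _)).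
have {foo}fE : Lq_norm q f = (fine (Lq_norm q f))%:E.
  by rewrite fineK// ge0_fin_numE ?Lq_norm_ge0// ltey.
have {goo}gE : Lq_norm q g = (fine (Lq_norm q g))%:E.
  by rewrite fineK// ge0_fin_numE ?Lq_norm_ge0// ltey.
move: fE gE; set a := fine _; set b := fine _ => fE gE.
have a0 : (0 <= a)%R by rewrite -lee_fin -fE Lq_norm_ge0.
have b0 : (0 <= b)%R by rewrite -lee_fin -gE Lq_norm_ge0.
rewrite fE gE -EFinD -EFinM.
case: (exponentP q1) => [[Q Q1 qE]|qE].
  rewrite {}qE in fE gE *.
  have Q0 : (0 < Q)%R by rewrite (lt_trans _ Q1).
  have /(Lq_norm_finP Q1 a0 f0) fa : Lq_norm Q%:E f <= a%:E by rewrite fE.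
  have /(Lq_norm_finP Q1 b0 g0) gb : Lq_norm Q%:E g <= b%:E by rewrite gE.
  apply/Lq_norm_finP => //; first by rewrite mulr_ge0 ?addr_ge0.
  have mpow h : measurable_fun H h -> measurable_fun H (fun t => h t `^ Q).
    exact: (measurableT_comp (measurable_poweR Q)).
  have double (x : \bar R) : 0 <= x -> 2%:E * x = x + x.
    by move=> x0; rewrite [2%R](_ : _ = 1 + 1)%R// EFinD ge0_muleDl ?mul1e.
  apply: (@le_trans _ _
    (\int[mu]_(t in H) ((2 `^ Q)%:E * (f t `^ Q + g t `^ Q)))).
    apply: le_integral_on => t Ht; first exact: poweR_ge0.
    rewrite ge0_muleDr ?poweR_ge0// -!poweR_EFin -!poweRM ?f0 ?g0//.
    have [fg|/ltW gf] := leP (f t) (g t).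
      apply: le_trans (leeDr _ (poweR_ge0 _ _)).
      apply: le_poweR; [exact: ltW|exact: fg0|rewrite double ?g0//].
      exact: leeD2r.
    apply: le_trans (leeDl _ (poweR_ge0 _ _)).
    apply: le_poweR; [exact: ltW|exact: fg0|rewrite double ?f0//].
    exact: leeD2l.
  rewrite ge0_integralZl; last 4 first.
  - exact: measurable_half_line.
  - by apply: emeasurable_funD; exact: mpow.
  - by move=> t _; rewrite adde_ge0 ?poweR_ge0.
  - by rewrite lee_fin powR_ge0.
  rewrite ge0_integralD; [|exact: measurable_half_line|
    by move=> *; exact: poweR_ge0|exact: mpow|
    by move=> *; exact: poweR_ge0|exact: mpow].
  apply: (@le_trans _ _ ((2 `^ Q)%:E * (a `^ Q + b `^ Q)%:E)).
    by apply: lee_wpmul2l; [rewrite lee_fin powR_ge0|rewrite EFinD leeD].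
  rewrite -EFinM lee_fin (_ : 4 = 2 * 2 :> R)%R; last by rewrite -natrM.
  rewrite -mulrA powRM ?mulr_ge0 ?addr_ge0//.
  apply: ler_wpM2l; rewrite ?powR_ge0//.
  apply: (@le_trans _ _ (2 * (a + b) `^ Q)%R).
    rewrite mulr_natl mulr2n lerD// ge0_ler_powR ?nnegrE ?(ltW Q0) ?addr_ge0//.
      by rewrite lerDl.
    by rewrite lerDr.
  by rewrite powRM ?addr_ge0// ler_wpM2r ?powR_ge0// le1r_powR ?ler1n// (ltW Q1).
rewrite {}qE in fE gE *.
have /(Lq_norm_yP _ f0) : Lq_norm +oo f <= a%:E by rewrite fE.
have /(Lq_norm_yP _ g0) : Lq_norm +oo g <= b%:E by rewrite gE.
rewrite !lee_fin => /(_ b0) gb /(_ a0) fa.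
apply/Lq_norm_yP => //; first by rewrite lee_fin mulr_ge0 ?addr_ge0.
apply: filterS2 fa gb => t fa gb Ht.
apply: (le_trans (leeD (fa Ht) (gb Ht))).
by rewrite -EFinD lee_fin ler_peMl ?addr_ge0// ler1n.
Qed.

(** Hoelder's inequality on a part of the half-line, in a form in which
    [q] may be infinite. *)
Lemma hoelder_Lq q (D : set T) (F G : T -> R) : 1 < q ->
  measurable D -> D `<=` H ->
  measurable_fun H F -> measurable_fun D G ->
  (forall t, H t -> 0 <= F t)%R -> (forall t, D t -> 0 <= G t)%R ->
  \int[mu]_(t in D) (F t * G t)%:E <=
    Lq_norm q (EFin \o F) *
      (\int[mu]_(t in D) (G t `^ conj_exp q)%:E) `^ (conj_exp q)^-1.
Proof.
move=> q1 mD DH mF mG F0 G0.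
have p0 := conj_exp_gt0 q1.
have F0' t : H t -> 0 <= (EFin \o F) t by move=> Ht; rewrite lee_fin F0.
have [Foo|Foo] := eqVneq (Lq_norm q (EFin \o F)) +oo.
  rewrite Foo.
  have : 0 <= \int[mu]_(t in D) (G t `^ conj_exp q)%:E.
    by apply: integral_ge0 => t _; rewrite lee_fin powR_ge0.
  rewrite le_eqVlt => /predU1P[G00|Gp]; last by rewrite gt0_mulye ?leey// poweR_gt0.
  rewrite -G00 poweR0r ?invr_neq0 ?gt_eqF// mule0.
  suff -> : \int[mu]_(t in D) (F t * G t)%:E = 0 by [].
  transitivity (\int[mu]_(t in D) (cst 0 t : \bar R)); last by rewrite integral0.
  apply: ae_eq_integral.
  - exact: mD.
  - apply/measurable_EFinP; apply: measurable_funM => //.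
    exact: (measurable_funS measurable_half_line DH).
  - exact: measurable_cst.
  have := @ae_eq_integral_abs _ _ _ mu D mD (fun t => (G t `^ conj_exp q)%:E).
  have mGp : measurable_fun D (fun t => (G t `^ conj_exp q)%:E).
    by apply/measurable_EFinP; exact: (measurableT_comp (measurable_powR _)).
  move=> /(_ mGp) [+ _].
  under eq_integral do rewrite gee0_abs ?lee_fin ?powR_ge0//.
  move=> /(_ (esym G00)); apply: filterS => t /[swap] Dt /(_ Dt) /=.
  by move=> /eqP; rewrite eqe powR_eq0 => /andP[/eqP -> _]; rewrite mulr0.
have FE : Lq_norm q (EFin \o F) = (fine (Lq_norm q (EFin \o F)))%:E.
  by rewrite fineK// ge0_fin_numE ?Lq_norm_ge0// ltey.
case: (exponentP q1) => [[Q Q1 qE]|qE].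
  have Q0 : (0 < Q)%R by rewrite (lt_trans _ Q1).
  have := @hoelder_ge0 _ T R mu (F \_ D)%R (G \_ D)%R Q (conj_exp q).
  have mFD : measurable_fun setT (F \_ D)%R.
    apply/(measurable_restrict _ _ _).1 => //.
    by rewrite setTI; exact: (measurable_funS measurable_half_line DH).
  have mGD : measurable_fun setT (G \_ D)%R.
    by apply/(measurable_restrict _ _ _).1 => //; rewrite setTI.
  have FD0 x : (0 <= (F \_ D)%R x)%R.
    by rewrite /patch; case: ifPn => // /set_mem /DH /F0.
  have GD0 x : (0 <= (G \_ D)%R x)%R.
    by rewrite /patch; case: ifPn => // /set_mem /G0.
  have QV : (Q^-1 + (conj_exp q)^-1 = 1)%R.
    by rewrite -(conj_expV q1) addrC qE recip_fin.
  move=> /(_ mFD mGD FD0 GD0 Q0 p0 QV) h.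
  apply: le_trans (le_trans h _).
    apply: (@le_integral_subset _ _ _ mu D setT) => // t => [Dt|_|Dt].
    - by rewrite lee_fin mulr_ge0 ?G0 ?F0//; exact: DH.
    - by rewrite lee_fin mulr_ge0.
    - by rewrite /patch mem_set.
  apply: lee_pmul; rewrite ?poweR_ge0//.
    rewrite qE Lq_norm_fin//.
    apply: le_poweR; first by rewrite invr_ge0 ltW.
      by apply: integral_ge0 => t _; rewrite lee_fin powR_ge0.
    rewrite [leRHS]integral_mkcond.
    apply: (@le_integral_on _ _ _ mu setT) => t _.
      by rewrite lee_fin powR_ge0.
    rewrite /patch; case: ifPn => [/set_mem Dt|_].
      by rewrite mem_set ?poweR_EFin//; exact: DH.
    rewrite powR0 ?gt_eqF//; case: ifPn => // /set_mem Ht.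
    by rewrite poweR_ge0.
  apply: le_poweR; first by rewrite invr_ge0 ltW.
    by apply: integral_ge0 => t _; rewrite lee_fin powR_ge0.
  rewrite [leRHS]integral_mkcond.
    apply: (@le_integral_on _ _ _ mu setT) => t _.
    by rewrite lee_fin powR_ge0.
  rewrite /patch; case: ifPn => //.
  by rewrite powR0// gt_eqF.
rewrite qE in FE *; rewrite conj_exp_y invr1 poweRe1; last first.
  by apply: integral_ge0 => t _; rewrite lee_fin powR_ge0.
rewrite FE; set M := fine _ in FE *.
have M0 : (0 <= M)%R by rewrite fine_ge0 ?Lq_norm_ge0.
have /(Lq_norm_yP _ F0') : Lq_norm +oo (EFin \o F) <= M%:E by rewrite FE.
rewrite lee_fin => /(_ M0) aeF.
under [X in _ * X]eq_integral => t /set_mem Dt do rewrite powRr1 ?G0//.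
rewrite -ge0_integralZl; last 4 first.
- exact: mD.
- exact/measurable_EFinP.
- by move=> t Dt; rewrite lee_fin G0.
- by rewrite lee_fin.
apply: ae_ge0_le_integral.
- exact: mD.
- by move=> t Dt; rewrite lee_fin mulr_ge0 ?G0 ?F0//; exact: DH.
- apply/measurable_EFinP; apply: measurable_funM => //.
  exact: (measurable_funS measurable_half_line DH).
- by move=> t Dt; rewrite mule_ge0// lee_fin G0.
- by apply/measurable_EFinP; apply: measurable_funM; [exact: measurable_cst|exact: mG].
apply: filterS aeF => t + Dt => /(_ (DH _ Dt)) /=.
by rewrite !lee_fin => FM; rewrite ler_wpM2r ?G0.
Qed.

End Lq_norm.

Section Lq_norm_complements.
Context {R : realType}.
Notation T := (lebR R).
Notation mu := (leb R).
Notation H := (half_line R : set T).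

Lemma eq_Lq_norm (q : \bar R) (f g : T -> \bar R) :
  (forall t, H t -> f t = g t) -> Lq_norm q f = Lq_norm q g.
Proof.
move=> fg; rewrite /Lq_norm; congr (Lnorm _ _ _); apply/funext => t.
by rewrite /patch; case: ifPn => // /set_mem; exact: fg.
Qed.

(** The preimage of a half-line is an interval. *)
Lemma measurable_nondecreasing (f : T -> \bar R) :
  (forall s t : T, 0 < (s : R) -> (s : R) <= (t : R) -> (f s <= f t)%E) ->
  measurable_fun H f.
Proof.
move=> nd; apply: (measurability (@ErealGenCInfty.G R)) => [|_ [_ [r ->] <-]].
  exact: ErealGenCInfty.measurableE.
apply: measurable_leb; apply: is_interval_measurable => s t /=.
move=> [/half_lineP s0 rs] _ x /andP[sx _].
split; first by apply/half_lineP/(lt_le_trans s0).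
by move: rs; rewrite !in_itv/= !andbT => rs; apply: (le_trans rs); exact: nd.
Qed.

Lemma measurable_nonincreasing (f : T -> \bar R) :
  (forall s t : T, 0 < (s : R) -> (s : R) <= (t : R) -> (f t <= f s)%E) ->
  measurable_fun H f.
Proof.
move=> nd; rewrite (_ : f = oppe \o (fun t => - f t)%E).
  apply: measurableT_comp; first exact: oppe_measurable.
  by apply: measurable_nondecreasing => s t s0 st; rewrite leeN2 nd.
by apply/funext => t /=; rewrite oppeK.
Qed.

Lemma measurable_two_valued (D : set T) (B : set R) (c c' : R) :
  measurable (B : set T) -> measurable_fun D (fun t : T => if (t : R) \in B then c else c').
Proof.
move=> mB.
have mB' : measurable_fun D (fun t : T => (t : R) \in B).
  move=> mD; apply: (measurable_fun_bool true) => //.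
  rewrite (_ : _ @^-1` _ = B); first exact: measurableI.
  by apply/seteqP; split => t; [exact: set_mem|exact: mem_set].
exact: (measurable_comp measurableT _ (f := fun b : bool => if b then c else c') _ mB').
Qed.

Lemma Lq_norm_bump (q : \bar R) (c : R) : (1 < q)%E -> 0 <= c ->
  (Lq_norm q (fun t => (if (t : R) \in (`[1%R, 2%R[)%classic then c else 0)%:E) <= c%:E)%E.
Proof.
move=> q1 c0.
have b0 (t : R) : (0 <= (if t \in `[1%R, 2%R[%classic then c else 0)%:E :> \bar R)%E.
  by rewrite lee_fin; case: ifP.
have [[Q Q1 ->]|->] := exponentP q1; last first.
  apply/(Lq_norm_yP _ (fun t _ => b0 t)); first by rewrite lee_fin.
  by apply/nearW => t _; rewrite lee_fin; case: ifP.
apply/(Lq_norm_finP Q1 c0 (fun t _ => b0 t)).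
rewrite (_ : (\int[mu]_(t in H) _)%E = (\int[mu]_(t in H)
    ((fun=> (c `^ Q)%:E) \_ (`[1%R, 2%R[%classic : set T)) t)%E).
  rewrite -integral_mkcondr setIidr; last first.
    by move=> t /=; rewrite in_itv/= => /andP[t1 _]; apply/half_lineP/(lt_le_trans ltr01).
  rewrite integral_cst; last exact: measurable_leb_itv.
  rewrite [X in (_ * X)%E](_ : _ = 1%E) ?mule1//.
  transitivity ((2 - 1 : R)%:E); first by apply: leb_itvco; rewrite ler1n.
  by congr EFin; lra.
apply: eq_integral => t _; rewrite /patch; case: ifPn => _; rewrite poweR_EFin//.
by rewrite powR0// gt_eqF// (lt_trans ltr01).
Qed.

End Lq_norm_complements.

(** * Primitives of weights *)

Section geometric_cover.
Context d (T : measurableType d) {R : realType} (mu : {measure set T -> \bar R}).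
Local Open Scope ereal_scope.

(** The pieces may overlap: the integrand is dominated by the sum of its
    restrictions to them. *)
Lemma integral_geometric_cover (D : set T) (G : nat -> set T) (f : T -> \bar R)
    (c rho : R) :
  measurable D -> (forall k, measurable (G k)) -> measurable_fun D f ->
  (forall t, D t -> 0 <= f t) -> D `<=` \bigcup_k G k ->
  (0 <= c)%R -> (0 <= rho < 1)%R ->
  (forall k, \int[mu]_(t in D `&` G k) f t <= (c * rho ^+ k)%:E) ->
  \int[mu]_(t in D) f t <= (c / (1 - rho))%:E.
Proof.
move=> mD mG mf f0 DG c0 /andP[rho0 rho1] fG.
have mDG k : measurable (D `&` G k) by exact: measurableI.
have mp k : measurable_fun setT (f \_ (D `&` G k)).
  apply/(measurable_restrict _ _ _).1 => //; rewrite setTI.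
  by apply: measurable_funS mf => // t [].
have p0 k t : 0 <= (f \_ (D `&` G k)) t.
  by rewrite /patch; case: ifPn => // /set_mem[/f0].
apply: (@le_trans _ _ (\int[mu]_t \sum_(k <oo) (f \_ (D `&` G k)) t)).
  rewrite integral_mkcond; apply: (@le_integral_on _ _ _ mu setT) => t _.
    by rewrite /patch; case: ifPn => // /set_mem/f0.
  rewrite {1}/patch; case: ifPn => [/set_mem Dt|_]; last exact: nneseries_ge0.
  have [k _ Gk] := DG _ Dt.
  apply: (@le_trans _ _ ((f \_ (D `&` G k)) t)).
    by rewrite /patch mem_set.
  rewrite (@nneseriesD1 _ _ k) //; first by rewrite leeDl// nneseries_ge0.
rewrite integral_nneseries//.
apply: (@le_trans _ _ (\sum_(k <oo) (c * rho ^+ k)%:E)).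
  apply: lee_nneseries => k; last by have := fG k; rewrite integral_mkcond.
  by move=> _ _; apply: integral_ge0.
rewrite (_ : (fun n => _) = EFin \o series (geometric c rho)); last first.
  by apply/funext => n; rewrite /series/= sumEFin.
have rho1' : (`|rho| < 1)%R by rewrite ger0_norm.
rewrite (_ : limn _ = (c / (1 - rho))%:E)//.
apply/cvg_lim => //; apply: cvg_EFin; first by near=> n.
exact: cvg_geometric_series.
Unshelve. all: by end_near. Qed.

End geometric_cover.

Section primitive.
Context {R : realType}.
Notation T := (lebR R).
Notation mu := (leb R).
Notation H := (half_line R : set T).

Definition primitive (w : T -> R) (x : R) : R :=
  fine (\int[mu]_(t in (`]0%R, x[ : set R)) (w t)%:E)%E.

Definition locally_bounded_weight (w : T -> R) : Prop :=
  forall x y : R, 0 < x -> x <= y ->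
    exists l L : R, [/\ 0 < l, 0 < L & forall t : R, x <= t -> t <= y -> l <= w t <= L].

(** The properties of [t |-> t^-1 v(t)^(-q')], for a slowly varying [v], on which
    the theory of its primitive rests. *)
Definition weight (w : T -> R) : Prop :=
  [/\ measurable_fun H w, locally_bounded_weight w &
    forall x : R, 0 < x ->
      (\int[mu]_(t in (`]0%R, x[ : set R)) (w t)%:E < +oo)%E].

Context (w : T -> R) (ww : weight w).
Let mw : measurable_fun H w. Proof. by case: ww. Qed.
Let lw : locally_bounded_weight w. Proof. by case: ww. Qed.
Let fw (x : R) : 0 < x ->
  (\int[mu]_(t in (`]0%R, x[ : set R)) (w t)%:E < +oo)%E.
Proof. by case: ww => _ _; exact. Qed.
Local Notation Phi := (primitive w).

Lemma weight_gt0 (t : R) : 0 < t -> 0 < w t.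
Proof.
move=> t0; have [l [L [l0 _ /(_ t (lexx t) (lexx t))]]] := lw t0 (lexx t).
by move=> /andP[+ _]; apply: lt_le_trans.
Qed.

Lemma itv0_half_line (x : R) : (`]0%R, x[ : set R) `<=` half_line R.
Proof. by move=> t; rewrite /half_line/= !in_itv/= andbT => /andP[]. Qed.

Lemma itvco_half_line (x y : R) : 0 < x -> (`[x, y[ : set R) `<=` half_line R.
Proof.
move=> x0 t; rewrite /half_line/= !in_itv/= andbT => /andP[xt _].
exact: lt_le_trans xt.
Qed.

Lemma measurable_weight (D : set T) : D `<=` H -> measurable_fun D w.
Proof. by move=> DH; exact: (measurable_funS measurable_half_line DH). Qed.

Lemma integral_weight_ge0 (D : set T) : D `<=` H ->
  (0 <= \int[mu]_(t in D) (w t)%:E)%E.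
Proof.
move=> DH; apply: integral_ge0 => t /DH /half_lineP t0.
by rewrite lee_fin ltW// weight_gt0.
Qed.

Lemma primitiveE (x : R) :
  (\int[mu]_(t in (`]0%R, x[ : set R)) (w t)%:E = (Phi x)%:E)%E.
Proof.
rewrite /primitive fineK// ge0_fin_numE; last first.
  exact/integral_weight_ge0/itv0_half_line.
have [x0|x0] := leP x 0; last exact: fw.
by rewrite set_itv_ge ?integral_set0// -leNgt bnd_simp.
Qed.

Lemma primitive_ge0 (x : R) : 0 <= Phi x.
Proof.
by rewrite -lee_fin -primitiveE; exact/integral_weight_ge0/itv0_half_line.
Qed.

Lemma primitiveB (x y : R) : 0 < x -> x <= y ->
  (\int[mu]_(t in (`[x, y[ : set R)) (w t)%:E = (Phi y - Phi x)%:E)%E.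
Proof.
move=> x0 xy.
have sE : `]0%R, y[%classic = `]0, x[%classic `|` `[x, y[%classic :> set R.
  by rewrite -itv_bndbnd_setU// bnd_simp// ltW.
have := primitiveE y; rewrite sE ge0_integral_setU.
- rewrite (primitiveE x) EFinB => <-.
  by rewrite addeAC subee// add0e.
- exact: measurable_leb_itv.
- exact: measurable_leb_itv.
- apply/measurable_EFinP/measurable_weight; rewrite -sE.
  exact: itv0_half_line.
- rewrite -sE => t /itv0_half_line /half_lineP t0.
  by rewrite lee_fin ltW// weight_gt0.
- apply/disj_setPS => t [] /=; rewrite !in_itv/= => /andP[_ tx] /andP[xt _].
  by have := lt_le_trans tx xt; rewrite ltxx.
Qed.

Lemma le_primitive (x y : R) : x <= y -> Phi x <= Phi y.
Proof.
move=> xy; rewrite -lee_fin -!primitiveE; apply: le_integral_subset => //.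
- by apply: subset_itvl; rewrite bnd_simp.
- by move=> t /itv0_half_line /half_lineP t0; rewrite lee_fin ltW// weight_gt0.
- by move=> t /itv0_half_line /half_lineP t0; rewrite lee_fin ltW// weight_gt0.
Qed.

Lemma primitive_bounds (x y : R) : 0 < x -> x <= y ->
  exists l L : R, [/\ 0 < l, 0 < L & forall s t : R, x <= s -> s <= t -> t <= y ->
    l * (t - s) <= Phi t - Phi s <= L * (t - s)].
Proof.
move=> x0 xy; have [l [L [l0 L0 wb]]] := lw x0 xy.
exists l, L; split=> // s t xs st ty.
have s0 : 0 < s by exact: lt_le_trans xs.
have cst_int (c : R) : 0 < c ->
    (\int[mu]_(u in (`[s, t[ : set R)) c%:E = (c * (t - s))%:E)%E.
  move=> c0; rewrite integral_cst; last exact: measurable_leb_itv.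
  by rewrite [X in (_ * X)%E](leb_itvco st).
rewrite -!lee_fin -primitiveB// -!cst_int//; apply/andP; split.
  apply: le_integral_on => u /=; rewrite in_itv/= => /andP[su ut].
    by rewrite lee_fin ltW.
  by rewrite lee_fin; have /andP[] := wb u (le_trans xs su) (le_trans (ltW ut) ty).
apply: le_integral_on => u /=; rewrite in_itv/= => /andP[su ut];
  have /andP[lu uL] := wb u (le_trans xs su) (le_trans (ltW ut) ty).
  by rewrite lee_fin (le_trans (ltW l0)).
by rewrite lee_fin.
Qed.

Lemma primitive_lt (x y : R) : 0 < x -> x < y -> Phi x < Phi y.
Proof.
move=> x0 xy; have [l [L [l0 _]]] := primitive_bounds x0 (ltW xy).
move=> /(_ x y (lexx _) (ltW xy) (lexx _)) /andP[+ _].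
rewrite -subr_gt0; apply: lt_le_trans; by rewrite mulr_gt0// subr_gt0.
Qed.

Lemma primitive_gt0 (x : R) : 0 < x -> 0 < Phi x.
Proof.
move=> x0; have x20 : 0 < x / 2 by rewrite divr_gt0.
apply: (le_lt_trans (primitive_ge0 (x / 2))); apply: primitive_lt => //.
by rewrite ltr_pdivrMr// ltr_pMr// ltr1n.
Qed.

(** Monotone convergence along the intervals [[1/(n+1), 1[]. *)
Lemma primitive_small (e : R) : 0 < e -> exists2 x : R, 0 < x <= 1 & Phi x < e.
Proof.
move=> e0.
pose F n : set T := `[n.+1%:R^-1, 1[%classic.
have FU : \bigcup_n F n = `]0%R, 1%R[%classic :> set R.
  apply/seteqP; split => t.
    move=> [n _]; rewrite /F/= !in_itv/= => /andP[nt ->]; rewrite andbT.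
    by apply: lt_le_trans nt; rewrite invr_gt0.
  rewrite /= in_itv/= => /andP[t0 t1].
  have [n nt] : exists n : nat, n.+1%:R^-1 < t.
    by have [n] := ltr_add_invr t0; rewrite add0r => nt; exists n.
  by exists n => //; rewrite /F/= in_itv/= t1 ltW.
have F0 n t : F n t -> half_line R t by apply: itvco_half_line; rewrite invr_gt0.
have cvgF : (\int[mu]_(t in F n) (w t)%:E)%E @[n --> \oo] --> (Phi 1)%:E.
  rewrite -primitiveE -FU; apply: ge0_nondecreasing_set_cvg_integral.
  - move=> m n mn; apply/subsetPset; apply: subset_itvr; rewrite bnd_simp.
    by rewrite lef_pV2 ?posrE// ler_nat.
  - by move=> n; exact: measurable_leb_itv.
  - by move=> n; apply/measurable_EFinP/measurable_weight => t /F0.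
  - by move=> n t /F0 /half_lineP t0; rewrite lee_fin ltW// weight_gt0.
have FE n : (\int[mu]_(t in F n) (w t)%:E)%E = (Phi 1 - Phi n.+1%:R^-1)%:E.
  by rewrite primitiveB// ?invr_gt0// invf_le1// ler1n.
have /fine_cvgP[_ ] := cvgF.
rewrite (_ : fine \o _ = (fun n => Phi 1 - Phi n.+1%:R^-1)); last first.
  by apply/funext => n /=; rewrite FE.
move=> /cvgrPdist_lt /(_ e e0)[N _ /(_ N (leqnn _))] /=.
rewrite opprB addrCA subrr addr0 ger0_norm ?primitive_ge0// => PN.
by exists N.+1%:R^-1; rewrite // invr_gt0 ltr0n/= invf_le1// ler1n.
Qed.

(** Near [0] the primitive is small, and elsewhere it is locally Lipschitz, so
    that the intermediate value theorem applies. *)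
Lemma primitive_surj (x y : R) : 0 < x -> 0 < y <= Phi x ->
  exists2 t, 0 < t <= x & Phi t = y.
Proof.
move=> x0 /andP[y0 yx].
have [z /andP[z0 _] zy] := primitive_small y0.
have zx : z <= x.
  rewrite leNgt; apply/negP => /ltW /le_primitive; rewrite leNgt => /negP; apply.
  exact: lt_le_trans yx.
have [l [L [_ L0 lip]]] := primitive_bounds z0 zx.
have cPhi : {within `[z, x], continuous Phi}.
  apply/subspace_continuousP => s; rewrite /= in_itv/= => /andP[zs sx].
  apply/cvgrPdist_le => e e0.
  near=> t.
  have : t \in `[z, x] by near: t; exact: withinT.
  rewrite in_itv/= => /andP[zt tx].
  have st : `|s - t| <= e / L.
    near: t; apply: cvg_within.
    have /cvgrPdist_le : (fun t : R => t) @ s --> s by exact: cvg_id.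
    by apply; rewrite divr_gt0.
  have [ts|/ltW ts] := leP t s.
    have /andP[_] := lip t s zt ts sx.
    rewrite ger0_norm ?subr_ge0 ?le_primitive// => /le_trans; apply.
    by rewrite mulrC -ler_pdivlMr// (le_trans (ler_norm _)).
  have /andP[_] := lip s t zs ts tx.
  rewrite distrC ger0_norm ?subr_ge0 ?le_primitive// => /le_trans; apply.
  by rewrite mulrC -ler_pdivlMr// (le_trans (ler_norm _))// distrC.
have [] := @IVT _ Phi z x y zx cPhi.
  by rewrite min_l ?max_r ?le_primitive// (ltW zy) yx.
move=> t; rewrite in_itv/= => /andP[zt tx] <-.
by exists t => //; rewrite tx (lt_le_trans z0).
Unshelve. all: by end_near. Qed.

Lemma measurable_primitive (D : set T) : measurable_fun D (Phi : T -> R).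
Proof.
have mPhi : measurable_fun setT Phi.
  by apply: nondecreasing_measurable => // x y xy; exact: le_primitive.
exact: (measurable_leb_comp mPhi).
Qed.

(** A sublevel set of the primitive is an interval [[0, t[] with
    [primitive w t = y], unless the primitive stays below [y] altogether. *)
Lemma integral_weight_sublevel (y : R) : 0 < y ->
  (\int[mu]_(t in H `&` [set t | (Phi t < y)%R]) (w t)%:E <= y%:E)%E.
Proof.
move=> y0.
have w0 t : H t -> (0 <= (w t)%:E)%E.
  by move=> /half_lineP t0; rewrite lee_fin ltW// weight_gt0.
have [[x [x0 yx]]|noy] := pselect (exists x : R, 0 < x /\ y <= Phi x).
  have [t /andP[t0 tx] <-] := @primitive_surj x y x0 (introT andP (conj y0 yx)).
  rewrite -primitiveE; apply: le_integral_subset.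
  - move=> s [/half_lineP s0] /= Pst; rewrite in_itv/= s0/= ltNge.
    by apply/negP => /le_primitive; rewrite leNgt Pst.
  - by move=> s [+ _]; exact: w0.
  - by move=> s /itv0_half_line; exact: w0.
  - by [].
apply: (@le_trans _ _ (\int[mu]_(t in H) (w t)%:E)%E).
  by apply: le_integral_subset => // s [Hs _]; exact: w0.
pose F n : set T := `]0%R, n%:R[%classic.
have FU : \bigcup_n F n = H.
  apply/seteqP; split => t; first by move=> [n _] /itv0_half_line.
  move=> /half_lineP t0; exists (Num.truncn t).+1 => //.
  by rewrite /F/= in_itv/= t0/= truncnS_gt.
have F0 n t : F n t -> half_line R t by exact: itv0_half_line.
have cvgF : (\int[mu]_(t in F n) (w t)%:E)%E @[n --> \oo] -->
    (\int[mu]_(t in H) (w t)%:E)%E.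
  rewrite -FU; apply: ge0_nondecreasing_set_cvg_integral.
  - by move=> m n mn; apply/subsetPset; apply: subset_itvl; rewrite bnd_simp ler_nat.
  - by move=> n; exact: measurable_leb_itv.
  - by move=> n; apply/measurable_EFinP/measurable_weight => t /F0.
  - by move=> n t /F0; exact: w0.
rewrite -(cvg_lim _ cvgF)//; apply: lime_le; first by apply/cvg_ex; exists (\int[mu]_(t in H) (w t)%:E)%E.
near=> n; rewrite primitiveE lee_fin leNgt; apply/negP => yn; apply: noy.
exists n%:R; split; last exact: ltW.
rewrite ltNge; apply/negP => n0; move: yn; rewrite ltNge => /negP; apply.
apply: le_trans (ltW y0); apply: (le_trans (le_primitive n0)).
by rewrite -lee_fin -primitiveE set_itvoo0 integral_set0.
Unshelve. all: by end_near. Qed.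

End primitive.

Section power_integrals.
Context {R : realType}.
Notation T := (lebR R).
Notation mu := (leb R).
Notation H := (half_line R : set T).
Context (w : T -> R) (ww : weight w).
Local Notation Phi := (primitive w).

Lemma measurable_weight_power (D : set T) (c : R) : D `<=` H ->
  measurable_fun D (fun t => w t * Phi t `^ c).
Proof.
move=> DH; apply: measurable_funM; first exact: (measurable_weight ww).
exact: (measurableT_comp (measurable_powR c) (measurable_primitive ww (D:=D))).
Qed.

(** The weight between two level sets of its primitive has mass at most the
    upper level, so that a power of the primitive is integrated shell by shell,
    which produces a geometric series. *)
Lemma integral_weight_shells (D : set T) (b c beta : R) :
  measurable D -> D `<=` H -> 0 < b -> 0 < c -> 0 <= beta ->
  b `^ (1 - beta) < 1 ->
  (forall t, D t -> exists k, b ^+ k * c <= Phi t < 2 * (b ^+ k * c)) ->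
  (\int[mu]_(t in D) (w t * Phi t `^ (- beta))%:E <=
    (2 * c `^ (1 - beta) / (1 - b `^ (1 - beta)))%:E)%E.
Proof.
move=> mD DH b0 c0 beta0 b1 Dk.
have w0 t : H t -> 0 < w t by move=> /half_lineP t0; exact: (weight_gt0 ww).
have mPhi := measurable_primitive ww (D := H).
pose G k : set T := H `&` [set t | b ^+ k * c <= Phi t < 2 * (b ^+ k * c)].
have mG k : measurable (G k).
  rewrite (_ : G k = H `&` Phi @^-1` `[b ^+ k * c, 2 * (b ^+ k * c)[%classic).
    by apply: mPhi => //; exact: measurable_itv.
  by apply/seteqP; split => t [Ht] /=; rewrite in_itv.
apply: (integral_geometric_cover mD mG).
- by apply/measurable_EFinP; exact: measurable_weight_power.
- by move=> t /DH Ht; rewrite lee_fin mulr_ge0 ?powR_ge0// ltW// w0.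
- by move=> t Dt; have [k kt] := Dk t Dt; exists k => //; split => //; exact: DH.
- by rewrite mulr_ge0// powR_ge0.
- by rewrite b1 powR_ge0.
move=> k; have bk0 : 0 < b ^+ k * c by rewrite mulr_gt0// exprn_gt0.
apply: (@le_trans _ _ (\int[mu]_(t in H `&` [set t | (Phi t < 2 * (b ^+ k * c))%R])
    (((b ^+ k * c) `^ (- beta))%:E * (w t)%:E))%E).
  apply: le_integral_subset.
  - by move=> t [_ [Ht /andP[_ ?]]].
  - by move=> t [/DH Ht _]; rewrite lee_fin mulr_ge0 ?powR_ge0// ltW// w0.
  - by move=> t [Ht _]; rewrite mule_ge0// lee_fin ?powR_ge0// ltW// w0.
  move=> t [_ [Ht /andP[kt _]]]; rewrite -EFinM lee_fin mulrC.
  apply: ler_wpM2r; first exact/ltW/w0.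
  have P0 : 0 < Phi t by exact: lt_le_trans kt.
  rewrite !powRN lef_pV2 ?posrE ?powR_gt0//.
  by apply: ge0_ler_powR; rewrite ?nnegrE// ltW.
rewrite ge0_integralZl; last 4 first.
- have := mPhi measurable_half_line `]-oo, 2 * (b ^+ k * c)[%classic (measurable_itv _).
  rewrite (_ : Phi @^-1` _ = [set t | Phi t < 2 * (b ^+ k * c)])//.
- by apply/measurable_EFinP; apply: (measurable_weight ww) => // t [].
- by move=> t [Ht _]; rewrite lee_fin ltW// w0.
- by rewrite lee_fin powR_ge0.
apply: (@le_trans _ _ (((b ^+ k * c) `^ (- beta))%:E * (2 * (b ^+ k * c))%:E)%E).
  apply: lee_wpmul2l; first by rewrite lee_fin powR_ge0.
  by apply: (integral_weight_sublevel ww) => //; rewrite mulr_gt0.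
rewrite -EFinM lee_fin.
rewrite [leLHS](_ : _ = 2 * (b ^+ k * c) `^ (1 - beta)); last first.
  by rewrite addrC powRD_gt0// powRr1 ?(ltW bk0)//; ring.
rewrite -mulrA ler_wpM2l// powRM ?exprn_ge0 ?(ltW b0) ?(ltW c0)//.
rewrite mulrC ler_wpM2l ?powR_ge0//.
by rewrite -!powR_mulrn ?(ltW b0) ?powR_ge0// -!powRrM mulrC.
Qed.

(** Shells with ratio [1/2], downwards from the level [c]. *)
Lemma integral_weight_below (D : set T) (c beta : R) :
  measurable D -> D `<=` H -> 0 < c -> 0 <= beta < 1 ->
  (forall t, D t -> Phi t <= c) ->
  (\int[mu]_(t in D) (w t * Phi t `^ (- beta))%:E <=
    (2 * c `^ (1 - beta) / (1 - 2^-1 `^ (1 - beta)))%:E)%E.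
Proof.
move=> mD DH c0 /andP[beta0 beta1] Dc.
apply: integral_weight_shells => //.
  have one : 1 `^ (1 - beta) = 1 :> R by rewrite powR1.
  rewrite -[ltRHS]one.
  by rewrite gt0_ltr_powR ?subr_gt0// ?nnegrE ?invr_ge0// invf_lt1// ltr1n.
move=> t Dt.
have Pt0 : 0 < Phi t by apply: (primitive_gt0 ww); apply/half_lineP; exact: DH.
have exk : exists k, 2^-1 ^+ k * c <= Phi t.
  have [k] : exists k, 2^-1 ^+ k < Phi t / c.
    have /cvgrPdist_lt /(_ (Phi t / c)) : (2^-1 : R) ^+ k @[k --> \oo] --> 0.
      by apply: cvg_expr; rewrite ger0_norm// invf_lt1// ltr1n.
    rewrite divr_gt0// => /(_ isT)[N _ /(_ N (leqnn N))] /=.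
    rewrite sub0r normrN ger0_norm ?exprn_ge0// => ?.
    by exists N.
  by rewrite ltr_pdivlMr// => /ltW; exists k.
case: (ex_minnP exk) => k kt kmin; exists k; rewrite kt/=.
case: k kt kmin => [_ _|k kt kmin].
  by rewrite expr0 mul1r (le_lt_trans (Dc t Dt))// ltr_pMl// ltr1n.
rewrite exprS -!mulrA mulVKf// ltNge; apply/negP => /kmin.
by rewrite ltnn.
Qed.

(** Shells with ratio [2], upwards from the level [c]. *)
Lemma integral_weight_above (D : set T) (c gamma : R) :
  measurable D -> D `<=` H -> 0 < c -> 0 < gamma ->
  (forall t, D t -> c <= Phi t) ->
  (\int[mu]_(t in D) (w t * Phi t `^ (- (1 + gamma)))%:E <=
    (2 * c `^ (- gamma) / (1 - 2 `^ (- gamma)))%:E)%E.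
Proof.
move=> mD DH c0 gamma0 Dc.
have gE : - gamma = 1 - (1 + gamma) by rewrite opprD addNKr.
rewrite gE; apply: integral_weight_shells => //.
- by rewrite addr_ge0// ltW.
- rewrite -gE -[ltRHS](powRr0 2) powRN powRr0 invf_lt1 ?powR_gt0//.
  have one : 1 `^ gamma = 1 :> R by rewrite powR1.
  rewrite -[ltLHS]one; by rewrite gt0_ltr_powR ?nnegrE// ltr1n.
move=> t Dt.
have exk : exists k, Phi t < 2 ^+ k.+1 * c.
  exists (Num.truncn (Phi t / c)).
  rewrite -ltr_pdivrMr//.
  apply: (@lt_le_trans _ _ (Num.truncn (Phi t / c)).+1%:R).
    exact: truncnS_gt.
  by rewrite -natrX ler_nat ltnW// ltn_expl.
case: (ex_minnP exk) => k kt kmin; exists k.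
rewrite mulrA -exprS kt andbT.
case: k kt kmin => [_ _|k kt kmin]; first by rewrite expr0 mul1r Dc.
rewrite leNgt; apply/negP => /kmin.
by rewrite ltnn.
Qed.

End power_integrals.

(** * Hardy's inequalities *)

Section schur_half_line.
Context {R : realType}.
Notation T := (lebR R).
Notation mu := (leb R).
Notation H := (half_line R : set T).
Local Open Scope ereal_scope.

(** Schur's test for a kernel [b(t) a(s)] restricted to [D].  The functions are
    extended to the whole line by [0], and [h], which has to be positive, by [1]. *)
Lemma schur_half_line (D : set (T * T)) (a b h g : T -> R) (q : \bar R) (Q C : R) :
  (1 < Q)%R -> q = Q%:E -> (0 < C)%R -> measurable D ->
  measurable_fun H a -> measurable_fun H b ->
  measurable_fun H h -> measurable_fun H g ->
  (forall x, H x -> 0 < a x)%R -> (forall x, H x -> 0 < b x)%R ->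
  (forall x, H x -> 0 < h x)%R -> (forall x, H x -> 0 <= g x)%R ->
  (forall t, H t -> \int[mu]_(s in H `&` xsection D t) (a s * h s `^ conj_exp q)%:E
     <= (C * h t `^ conj_exp q / b t)%:E) ->
  (forall s, H s -> \int[mu]_(t in H `&` ysection D s) (b t * h t `^ Q)%:E
     <= (C * h s `^ Q / a s)%:E) ->
  Lq_norm q (fun t => (b t)%:E * \int[mu]_(s in H `&` xsection D t) (a s * g s)%:E)
    <= C%:E * Lq_norm q (EFin \o g).
Proof.
move=> Q1 qE C0 mD ma mb mh mg ap bp h0 g0 row col.
have a0 x : H x -> (0 <= a x)%R by move=> /ap/ltW.
have b0 x : H x -> (0 <= b x)%R by move=> /bp/ltW.
have q1 : 1 < q by rewrite qE lte_fin.
have Q0 : (0 < Q)%R by rewrite (lt_trans _ Q1).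
have p0 := conj_exp_gt0 q1.
have pQ : ((conj_exp q)^-1 + Q^-1 = 1)%R.
  by rewrite -(conj_expV q1) qE recip_fin.
pose h' := patch (fun=> 1%R) H h.
have meas_patch (f : T -> R) : measurable_fun H f -> measurable_fun setT (f \_ H)%R.
  by move=> mf; apply/(measurable_restrict _ _ _).1 => //; rewrite setTI.
have HE : (fun t : T => t \in H) @^-1` [set true] = H.
  by apply/seteqP; split => t /=; [exact: set_mem|exact: mem_set].
have mh' : measurable_fun setT h'.
  apply: measurable_fun_if; [exact: measurableT| | |exact: measurable_cst].
    by apply: (@measurable_fun_bool _ _ _ _ true); rewrite HE setTI.
  by rewrite HE setTI.
pose k t s := ((b \_ H) t * (a \_ H) s * \1_D (t, s))%R.
have k_out t s f : ~ H t -> (k t s * f)%R = 0%R.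
  by move=> Ht; rewrite /k /patch memNset// !mul0r.
have k_out' t s f : ~ H s -> (k t s * f)%R = 0%R.
  by move=> Hs; rewrite /k /patch (memNset Hs) mulr0 !mul0r.
have rowE t (f : T -> R) : H t -> (forall s, H s -> 0 <= f s)%R -> measurable_fun H f ->
    \int[mu]_s (k t s * f s)%:E =
    (b t)%:E * \int[mu]_(s in H `&` xsection D t) (a s * f s)%:E.
  move=> Ht f0 mf; rewrite -ge0_integralZl; last 4 first.
  - by apply: measurableI => //; exact: measurable_xsection.
  - apply/measurable_EFinP; apply: measurable_funM;
    by apply: (measurable_funS measurable_half_line _ _) => // s [].
  - by move=> s [Hs _]; rewrite lee_fin mulr_ge0 ?a0 ?f0.
  - by rewrite lee_fin b0.
  rewrite [RHS]integral_mkcond; apply: eq_integral => s _.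
  rewrite {1}/patch; case: ifPn => [/set_mem[Hs Ds]|].
    rewrite /k /patch !mem_set// indicE mem_set; last by move: Ds; rewrite /xsection/= inE.
    by rewrite mulr1 -EFinM mulrA.
  rewrite notin_setE => /not_andP[Hs|Ds]; first by rewrite k_out'.
  rewrite /k indicE memNset ?mulr0 ?mul0r//; move: Ds.
  by rewrite /xsection/= inE.
have colE s (f : T -> R) : H s -> (forall t, H t -> 0 <= f t)%R -> measurable_fun H f ->
    \int[mu]_t (k t s * f t)%:E =
    (a s)%:E * \int[mu]_(t in H `&` ysection D s) (b t * f t)%:E.
  move=> Hs f0 mf; rewrite -ge0_integralZl; last 4 first.
  - by apply: measurableI => //; exact: measurable_ysection.
  - apply/measurable_EFinP; apply: measurable_funM;
    by apply: (measurable_funS measurable_half_line _ _) => // t [].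
  - by move=> t [Ht _]; rewrite lee_fin mulr_ge0 ?b0 ?f0.
  - by rewrite lee_fin a0.
  rewrite [RHS]integral_mkcond; apply: eq_integral => t _.
  rewrite {1}/patch; case: ifPn => [/set_mem[Ht Dt]|].
    rewrite /k /patch !mem_set// indicE mem_set; last by move: Dt; rewrite /ysection/= inE.
    by rewrite mulr1 -EFinM; congr EFin; rewrite mulrA [(b t * _)%R]mulrC.
  rewrite notin_setE => /not_andP[Ht|Dt]; first by rewrite k_out.
  rewrite /k indicE memNset ?mulr0 ?mul0r//; move: Dt.
  by rewrite /ysection/= inE.
have hE t : H t -> h' t = h t by move=> Ht; rewrite /h' /patch mem_set.
have nn (f : T -> R) t : (forall x, H x -> 0 <= f x)%R -> (0 <= (f \_ H)%R t)%R.
  by move=> f0; rewrite /patch; case: ifPn => // /set_mem/f0.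
have h'0 t : (0 < h' t)%R by rewrite /h' /patch; case: ifPn => // /set_mem/h0.
have mpow (f : T -> R) c : measurable_fun H f -> measurable_fun H (fun t => f t `^ c)%R.
  exact: (measurableT_comp (measurable_powR c)).
have := @schur_test _ T R mu D (a \_ H)%R (b \_ H)%R h' (g \_ H)%R (conj_exp q) Q C
  p0 Q0 pQ C0 mD (meas_patch _ ma) (meas_patch _ mb) mh' (meas_patch _ mg)
  (fun x => nn _ x a0) (fun x => nn _ x b0) h'0 (fun x => nn _ x g0).
rewrite -/k => /(_ _ _)/wrap[].
- move=> t; have [Ht|Ht] := pselect (H t); last first.
    under eq_integral do rewrite k_out//.
    by rewrite integral0 lee_fin mulr_ge0 ?powR_ge0 ?(ltW C0).
  rewrite (eq_integral (fun s => (k t s * h s `^ conj_exp q)%:E)); last first.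
    move=> s _; have [Hs|Hs] := pselect (H s); last by rewrite !k_out'.
    by rewrite hE.
  rewrite (rowE t (fun s => h s `^ conj_exp q)%R Ht); last 2 first.
  - by move=> s _; exact: powR_ge0.
  - exact: (mpow h).
  rewrite (hE _ Ht).
  apply: (le_trans (lee_wpmul2l _ (row t Ht))); first by rewrite lee_fin b0.
  by rewrite -EFinM lee_fin mulrC mulfVK// gt_eqF// bp.
- move=> s; have [Hs|Hs] := pselect (H s); last first.
    under eq_integral do rewrite k_out'//.
    by rewrite integral0 lee_fin mulr_ge0 ?powR_ge0 ?(ltW C0).
  rewrite (eq_integral (fun t => (k t s * h t `^ Q)%:E)); last first.
    move=> t _; have [Ht|Ht] := pselect (H t); last by rewrite !k_out.
    by rewrite hE.
  rewrite (colE s (fun t => h t `^ Q)%R Hs); last 2 first.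
  - by move=> t _; exact: powR_ge0.
  - exact: (mpow h).
  rewrite (hE _ Hs).
  apply: (le_trans (lee_wpmul2l _ (col s Hs))); first by rewrite lee_fin a0.
  by rewrite -EFinM lee_fin mulrC mulfVK// gt_eqF// ap.
move=> S; rewrite qE.
have int0 t : H t -> 0 <= (b t)%:E * \int[mu]_(s in H `&` xsection D t) (a s * g s)%:E.
  move=> Ht; rewrite mule_ge0 ?lee_fin ?b0//.
  by apply: integral_ge0 => s [Hs _]; rewrite lee_fin mulr_ge0 ?a0 ?g0.
rewrite !Lq_norm_fin//.
have -> : C%:E = (C `^ Q)%:E `^ Q^-1.
  by rewrite poweR_EFin -powRrM divff ?gt_eqF// powRr1// ltW.
rewrite -poweRM ?lee_fin ?powR_ge0//; last first.
  by apply: integral_ge0 => s _; rewrite poweR_ge0.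
apply: le_poweR; first by rewrite invr_ge0 ltW.
  by apply: integral_ge0 => s _; rewrite poweR_ge0.
apply: le_trans (le_trans S _).
  apply: (@le_integral_subset _ _ _ mu H setT) => // t; try by rewrite ?poweR_ge0.
  move=> Ht; rewrite -rowE//; apply: le_poweR; first exact: ltW.
    apply: integral_ge0 => s _; have [Hs|Hs] := pselect (H s); last by rewrite k_out'.
    by rewrite lee_fin mulr_ge0 ?g0// !mulr_ge0 ?nn.
  apply: le_integral_on => s _.
    have [Hs|Hs] := pselect (H s); last by rewrite k_out'.
    by rewrite lee_fin mulr_ge0 ?g0// !mulr_ge0 ?nn.
  have [Hs|Hs] := pselect (H s); last by rewrite !k_out'.
  by rewrite [(g \_ H)%R s]/patch mem_set.
apply: lee_wpmul2l; first by rewrite lee_fin powR_ge0.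
rewrite [leRHS]integral_mkcond; apply: (@le_integral_on _ _ _ mu setT) => t _.
  by rewrite lee_fin powR_ge0.
rewrite /patch; case: ifPn => // _.
by rewrite powR0 ?gt_eqF.
Qed.

End schur_half_line.

Section hardy.
Context {R : realType}.
Notation T := (lebR R).
Notation mu := (leb R).
Notation H := (half_line R : set T).

Let measurable_leb_fst : measurable_fun setT (fun z : T * T => z.1 : R).
Proof.
exact: (measurable_comp measurableT (@subsetT _ _)
  (measurable_leb_id (D := setT)) measurable_fst).
Qed.

Let measurable_leb_snd : measurable_fun setT (fun z : T * T => z.2 : R).
Proof.
exact: (measurable_comp measurableT (@subsetT _ _)
  (measurable_leb_id (D := setT)) measurable_snd).
Qed.

Lemma measurable_snd_lt_fst : measurable [set z : T * T | (z.2 : R) < z.1].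
Proof.
have := measurable_fun_ltr measurable_leb_snd measurable_leb_fst.
by move=> /(_ measurableT [set true] I); rewrite setTI.
Qed.

Lemma measurable_fst_le_snd : measurable [set z : T * T | (z.1 : R) <= z.2].
Proof.
have := measurable_fun_ler measurable_leb_fst measurable_leb_snd.
by move=> /(_ measurableT [set true] I); rewrite setTI.
Qed.

Lemma xsection_lt (t : T) :
  H `&` xsection [set z : T * T | (z.2 : R) < z.1] t = `]0%R, (t : R)[%classic.
Proof.
apply/seteqP; split => s; rewrite /xsection/= in_itv/= inE/=.
  by move=> [/half_lineP -> ->].
by move=> /andP[s0 st]; split=> //; apply/half_lineP.
Qed.

Lemma xsection_le (t : T) : H t ->
  H `&` xsection [set z : T * T | (z.1 : R) <= z.2] t = `[(t : R), +oo[%classic.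
Proof.
move=> /half_lineP t0; apply/seteqP; split => s; rewrite /xsection/= in_itv/= inE/= andbT.
  by move=> [_ ->].
by move=> ts; split=> //; apply/half_lineP; exact: lt_le_trans ts.
Qed.

(** Hardy's inequality for the averages with respect to the measure [w dt]:
    Schur's test with the function [(w / primitive w)^(1/(q q'))]. *)
Lemma hardy_below (q : \bar R) (w : T -> R) : (1 < q)%E -> weight w ->
  exists2 C : R, 0 < C & forall g : T -> R,
    measurable_fun H g -> (forall t, H t -> 0 <= g t) ->
  (Lq_norm q (fun t => (w t `^ recip q * (primitive w t)^-1)%:E *
     \int[mu]_(s in (`]0%R, (t : R)[%classic : set R)) (w s `^ (conj_exp q)^-1 * g s)%:E)
   <= C%:E * Lq_norm q (EFin \o g))%E.
Proof.
move=> q1 ww; have [mw _ _] := ww.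
have p0 := conj_exp_gt0 q1.
have w0 t : H t -> 0 < w t by move=> /half_lineP t0; exact: (weight_gt0 ww).
have P0 t : H t -> 0 < primitive w t.
  by move=> /half_lineP t0; exact: (primitive_gt0 ww).
have mP := measurable_primitive ww (D := H).
have mpow (f : T -> R) c : measurable_fun H f ->
    measurable_fun H (fun t => f t `^ c).
  exact: (measurableT_comp (measurable_powR c)).
case: (exponentP q1) => [[Q Q1 qE]|qE]; last first.
  exists 1 => // g mg g0; rewrite mul1e qE recip_y conj_exp_y invr1.
  have g0' t : H t -> (0 <= (EFin \o g) t)%E by move=> Ht; rewrite lee_fin g0.
  have [->|/Lq_norm_finite[gE M0]] := eqVneq (Lq_norm +oo (EFin \o g)) +oo%E.
    by rewrite leey.
  have int0 t : H t -> (0 <= (w t `^ 0 * (primitive w t)^-1)%:E *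
      \int[mu]_(s in (`]0%R, (t : R)[%classic : set R)) (w s `^ 1 * g s)%:E)%E.
    move=> Ht; rewrite mule_ge0//.
      by rewrite lee_fin mulr_ge0 ?powR_ge0// invr_ge0 ltW// P0.
    apply: integral_ge0 => s /itv0_half_line Hs.
    by rewrite lee_fin mulr_ge0 ?powR_ge0// g0.
  apply/Lq_norm_yP => //; first exact: Lq_norm_ge0.
  apply/nearW => t Ht; rewrite powRr0 mul1r.
  have DH := @itv0_half_line R t.
  have := @hoelder_Lq R +oo%E (`]0%R, (t : R)[%classic : set R) g w (ltry 1)
    (measurable_leb_itv _) DH mg (measurable_weight ww DH) g0
    (fun s Ds => ltW (w0 s (DH s Ds))).
  rewrite conj_exp_y invr1 poweRe1; last first.
    by apply: integral_ge0 => s Ds; rewrite lee_fin powR_ge0.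
  under [X in (_ <= _ * X)%E]eq_integral => s /set_mem /DH Hs
    do rewrite powRr1 ?(ltW (w0 s Hs))//.
  rewrite (primitiveE ww) => h.
  rewrite gE in h *.
  rewrite (_ : \int[mu]_(s in _) _ = \int[mu]_(s in (`]0%R, (t : R)[%classic : set R)) (g s * w s)%:E)%E; last first.
    apply: eq_integral => s /set_mem /DH Hs.
    by rewrite powRr1 ?(ltW (w0 s Hs))// mulrC.
  apply: (le_trans (lee_wpmul2l _ h)); first by rewrite lee_fin invr_ge0 ltW// P0.
  by rewrite -!EFinM lee_fin mulrC mulfK// gt_eqF// P0.
have Q0 : 0 < Q by rewrite (lt_trans _ Q1).
have rE : recip q = Q^-1 by rewrite qE recip_fin.
have r1 : recip q < 1 by exact: recip_lt1.
have r0 : 0 < recip q by rewrite rE invr_gt0.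
have pV : 1 - recip q = (conj_exp q)^-1 by rewrite -(conj_expV q1) addrK.
have pV0 : 0 < (conj_exp q)^-1 by rewrite invr_gt0.
pose C1 := 2 / (1 - 2^-1 `^ (1 - recip q)) : R.
pose C2 := 2 / (1 - 2 `^ (- (conj_exp q)^-1)) : R.
have C10 : 0 < C1.
  rewrite divr_gt0// subr_gt0.
  have one : 1 `^ (1 - recip q) = 1 :> R by rewrite powR1.
  by rewrite -[ltRHS]one gt0_ltr_powR ?subr_gt0// ?nnegrE ?invr_ge0// invf_lt1// ltr1n.
have C20 : 0 < C2.
  rewrite divr_gt0// subr_gt0 powRN invf_lt1 ?powR_gt0//.
  have one : 1 `^ (conj_exp q)^-1 = 1 :> R by rewrite powR1.
  by rewrite -[ltLHS]one gt0_ltr_powR ?nnegrE// ltr1n.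
exists (C1 + C2); first exact: addr_gt0.
move=> g mg g0.
pose h t := (w t / primitive w t) `^ (Q^-1 * (conj_exp q)^-1).
have hp t : h t `^ conj_exp q = (w t / primitive w t) `^ recip q.
  by rewrite /h -powRrM mulfVK ?rE// gt_eqF.
have hQ t : h t `^ Q = (w t / primitive w t) `^ (conj_exp q)^-1.
  by rewrite /h -powRrM mulrAC mulVf ?mul1r// gt_eqF.
have divP t c : H t -> (w t / primitive w t) `^ c = w t `^ c * primitive w t `^ (- c).
  move=> Ht; rewrite powRM ?invr_ge0 ?(ltW (w0 _ Ht)) ?(ltW (P0 _ Ht))//.
  by rewrite -powR_inv1 ?(ltW (P0 _ Ht))// -powRrM mulN1r.
have rp : (conj_exp q)^-1 + recip q = 1 by exact: conj_expV.
have mh : measurable_fun H h.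
  apply: (mpow (fun t => w t / primitive w t)); apply: measurable_funM; first exact: mw.
  apply: (eq_measurable_fun (fun t : T => primitive w t `^ (-1))); last exact: (mpow _ _ mP).
  by move=> t /set_mem Ht; rewrite powR_inv1 ?(ltW (P0 _ Ht)).
have mb : measurable_fun H (fun t => w t `^ recip q * (primitive w t)^-1).
  apply: measurable_funM; first exact: (mpow _ _ mw).
  apply: (eq_measurable_fun (fun t : T => primitive w t `^ (-1))); last exact: (mpow _ _ mP).
  by move=> t /set_mem Ht; rewrite powR_inv1 ?(ltW (P0 _ Ht)).
have b0 t : H t -> 0 < w t `^ recip q * (primitive w t)^-1.
  by move=> Ht; rewrite mulr_gt0 ?powR_gt0 ?w0// invr_gt0 P0.
have a0 t : H t -> 0 < w t `^ (conj_exp q)^-1 by move=> Ht; rewrite powR_gt0 ?w0.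
have := @schur_half_line R _ _ _ h g q Q (C1 + C2) Q1 qE (addr_gt0 C10 C20)
  measurable_snd_lt_fst (mpow w (conj_exp q)^-1 mw) mb mh mg
  a0 b0.
move=> /(_ (fun t Ht => powR_gt0 _ (divr_gt0 (w0 t Ht) (P0 t Ht))) g0).
have xE : (fun t => (w t `^ recip q * (primitive w t)^-1)%:E *
    \int[mu]_(s in H `&` xsection [set z : T * T | ((z.2 : R) < z.1)%R] t)
      (w s `^ (conj_exp q)^-1 * g s)%:E)%E =
  (fun t : T => (w t `^ recip q * (primitive w t)^-1)%:E *
     \int[mu]_(s in (`]0%R, (t : R)[%classic : set R)) (w s `^ (conj_exp q)^-1 * g s)%:E)%E.
  by apply/funext => t; rewrite xsection_lt.
rewrite xE; apply.
- move=> t Ht; rewrite xsection_lt.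
  rewrite (eq_integral (fun s => (w s * primitive w s `^ (- recip q))%:E)); last first.
    move=> s /set_mem /itv0_half_line Hs; congr EFin.
    rewrite hp divP// mulrA -powRD_gt0 ?w0//.
    by rewrite rp powRr1// ltW// w0.
  have := @integral_weight_below R w ww (`]0%R, (t : R)[%classic : set R) (primitive w t) (recip q)
    (measurable_leb_itv _) (@itv0_half_line R t) (P0 t Ht).
  rewrite (ltW r0) r1 => /(_ isT) h1; apply: (le_trans (h1 _)).
    by move=> s; rewrite /= in_itv/= => /andP[_ /ltW]; exact: (le_primitive ww).
  rewrite lee_fin hp divP//.
  rewrite [leRHS](_ : _ = (C1 + C2) * primitive w t `^ (1 - recip q)); last first.
    rewrite addrC powRD_gt0 ?P0// powRr1 ?(ltW (P0 _ Ht))//.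
    have wr0 : w t `^ recip q != 0 by rewrite gt_eqF// powR_gt0 ?w0.
    have Pn0 : primitive w t != 0 by rewrite gt_eqF ?P0.
    by field; rewrite wr0 Pn0.
  rewrite mulrAC ler_wpM2r ?powR_ge0//.
  by rewrite lerDl ltW.
move=> s Hs.
have yE : H `&` ysection [set z : T * T | (z.2 : R) < z.1] s = `](s : R), +oo[%classic.
  move/half_lineP: Hs => s0; apply/seteqP; split => t; rewrite /ysection/= in_itv/= inE/= andbT.
    by move=> [_ ->].
  by move=> st; split=> //; apply/half_lineP; exact: lt_trans st.
have DH : (`](s : R), +oo[%classic : set R) `<=` H by rewrite -yE => t [].
rewrite yE.
rewrite (eq_integral (fun t => (w t * primitive w t `^ (- (1 + (conj_exp q)^-1)))%:E)); last first.
  move=> t /set_mem /DH Ht; congr EFin.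
  rewrite hQ divP// mulrACA -powRD_gt0 ?w0//.
  rewrite addrC rp powRr1 ?(ltW (w0 _ Ht))// opprD powRD_gt0 ?P0//.
  by rewrite powR_inv1// ltW// P0.
have := @integral_weight_above R w ww (`](s : R), +oo[%classic : set R) (primitive w s) (conj_exp q)^-1
  (measurable_leb_itv _) DH (P0 s Hs) pV0.
move=> h1; apply: (le_trans (h1 _)).
  by move=> t; rewrite /= in_itv/= andbT => /ltW; exact: (le_primitive ww).
rewrite lee_fin hQ divP//.
rewrite [leRHS](_ : _ = (C1 + C2) * primitive w s `^ (- (conj_exp q)^-1)); last first.
  rewrite -mulrA; congr *%R; rewrite mulrAC divff ?mul1r//.
  by rewrite gt_eqF// a0.
rewrite mulrAC ler_wpM2r ?powR_ge0//.
by rewrite lerDr ltW.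
Qed.

End hardy.

Section hardy_above.
Context {R : realType}.
Notation T := (lebR R).
Notation mu := (leb R).
Notation H := (half_line R : set T).

Lemma integral_one (x : R) : 0 <= x ->
  (\int[mu]_(t in (`]0%R, x[%classic : set R)) (1 : R)%:E = x%:E)%E.
Proof.
move=> x0; rewrite integral_cst; last exact: measurable_leb_itv.
rewrite mul1e [LHS](leb_itv `]0, x[)/= lte_fin sube0.
by case: ltP => // x0'; rewrite (@le_anti _ _ x 0) ?x0 ?x0'.
Qed.

(** The weight [1] has the primitive [x], so that integrals of powers are
    instances of the integrals of powers of a primitive. *)
Lemma weight_one : weight (fun=> 1 : R).
Proof.
split; first exact: measurable_cst.
  by move=> x y _ _; exists 1, 1; split => // t _ _; rewrite lexx.
by move=> x x0; rewrite integral_one ?ltry// ltW.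
Qed.

Lemma primitive_one (x : R) : 0 < x -> primitive (fun=> 1) x = x.
Proof. by move=> x0; rewrite /primitive integral_one// ltW. Qed.

Lemma integral_powR_below (s : R) : 0 < s ->
  (\int[mu]_(t in (`]0%R, s]%classic : set R)) ((t : R) `^ (- 2^-1))%:E <=
   (2 / (1 - 2^-1 `^ 2^-1) * s `^ 2^-1)%:E)%E.
Proof.
move=> s0; have DH : `]0%R, s]%classic `<=` half_line R.
  by move=> t /=; rewrite in_itv/= => /andP[t0 _]; apply/half_lineP.
have hE : 1 - 2^-1 = 2^-1 :> R by rewrite {1}[1](splitr 1) div1r addrK.
have := @integral_weight_below R _ weight_one (`]0%R, s]%classic : set R) s 2^-1
  (measurable_leb_itv _) DH s0.
rewrite invr_ge0 invf_lt1// ltr1n ler0n/= hE => /(_ isT) h.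
apply: le_trans (le_trans (h _) _); last by rewrite mulrAC.
  apply: le_integral_on => t /DH /half_lineP t0; first by rewrite lee_fin powR_ge0.
  by rewrite mul1r primitive_one.
by move=> t Dt; rewrite primitive_one; [move: Dt; rewrite /= in_itv/= => /andP[]|
   exact/half_lineP/DH].
Qed.

Lemma integral_powR_above (s : R) : 0 < s ->
  (\int[mu]_(t in (`[s, +oo[%classic : set R)) ((t : R) `^ (- (1 + 2^-1)))%:E <=
   (2 / (1 - 2 `^ (- 2^-1)) * s `^ (- 2^-1))%:E)%E.
Proof.
move=> s0; have DH : `[s, +oo[%classic `<=` half_line R.
  by move=> t /=; rewrite in_itv/= andbT => st; apply/half_lineP/(lt_le_trans s0).
have := @integral_weight_above R _ weight_one (`[s, +oo[%classic : set R) s 2^-1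
  (measurable_leb_itv _) DH s0.
rewrite invr_gt0 ltr0n => /(_ isT) h.
apply: le_trans (le_trans (h _) _); last by rewrite mulrAC.
  apply: le_integral_on => t /DH /half_lineP t0; first by rewrite lee_fin powR_ge0.
  by rewrite mul1r primitive_one.
by move=> t Dt; rewrite primitive_one; [move: Dt; rewrite /= in_itv/= => /andP[]|
   exact/half_lineP/DH].
Qed.

(** Schur's test with the function [t^(-1/(q q'))]; the exponent [1/2] leaves room
    for the growth of slowly varying functions. *)
Lemma hardy_above (q : \bar R) : (1 < q)%E ->
  exists2 C : R, 0 < C & forall g : T -> R,
    measurable_fun H g -> (forall t, H t -> 0 <= g t) ->
  (Lq_norm q (fun t => ((t : R) `^ ((conj_exp q)^-1 - 2^-1))%:E *
     \int[mu]_(s in (`[(t : R), +oo[%classic : set R))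
        ((s : R) `^ (- (conj_exp q)^-1 - 2^-1) * g s)%:E)
   <= C%:E * Lq_norm q (EFin \o g))%E.
Proof.
move=> q1; have p0 := conj_exp_gt0 q1.
pose C1 := 2 / (1 - 2^-1 `^ 2^-1) : R.
pose C2 := 2 / (1 - 2 `^ (- 2^-1)) : R.
have one : 1 `^ 2^-1 = 1 :> R by rewrite powR1.
have C10 : 0 < C1.
  rewrite divr_gt0// subr_gt0.
  by rewrite -[ltRHS]one gt0_ltr_powR ?invr_gt0// ?nnegrE ?invr_ge0// invf_lt1// ltr1n.
have C20 : 0 < C2.
  rewrite divr_gt0// subr_gt0 powRN invf_lt1 ?powR_gt0//.
  by rewrite -[ltLHS]one gt0_ltr_powR ?nnegrE ?invr_gt0// ltr1n.
have C0 : 0 < C1 + C2 by exact: addr_gt0.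
exists (C1 + C2) => // g mg g0.
have g0' t : H t -> (0 <= (EFin \o g) t)%E by move=> Ht; rewrite lee_fin g0.
have DH (t : T) : H t -> `[(t : R), +oo[%classic `<=` half_line R.
  move=> /half_lineP t0 s /=; rewrite in_itv/= andbT => ts.
  by apply/half_lineP/(lt_le_trans t0).
have mpw (c : R) (D : set T) : measurable_fun D (fun t : T => (t : R) `^ c).
  exact: measurable_leb_powR.
have F0 t : H t -> (0 <= ((t : R) `^ ((conj_exp q)^-1 - 2^-1))%:E *
     \int[mu]_(s in (`[(t : R), +oo[%classic : set R))
        ((s : R) `^ (- (conj_exp q)^-1 - 2^-1) * g s)%:E)%E.
  move=> Ht; rewrite mule_ge0 ?lee_fin ?powR_ge0//.
  by apply: integral_ge0 => s /(DH _ Ht) Hs; rewrite lee_fin mulr_ge0 ?powR_ge0 ?g0.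
case: (exponentP q1) => [[Q Q1 qE]|qE]; last first.
  rewrite qE in F0 *.
  have [->|/Lq_norm_finite[gE M0]] := eqVneq (Lq_norm +oo (EFin \o g)) +oo%E.
    by rewrite gt0_muley ?leey// lte_fin.
  apply/Lq_norm_yP => //; first by rewrite mule_ge0 ?Lq_norm_ge0// lee_fin ltW.
  apply/nearW => t Ht; rewrite conj_exp_y invr1.
  have t0 : 0 < (t : R) by exact/half_lineP.
  have hE : 1 - 2^-1 = 2^-1 :> R by rewrite {1}[1](splitr 1) div1r addrK.
  rewrite hE -opprD.
  have := @hoelder_Lq R +oo%E (`[(t : R), +oo[%classic : set R) g
    (fun s => (s : R) `^ (- (1 + 2^-1))) (ltry 1)
    (measurable_leb_itv _) (DH _ Ht) mg (mpw _ _) g0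
    (fun s Ds => powR_ge0 _ _).
  rewrite conj_exp_y invr1 poweRe1; last first.
    by apply: integral_ge0 => s Ds; rewrite lee_fin powR_ge0.
  have e1 : (\int[mu]_(s in (`[(t : R), +oo[%classic : set R))
      (((s : R) `^ (- (1 + 2^-1))) `^ 1)%:E =
      \int[mu]_(s in (`[(t : R), +oo[%classic : set R))
      ((s : R) `^ (- (1 + 2^-1)))%:E)%E.
    by apply: eq_integral => s _; rewrite powRr1 ?powR_ge0.
  rewrite e1.
  move=> h.
  rewrite (_ : \int[mu]_(s in _) _ = \int[mu]_(s in (`[(t : R), +oo[%classic : set R))
      (g s * (s : R) `^ (- (1 + 2^-1)))%:E)%E; last first.
    by apply: eq_integral => s _; rewrite mulrC.
  apply: (le_trans (lee_wpmul2l _ h)); first by rewrite lee_fin powR_ge0.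
  rewrite gE; apply: (@le_trans _ _ (((t : R) `^ 2^-1)%:E *
     ((fine (Lq_norm +oo (EFin \o g)))%:E * (C2 * (t : R) `^ (- 2^-1))%:E))%E).
    apply: lee_wpmul2l; first by rewrite lee_fin powR_ge0.
    by apply: lee_wpmul2l => //; exact: integral_powR_above.
  rewrite -!EFinM lee_fin [leLHS](_ : _ = C2 * fine (Lq_norm +oo (EFin \o g))); last first.
    rewrite powRN.
    have tn : (t : R) `^ 2^-1 != 0 by rewrite gt_eqF// powR_gt0.
    by field.
  by rewrite ler_wpM2r// lerDr ltW.
have Q0 : 0 < Q by rewrite (lt_trans _ Q1).
have rE : recip q = Q^-1 by rewrite qE recip_fin.
have pV : (conj_exp q)^-1 = 1 - recip q by rewrite -(conj_expV q1) addrK.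
pose h (t : T) := (t : R) `^ (- (Q^-1 * (conj_exp q)^-1)).
have hp (t : T) : h t `^ conj_exp q = (t : R) `^ (- recip q).
  by rewrite /h -powRrM mulNr mulfVK ?rE// gt_eqF.
have hQ (t : T) : h t `^ Q = (t : R) `^ (- (conj_exp q)^-1).
  by rewrite /h -powRrM mulNr mulrAC mulVf ?mul1r// gt_eqF.
have pw0 c (t : T) : H t -> 0 < (t : R) `^ c by move=> /half_lineP ?; rewrite powR_gt0.
have := @schur_half_line R _ (fun s => (s : R) `^ (- (conj_exp q)^-1 - 2^-1))
  (fun t => (t : R) `^ ((conj_exp q)^-1 - 2^-1)) h g q Q (C1 + C2) Q1 qE C0
  measurable_fst_le_snd (mpw _ _) (mpw _ _) (mpw _ _) mg
  (pw0 _) (pw0 _) (pw0 _) g0.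
move=> S.
apply: le_trans (S _ _).
- by apply: le_Lq_norm => // t Ht; rewrite xsection_le.
- move=> t Ht; rewrite xsection_le//; have t0 : 0 < (t : R) by exact/half_lineP.
  rewrite (eq_integral (fun s : T => ((s : R) `^ (- (1 + 2^-1)))%:E)); last first.
    move=> s /set_mem /(DH _ Ht) /half_lineP s0; congr EFin.
    by rewrite hp -powRD_gt0//; congr (_ `^ _); rewrite pV; ring.
  apply: (le_trans (integral_powR_above t0)).
  rewrite lee_fin -/C2 hp.
  rewrite [leRHS](_ : _ = (C1 + C2) * (t : R) `^ (- 2^-1)); last first.
    rewrite -mulrA -powRN -powRD_gt0//; by congr (_ * _ `^ _); rewrite pV; field.
  by rewrite ler_wpM2r ?powR_ge0// lerDr ltW.
move=> s Hs; have s0 : 0 < (s : R) by exact/half_lineP.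
have yE : H `&` ysection [set z : T * T | (z.1 : R) <= z.2] s = `]0%R, (s : R)]%classic.
  apply/seteqP; split => t; rewrite /ysection/= in_itv/= inE/=.
    by move=> [/half_lineP -> ->].
  by move=> /andP[t0 ts]; split=> //; apply/half_lineP.
rewrite yE.
rewrite (eq_integral (fun t : T => ((t : R) `^ (- 2^-1))%:E)); last first.
  move=> t /set_mem; rewrite /= in_itv/= => /andP[t0 _]; congr EFin.
  by rewrite hQ -powRD_gt0//; congr (_ `^ _); ring.
apply: (le_trans (integral_powR_below s0)).
rewrite lee_fin -/C1 hQ.
rewrite [leRHS](_ : _ = (C1 + C2) * (s : R) `^ 2^-1); last first.
  rewrite -mulrA -powRN -powRD_gt0//; congr (_ * _ `^ _).
  by field; rewrite gt_eqF.
by rewrite ler_wpM2r ?powR_ge0// lerDl ltW.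
Qed.

End hardy_above.

(** * Level intervals of a primitive *)

Section level_points.
Context {R : realType}.
Notation T := (lebR R).
Notation mu := (leb R).
Notation H := (half_line R : set T).
Context (w : T -> R) (ww : weight w).
Local Notation Phi := (primitive w).

(** The values of the primitive are halved at each step, so that the masses of
    the level intervals decrease geometrically. *)
Definition level_points (tau : nat -> R) : Prop :=
  tau 0%N = 1 /\ forall k, 0 < tau k /\ Phi (tau k) = 2^-1 ^+ k * Phi 1.

Lemma level_points_exist : exists tau, level_points tau.
Proof.
have P1 : 0 < Phi 1 by exact: (primitive_gt0 ww).
have ex k : exists t, 0 < t <= 1 /\ Phi t = 2^-1 ^+ k * Phi 1.
  have [|t t01 tE] := @primitive_surj R w ww 1 (2^-1 ^+ k * Phi 1) ltr01.
    rewrite mulr_gt0 ?exprn_gt0//= ler_piMl ?(ltW P1)// exprn_ile1//.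
    by rewrite invf_le1// ler1n.
  by exists t.
have [tau tauP] := choice ex; exists tau; split; last first.
  by move=> k; have [/andP[? _] ?] := tauP k.
have [/andP[t0 +]] := tauP 0%N; rewrite le_eqVlt => /predU1P[//|t1].
rewrite expr0 mul1r => PE.
by have := primitive_lt ww t0 t1; rewrite PE ltxx.
Qed.

Context (tau : nat -> R) (tauP : level_points tau).

Definition level_interval (k : nat) : set T := `[tau k.+1, tau k[%classic.

Let P1 : 0 < Phi 1. Proof. exact: (primitive_gt0 ww). Qed.

Lemma level_point_gt0 k : 0 < tau k. Proof. by have [] := tauP.2 k. Qed.

Lemma level_point_primitive k : Phi (tau k) = 2^-1 ^+ k * Phi 1.
Proof. by have [] := tauP.2 k. Qed.

Lemma lt_level_point k : tau k.+1 < tau k.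
Proof.
rewrite ltNge; apply/negP => /(le_primitive ww).
rewrite !level_point_primitive leNgt exprS -mulrA => /negP; apply.
by rewrite gtr_pMl ?mulr_gt0 ?exprn_gt0// invf_lt1// ltr1n.
Qed.

Lemma le_level_point j k : (j <= k)%N -> tau k <= tau j.
Proof.
move=> /subnK <-; elim: (k - j)%N => [|n IHn]; first by rewrite add0n.
by rewrite addSn (le_trans _ IHn)// ltW// lt_level_point.
Qed.

Lemma level_point_le1 k : tau k <= 1.
Proof. by rewrite -tauP.1; exact: le_level_point. Qed.

Lemma level_point_small (t : R) : 0 < t -> exists k, tau k <= t.
Proof.
move=> t0; have Pt : 0 < Phi t by exact: (primitive_gt0 ww).
have [k] : exists k, 2^-1 ^+ k < Phi t / Phi 1.
  have /cvgrPdist_lt /(_ (Phi t / Phi 1)) : (2^-1 : R) ^+ k @[k --> \oo] --> 0.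
    by apply: cvg_expr; rewrite ger0_norm// invf_lt1// ltr1n.
  rewrite divr_gt0// => /(_ isT)[N _ /(_ N (leqnn N))] /=.
  rewrite sub0r normrN ger0_norm ?exprn_ge0// => ?.
  by exists N.
rewrite ltr_pdivlMr// -level_point_primitive => Pk; exists k.
rewrite leNgt; apply/negP => /ltW /(le_primitive ww).
by rewrite leNgt Pk.
Qed.

Lemma level_interval_half_line k : level_interval k `<=` H.
Proof. by apply: itvco_half_line; exact: level_point_gt0. Qed.

Lemma measurable_level_interval k : measurable (level_interval k).
Proof. exact: measurable_leb_itv. Qed.

Lemma level_interval_cover (t : R) : 0 < t < 1 -> exists k, level_interval k t.
Proof.
move=> /andP[t0 t1].
have ex : exists k, tau k.+1 <= t.
  have [k kt] := level_point_small t0; exists k.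
  exact: le_trans (ltW (lt_level_point _)) kt.
case: (ex_minnP ex) => k kt kmin; exists k; rewrite /level_interval/= in_itv/= kt/=.
case: k kt kmin => [_ _|k kt kmin]; first by rewrite tauP.1.
by rewrite ltNge; apply/negP => /kmin; rewrite ltnn.
Qed.

Lemma level_interval_inj (t : R) j k :
  level_interval j t -> level_interval k t -> j = k.
Proof.
wlog jk : j k / (j <= k)%N.
  by move=> wl tj tk; case/orP: (leq_total j k) => h; [|symmetry]; apply: wl.
rewrite /level_interval/= !in_itv/= => /andP[jt _] /andP[_ tk].
apply/eqP; rewrite eqn_leq jk/= leqNgt; apply/negP => /le_level_point.
by rewrite leNgt (le_lt_trans jt tk).
Qed.

Lemma integral_level_interval k :
  (\int[mu]_(t in level_interval k) (w t)%:E = (2^-1 ^+ k.+1 * Phi 1)%:E)%E.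
Proof.
rewrite (primitiveB ww); [|exact: level_point_gt0|exact/ltW/lt_level_point].
rewrite !level_point_primitive; congr EFin.
by rewrite exprS; field.
Qed.

Let wPhi_ge0 (q : \bar R) (kappa : T -> R) t : (forall s, H s -> 0 <= kappa s) ->
  H t -> (0 <= (w t `^ recip q * (Phi t)^-1 * kappa t)%:E)%E.
Proof.
move=> k0 Ht; rewrite lee_fin !mulr_ge0 ?powR_ge0 ?k0//.
by rewrite invr_ge0 (primitive_ge0 ww).
Qed.

Lemma ae_witness (A : set T) (P : T -> Prop) : measurable A -> (0 < mu A)%E ->
  {ae mu, forall t, P t} -> exists2 t, A t & P t.
Proof.
move=> mA A0 aeP; apply: contrapT => noP.
have : mu.-negligible A.
  apply: negligibleS aeP => t At Pt; apply: noP; by exists t.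
by move=> /(measure_negligible mA) A0'; move: A0; rewrite A0' ltxx.
Qed.

(** On [[x, y[] the function is at least [w^(1/q) kappa(x) / Phi(y)], whose norm
    there is explicit. *)
Lemma Lq_norm_primitive_ge (q : \bar R) (kappa : T -> R) (x y M : R) :
  (1 < q)%E -> 0 < x -> x < y -> 0 <= M -> (forall t, H t -> 0 <= kappa t) ->
  (forall t : R, x <= t -> kappa x <= kappa t) ->
  (Lq_norm q (fun t => (w t `^ recip q * (Phi t)^-1 * kappa t)%:E) <= M%:E)%E ->
  kappa x * (Phi y - Phi x) `^ recip q <= M * Phi y.
Proof.
move=> q1 x0 xy M0 k0 kmono normM.
have y0 : 0 < y by exact: lt_trans xy.
have Py : 0 < Phi y by exact: (primitive_gt0 ww).
have kx : 0 <= kappa x by apply: k0; exact/half_lineP.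
have DH := @itvco_half_line R x y x0.
have Plt (t : T) : `[x, y[%classic t -> 0 < Phi t <= Phi y.
  move=> Dt; rewrite (primitive_gt0 ww); last exact/half_lineP/DH.
  by apply: (le_primitive ww); move: Dt; rewrite /= in_itv/= => /andP[_ /ltW].
have kle (t : T) : `[x, y[%classic t -> kappa x <= kappa t.
  by rewrite /= in_itv/= => /andP[xt _]; exact: kmono.
have f0 t := @wPhi_ge0 q kappa t k0.
case: (exponentP q1) => [[Q Q1 qE]|qE]; last first.
  rewrite qE in normM f0; have /(Lq_norm_yP _ f0) := normM.
  rewrite lee_fin => /(_ M0) aeM.
  have mass0 : (0 < mu `[x, y[%classic)%E.
    by rewrite (leb_itvco (ltW xy)) lte_fin subr_gt0.
  have [t Dt] := ae_witness (measurable_leb_itv _) mass0 aeM.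
  move=> /(_ (DH _ Dt)); rewrite recip_y powRr0 mul1r lee_fin => tM.
  rewrite qE recip_y powRr0 mulr1.
  have /andP[Pt0 Pty] := Plt t Dt.
  apply: (le_trans (kle t Dt)).
  move: tM; rewrite mulrC ler_pdivrMr// => /le_trans; apply.
  by rewrite ler_wpM2l.
have Q0 : 0 < Q by rewrite (lt_trans _ Q1).
rewrite qE in normM f0; move: normM => /(Lq_norm_finP Q1 M0 f0) normM.
rewrite qE recip_fin//.
suff : (kappa x / Phi y) `^ Q * (Phi y - Phi x) <= M `^ Q.
  have d0 : 0 <= Phi y - Phi x by rewrite subr_ge0 (le_primitive ww)// ltW.
  move=> /(@ge0_ler_powR _ Q^-1 _ _ _ _ _); rewrite invr_ge0 (ltW Q0) !nnegrE.
  rewrite mulr_ge0 ?powR_ge0// => /(_ isT isT isT).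
  rewrite powRM ?powR_ge0// -!powRrM divff ?gt_eqF// !powRr1//; last first.
    by rewrite divr_ge0// ltW.
  by rewrite mulrAC ler_pdivrMr.
rewrite -lee_fin EFinM -(primitiveB ww x0 (ltW xy)).
apply: le_trans normM.
rewrite -ge0_integralZl; last 4 first.
- exact: measurable_leb_itv.
- by apply/measurable_EFinP; apply: (measurable_weight ww).
- by move=> t /DH /half_lineP t0; rewrite lee_fin ltW// (weight_gt0 ww).
- by rewrite lee_fin powR_ge0.
apply: le_integral_subset => //.
- move=> t /DH /half_lineP t0; rewrite mule_ge0 ?lee_fin ?powR_ge0//.
  by rewrite ltW// (weight_gt0 ww).
- by move=> t Ht; rewrite poweR_ge0.
move=> t Dt; have /half_lineP t0 := DH t Dt.
have w0 : 0 < w t by exact: (weight_gt0 ww).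
have /andP[Pt0 Pty] := Plt t Dt.
have kt0 : 0 <= (Phi t)^-1 * kappa t.
  by rewrite mulr_ge0 ?invr_ge0 ?(ltW Pt0)// k0//; exact: DH.
rewrite recip_fin// poweR_EFin -EFinM lee_fin -mulrA [leRHS]powRM ?powR_ge0//.
rewrite -powRrM mulVf ?gt_eqF// powRr1 ?(ltW w0)// mulrC ler_wpM2l ?(ltW w0)//.
apply: ge0_ler_powR; rewrite ?nnegrE ?(ltW Q0)//.
- by rewrite divr_ge0// ltW.
rewrite mulrC ler_pM ?invr_ge0 ?(ltW Py)//; last exact: kle.
by rewrite lef_pV2 ?posrE.
Qed.

(** The value of a non-decreasing function at the left end of a level interval is
    at most its values on that interval, which has four times the mass of the one
    two steps below. *)
Lemma Lq_norm_level_shift (q : \bar R) (kappa F : T -> R) (M : R) :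
  (1 < q)%E -> 0 <= M ->
  measurable_fun H kappa -> (forall t, H t -> 0 <= kappa t) ->
  (forall s t : R, 0 < s -> s <= t -> kappa s <= kappa t) ->
  (Lq_norm q (fun t => (w t `^ recip q * (Phi t)^-1 * kappa t)%:E) <= M%:E)%E ->
  measurable_fun H F -> (forall t, H t -> 0 <= F t) ->
  (forall k t, level_interval k.+2 t ->
    F t <= w t `^ recip q * (2^-1 ^+ k.+3 * Phi 1)^-1 * kappa (tau k.+1)) ->
  (forall t, H t -> (forall k, ~ level_interval k.+2 t) -> F t = 0) ->
  (Lq_norm q (EFin \o F) <= (8 * M)%:E)%E.
Proof.
move=> q1 M0 mk k0 kmono normM mF F0 FE Fout.
have f0 t := @wPhi_ge0 q kappa t k0.
have F0' t : H t -> (0 <= (EFin \o F) t)%E by move=> Ht; rewrite lee_fin F0.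
(* [2^-k Phi(1)] bounds the primitive on [level_interval k] from above, and
   [2^-(k+3) Phi(1)] is the mass of the interval two steps below. *)
have pow8 k : (2^-1 ^+ k.+3 * Phi 1)^-1 = 8 * (2^-1 ^+ k * Phi 1)^-1.
  have P1n : Phi 1 != 0 by rewrite gt_eqF.
  have e0 : (2^-1 : R) ^+ k != 0 by rewrite expf_neq0.
  by rewrite !exprS; field; rewrite P1n e0.
case: (exponentP q1) => [[Q Q1 qE]|qE]; last first.
  have key k : kappa (tau k.+1) <= M * Phi (tau k).
    have := @Lq_norm_primitive_ge q kappa (tau k.+1) (tau k) M q1
      (level_point_gt0 _) (lt_level_point k) M0 k0
      (fun t => kmono _ t (level_point_gt0 _)) normM.
    by rewrite qE recip_y powRr0 mulr1.
  rewrite qE; apply/Lq_norm_yP => //; first by rewrite lee_fin mulr_ge0.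
  apply/nearW => t Ht; rewrite lee_fin.
  have [[k tk]|nok] := pselect (exists k, level_interval k.+2 t); last first.
    by rewrite Fout ?mulr_ge0// => k tk; apply: nok; exists k.
  apply: (le_trans (FE _ _ tk)); rewrite qE recip_y powRr0 mul1r pow8 -mulrA.
  rewrite ler_wpM2l// -level_point_primitive mulrC ler_pdivrMr ?key//.
  exact/(primitive_gt0 ww)/level_point_gt0.
have Q0 : 0 < Q by rewrite (lt_trans _ Q1).
rewrite qE in normM f0 FE *; rewrite recip_fin// in normM f0 FE.
move: normM => /(Lq_norm_finP Q1 M0 f0) normM.
apply/Lq_norm_finP => //; first by rewrite mulr_ge0.
pose g t := ((w t `^ Q^-1 * (Phi t)^-1 * kappa t)%:E `^ Q)%E.
have g0 t : H t -> (0 <= g t)%E by move=> Ht; exact: poweR_ge0.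
have mg : measurable_fun H g.
  apply: (measurableT_comp (measurable_poweR Q)); apply/measurable_EFinP.
  apply: measurable_funM; last exact: mk.
  apply: measurable_funM.
    exact: (measurableT_comp (measurable_powR _) (measurable_weight ww (@subset_refl _ _))).
  apply: (eq_measurable_fun (fun t : T => Phi t `^ (-1))).
    by move=> t _; rewrite powR_inv1// (primitive_ge0 ww).
  exact: (measurableT_comp (measurable_powR _) (measurable_primitive ww (D := H))).
have step k : (\int[mu]_(t in level_interval k.+2) ((EFin \o F) t `^ Q) <=
    (8 `^ Q)%:E * \int[mu]_(t in level_interval k) g t)%E.
  pose K := ((2^-1 ^+ k * Phi 1)^-1 * kappa (tau k.+1)) `^ Q.
  have kk0 : 0 <= kappa (tau k.+1) by apply: k0; exact/half_lineP/level_point_gt0.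
  have ck0 : 0 < 2^-1 ^+ k * Phi 1 by rewrite mulr_gt0 ?exprn_gt0.
  have K0 : 0 <= K by exact: powR_ge0.
  have mid j (c : R) : 0 <= c -> (\int[mu]_(t in level_interval j) (c%:E * (w t)%:E) =
      (c * (2^-1 ^+ j.+1 * Phi 1))%:E)%E.
    move=> c0; rewrite ge0_integralZl; last 4 first.
    - exact: measurable_level_interval.
    - apply/measurable_EFinP; apply: (measurable_weight ww).
      exact: level_interval_half_line.
    - move=> t /level_interval_half_line /half_lineP t0.
      by rewrite lee_fin ltW// (weight_gt0 ww).
    - by rewrite lee_fin.
    by rewrite integral_level_interval EFinM.
  apply: (@le_trans _ _ (\int[mu]_(t in level_interval k.+2) ((8 `^ Q * K)%:E * (w t)%:E))%E).
    apply: le_integral_on => t tk; first exact: poweR_ge0.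
    have Ht := level_interval_half_line tk.
    have w0 : 0 < w t by apply: (weight_gt0 ww); exact/half_lineP.
    rewrite poweR_EFin -EFinM lee_fin.
    have := FE _ _ tk; rewrite pow8 => /(@ge0_ler_powR _ Q (ltW Q0) _ _ _ _)/le_trans -> //.
    - by rewrite nnegrE F0.
    - by rewrite nnegrE !mulr_ge0 ?powR_ge0// invr_ge0 ltW.
    rewrite -mulrA powRM ?powR_ge0//; last first.
      by rewrite !mulr_ge0// invr_ge0 ltW.
    rewrite -powRrM mulVf ?gt_eqF// powRr1 ?(ltW w0)// -mulrA powRM//; last first.
      by rewrite mulr_ge0// invr_ge0 ltW.
    by rewrite mulrC.
  rewrite mid ?mulr_ge0 ?powR_ge0//.
  apply: (@le_trans _ _ ((8 `^ Q)%:E * \int[mu]_(t in level_interval k) (K%:E * (w t)%:E))%E).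
    rewrite mid// -EFinM lee_fin -mulrA.
    apply: ler_wpM2l; first exact: powR_ge0.
    apply: ler_wpM2l => //; apply: ler_wpM2r; first exact: ltW.
    apply: ler_wiXn2l (leqW (leqnSn _)); first by rewrite invr_ge0.
    by rewrite invf_le1// ler1n.
  apply: lee_wpmul2l; first by rewrite lee_fin powR_ge0.
  apply: le_integral_on => t tk; have Ht := level_interval_half_line tk.
    rewrite mule_ge0 ?lee_fin// ltW// (weight_gt0 ww)//; exact/half_lineP.
  have t0 : 0 < (t : R) by exact/half_lineP.
  have w0 : 0 < w t by exact: (weight_gt0 ww).
  have Pt0 : 0 < Phi t by exact: (primitive_gt0 ww).
  have kt0 : 0 <= (Phi t)^-1 * kappa t by rewrite mulr_ge0 ?invr_ge0 ?(ltW Pt0)// k0.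
  rewrite /g poweR_EFin -EFinM lee_fin -mulrA [leRHS]powRM ?powR_ge0//.
  rewrite -powRrM mulVf ?gt_eqF// powRr1 ?(ltW w0)// mulrC ler_wpM2l ?(ltW w0)//.
  move: tk; rewrite /level_interval/= in_itv/= => /andP[kt tk].
  apply: ge0_ler_powR; rewrite ?nnegrE ?(ltW Q0)//.
  - by rewrite mulr_ge0// invr_ge0 ltW.
  apply: ler_pM => //; first by rewrite invr_ge0 ltW.
    rewrite lef_pV2 ?posrE// -level_point_primitive.
    exact/(le_primitive ww)/ltW.
  by apply: kmono => //; exact: level_point_gt0.
have mU (j : nat) : measurable (\bigcup_k level_interval (k + j)).
  by apply: bigcup_measurable => k _; exact: measurable_level_interval.
have UH j : \bigcup_k level_interval (k + j) `<=` H.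
  by move=> t [k _]; exact: level_interval_half_line.
have tU j : trivIset [set: nat] (fun k => level_interval (k + j)).
  apply/trivIsetP => m n _ _ /eqP mn; rewrite -subset0 => t [tm tn]; apply: mn.
  by apply/eqP; rewrite -(eqn_add2r j); apply/eqP; exact: level_interval_inj tm tn.
apply: (@le_trans _ _ (\int[mu]_(t in \bigcup_k level_interval (k + 2))
    ((EFin \o F) t `^ Q))%E).
  rewrite integral_mkcond [leRHS]integral_mkcond.
  apply: (@le_integral_on _ _ _ mu setT) => t _; rewrite /patch.
    by case: ifPn => // _; exact: poweR_ge0.
  case: ifPn => [/set_mem Ht|_]; last by case: ifPn => // _; exact: poweR_ge0.
  case: ifPn => //; rewrite notin_setE => nU.
  rewrite /= Fout; first by rewrite powR0 ?gt_eqF.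
    by [].
  by move=> k tk; apply: nU; exists k; rewrite // addn2.
rewrite ge0_integral_bigcup; last 4 first.
- by move=> k; exact: measurable_level_interval.
- apply: (measurableT_comp (measurable_poweR Q)); apply/measurable_EFinP.
  exact: (measurable_funS measurable_half_line (UH 2%N) mF).
- by move=> t _; exact: poweR_ge0.
- exact: tU.
apply: (@le_trans _ _ ((8 `^ Q)%:E * \int[mu]_(t in \bigcup_k level_interval (k + 0)) g t)%E).
  rewrite ge0_integral_bigcup; last 4 first.
  - by move=> k; exact: measurable_level_interval.
  - exact: (measurable_funS measurable_half_line (UH 0%N) mg).
  - by move=> t /UH; exact: g0.
  - exact: tU.
  rewrite -nneseriesZl; last first.
    move=> k _; apply: integral_ge0 => t /level_interval_half_line; exact: g0.
  apply: lee_nneseries => k.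
    by move=> _ _; apply: integral_ge0 => t _; exact: poweR_ge0.
  by move=> _; rewrite addn2 addn0; exact: step.
rewrite powRM// EFinM; apply: lee_wpmul2l; first by rewrite lee_fin powR_ge0.
apply: le_trans normM; apply: le_integral_subset => //.
by move=> t /UH; exact: g0.
Qed.

End level_points.

(** * Slowly varying weights *)

Section slowly_varying_weights.
Context {R : realType}.
Notation T := (lebR R).
Notation mu := (leb R).
Notation H := (half_line R : set T).
Implicit Types (q : \bar R) (v : R -> R).

(** Slow variation in its quantitative form: between [s] and [t] the function
    changes by at most an arbitrarily small power of [t / s]. *)
Lemma slowly_varying_bounds v (e : R) : slowly_varying v -> 0 < e ->
  exists2 C : R, 0 < C & forall s t : R, 0 < s -> s <= t ->
    v s <= C * (t / s) `^ e * v t /\ v t <= C * (t / s) `^ e * v s.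
Proof.
move=> [v0 _ sv] e0; have [[g gi [c [D [c0 D0 gE]]]] [h hd [c' [D' [c'0 D'0 hE]]]]] := sv e e0.
have CD : 0 < D / c by rewrite divr_gt0.
have CD' : 0 < D' / c' by rewrite divr_gt0.
exists (D / c + D' / c'); first by rewrite addr_gt0.
move=> s t s0 st; have t0 : 0 < t by exact: lt_le_trans st.
have [cgs sDg] := gE s ((half_lineP s).2 s0).
have [cgt tDg] := gE t ((half_lineP t).2 t0).
have [chs sDh] := hE s ((half_lineP s).2 s0).
have [cht tDh] := hE t ((half_lineP t).2 t0).
have tsE : (t / s) `^ e = t `^ e * s `^ (- e).
  rewrite powRM ?invr_ge0 ?(ltW s0) ?(ltW t0)//.
  by rewrite -powR_inv1 ?(ltW s0)// -powRrM mulN1r.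
have ps : s `^ e * s `^ (- e) = 1 by rewrite -powRD_gt0// subrr powRr0.
have pt : t `^ e * t `^ (- e) = 1 by rewrite -powRD_gt0// subrr powRr0.
rewrite tsE; split.
  apply: (@le_trans _ _ (D / c * (t `^ e * s `^ (- e)) * v t)); last first.
    rewrite ler_wpM2r ?(ltW (v0 _ t0))// ler_wpM2r ?mulr_ge0 ?powR_ge0//.
    by rewrite lerDl ltW.
  have : s `^ e * v s <= D / c * (t `^ e * v t).
    apply: (le_trans sDg); apply: (@le_trans _ _ (D * g t)).
      by rewrite ler_wpM2l ?(ltW D0)// gi.
    rewrite -mulrA ler_wpM2l ?(ltW D0)// mulrC ler_pdivlMr//.
    by rewrite mulrC.
  move=> /(ler_wpM2l (powR_ge0 s (- e))).
  rewrite [leLHS]mulrA [s `^ (- e) * s `^ e]mulrC ps mul1r => /le_trans; apply.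
  by rewrite le_eqVlt; apply/orP; left; apply/eqP; ring.
apply: (@le_trans _ _ (D' / c' * (t `^ e * s `^ (- e)) * v s)); last first.
  rewrite ler_wpM2r ?(ltW (v0 _ s0))// ler_wpM2r ?mulr_ge0 ?powR_ge0//.
  by rewrite lerDr ltW.
have : t `^ (- e) * v t <= D' / c' * (s `^ (- e) * v s).
  apply: (le_trans tDh); apply: (@le_trans _ _ (D' * h s)).
    by rewrite ler_wpM2l ?(ltW D'0)// hd.
  rewrite -mulrA ler_wpM2l ?(ltW D'0)// mulrC ler_pdivlMr//.
  by rewrite mulrC.
move=> /(ler_wpM2l (powR_ge0 t e)).
rewrite [leLHS]mulrA pt mul1r => /le_trans; apply.
by rewrite le_eqVlt; apply/orP; left; apply/eqP; ring.
Qed.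

Lemma slowly_varying_locally_bounded v (x y : R) :
  slowly_varying v -> 0 < x -> x <= y ->
  exists l L : R, [/\ 0 < l, 0 < L & forall t : R, x <= t -> t <= y -> l <= v t <= L].
Proof.
move=> sv x0 xy; have [v0 _ _] := sv.
have [C C0 bd] := slowly_varying_bounds sv ltr01.
have y0 : 0 < y by exact: lt_le_trans xy.
have k0 : 0 < C * (y / x) by rewrite mulr_gt0// divr_gt0.
exists (v x / (C * (y / x))), (C * (y / x) * v x); split.
- by rewrite divr_gt0// v0.
- by rewrite mulr_gt0// v0.
move=> t xt ty; have t0 : 0 < t by exact: lt_le_trans xt.
have [h1 h2] := bd x t x0 xt; rewrite powRr1 in h1 h2; last by rewrite divr_ge0// ltW.
have Ctx : C * (t / x) <= C * (y / x).
  by rewrite ler_wpM2l ?(ltW C0)// ler_wpM2r// invr_ge0 ltW.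
rewrite ler_pdivrMr// mulrC (le_trans h1) ?(le_trans h2)//.
  by rewrite ler_wpM2r// ltW// v0.
by rewrite ler_wpM2r// ltW// v0.
Qed.

(** The density of the measure that governs the Hardy inequalities. *)
Definition sv_density q v (t : R) : R := t^-1 * v t `^ (- conj_exp q).

Lemma measurable_slowly_varying v (D : set T) : slowly_varying v -> D `<=` H ->
  measurable_fun D (v : T -> R).
Proof. by move=> [_ mv _] DH; exact: (measurable_funS measurable_half_line DH). Qed.

Lemma measurable_sv_density q v : slowly_varying v ->
  measurable_fun H (sv_density q v : T -> R).
Proof.
move=> sv; apply: measurable_funM; first exact: measurable_leb_inv.
exact: (measurableT_comp (measurable_powR _) (measurable_slowly_varying sv (@subset_refl _ _))).
Qed.

Lemma sv_density_locally_bounded q v : (1 < q)%E -> slowly_varying v ->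
  locally_bounded_weight (sv_density q v).
Proof.
move=> q1 sv x y x0 xy; have [l [L [l0 L0 lL]]] := slowly_varying_locally_bounded sv x0 xy.
have p0 := conj_exp_gt0 q1; have y0 : 0 < y by exact: lt_le_trans xy.
exists (y^-1 * L `^ (- conj_exp q)), (x^-1 * l `^ (- conj_exp q)); split.
- by rewrite mulr_gt0 ?invr_gt0 ?powR_gt0.
- by rewrite mulr_gt0 ?invr_gt0 ?powR_gt0.
move=> t xt ty; have t0 : 0 < t by exact: lt_le_trans xt.
have /andP[lt tL] := lL t xt ty; have v0 : 0 < v t by exact: lt_le_trans lt.
apply/andP; split; apply: ler_pM; rewrite ?invr_ge0 ?(ltW y0) ?(ltW t0) ?powR_ge0//.
- by rewrite lef_pV2 ?posrE.
- rewrite !powRN lef_pV2 ?posrE ?powR_gt0//.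
  by apply: ge0_ler_powR; rewrite ?nnegrE ?(ltW p0) ?(ltW v0) ?(ltW L0).
- by rewrite lef_pV2 ?posrE.
- rewrite !powRN lef_pV2 ?posrE ?powR_gt0//.
  by apply: ge0_ler_powR; rewrite ?nnegrE ?(ltW p0) ?(ltW v0) ?(ltW l0).
Qed.

(** Away from [0] the density is bounded, so that finiteness near [0] is
    enough. *)
Lemma sv_density_weight q v : (1 < q)%E -> slowly_varying v ->
  (weight_integral q v `]0%R, 1%R[ < +oo)%E -> weight (sv_density q v).
Proof.
move=> q1 sv fin1; have lw := sv_density_locally_bounded q1 sv.
have mw := measurable_sv_density q sv; have [v0 _ _] := sv.
have w0 t : H t -> (0 <= (sv_density q v t)%:E)%E.
  by move=> /half_lineP t0; rewrite lee_fin mulr_ge0 ?powR_ge0// invr_ge0 ltW.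
split=> // x x0; have [x1|/ltW x1] := leP x 1.
  apply: le_lt_trans fin1; apply: le_integral_subset.
  - by apply: subset_itvl; rewrite bnd_simp.
  - by move=> t /itv0_half_line; exact: w0.
  - by move=> t /itv0_half_line; exact: w0.
  - by [].
have sE : `]0%R, x[%classic = `]0%R, 1%R[%classic `|` `[1%R, x[%classic :> set R.
  by rewrite -itv_bndbnd_setU// bnd_simp.
rewrite sE ge0_integral_setU; last 5 first.
- exact: measurable_leb_itv.
- exact: measurable_leb_itv.
- rewrite -sE; apply/measurable_EFinP.
  exact: (measurable_funS measurable_half_line (@itv0_half_line _ x)).
- by rewrite -sE => t /itv0_half_line; exact: w0.
- apply/disj_setPS => t [] /=; rewrite !in_itv/= => /andP[_ t1] /andP[t1' _].
  by have := lt_le_trans t1 t1'; rewrite ltxx.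
have [l [L [_ L0 lL]]] := lw 1 x ltr01 x1.
apply: lte_add_pinfty; first exact: fin1.
apply: (@le_lt_trans _ _ (\int[mu]_(t in (`[1%R, x[%classic : set R)) L%:E)%E).
  apply: le_integral_on => t Dt.
    by apply: w0; exact: itvco_half_line Dt.
  rewrite lee_fin; move: Dt; rewrite /= in_itv/= => /andP[t1 tx].
  by have /andP[] := lL t t1 (ltW tx).
rewrite integral_cst; last exact: measurable_leb_itv.
by rewrite [X in (_ * X)%E](leb_itvco x1) -EFinM ltry.
Qed.

Context (q : \bar R) (q1 : (1 < q)%E).
Local Notation p := (conj_exp q).
Local Notation r := (recip q).

Definition weighted_norm v (phi : T -> R) : \bar R :=
  Lq_norm q (fun t => ((t : R) `^ (- r) * v t * phi t)%:E).

Let p0 : 0 < p. Proof. exact: conj_exp_gt0. Qed.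

Lemma weighted_measurable v (phi : T -> R) (D : set T) :
  slowly_varying v -> D `<=` H -> measurable_fun D phi ->
  measurable_fun D (fun t : T => (t : R) `^ (- r) * v t * phi t).
Proof.
move=> sv DH mphi; apply: measurable_funM; last exact: mphi.
apply: measurable_funM; first exact: measurable_leb_powR.
exact: measurable_slowly_varying.
Qed.

(** Hoelder's inequality, with [t^-1 phi = (t^(-1/q) v phi) (t^(-1/q') v^-1)]. *)
Lemma integral_le_weighted_norm v (phi : T -> R) (D : set T) :
  slowly_varying v -> measurable D -> D `<=` H ->
  measurable_fun H phi -> (forall t, H t -> 0 <= phi t) ->
  (\int[mu]_(t in D) ((t : R)^-1 * phi t)%:E <=
    weighted_norm v phi * (\int[mu]_(t in D) (sv_density q v t)%:E) `^ p^-1)%E.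
Proof.
move=> sv mD DH mphi phi0; have [v0 _ _] := sv.
have v0' t : H t -> 0 < v t by move=> /half_lineP; exact: v0.
have t0' (t : T) : H t -> 0 < (t : R) by move=> /half_lineP.
have := @hoelder_Lq R q D (fun t : T => (t : R) `^ (- r) * v t * phi t)
  (fun t => (t : R) `^ (- p^-1) * v t `^ (-1)) q1 mD DH
  (weighted_measurable sv (@subset_refl _ _) mphi).
have mG : measurable_fun D (fun t : T => (t : R) `^ (- p^-1) * v t `^ (-1)).
  apply: measurable_funM; first exact: measurable_leb_powR.
  exact: (measurableT_comp (measurable_powR _) (measurable_slowly_varying sv DH)).
move=> /(_ mG)h.
have -> : (\int[mu]_(t in D) (sv_density q v t)%:E =
    \int[mu]_(t in D) (((t : R) `^ (- p^-1) * v t `^ (-1)) `^ p)%:E)%E.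
  apply: eq_integral => t /set_mem /DH Ht; congr EFin.
  rewrite powRM ?powR_ge0// -!powRrM mulN1r mulNr mulVf ?gt_eqF//.
  by rewrite powR_inv1// ltW// t0'.
have -> : (\int[mu]_(t in D) ((t : R)^-1 * phi t)%:E =
    \int[mu]_(t in D) ((t : R) `^ (- r) * v t * phi t *
      ((t : R) `^ (- p^-1) * v t `^ (-1)))%:E)%E.
  apply: eq_integral => t /set_mem /DH Ht; congr EFin.
  have vt := v0' t Ht.
  rewrite powR_inv1 ?(ltW vt)//.
  rewrite (_ : _ * v t * phi t * _ = (t : R) `^ (- r) * (t : R) `^ (- p^-1) *
     (v t / v t) * phi t); last by ring.
  rewrite divff ?gt_eqF// mulr1 -powRD_gt0 ?t0'//.
  rewrite -opprD addrC (conj_expV q1) powR_inv1// ltW//; exact: t0'.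
apply: h.
- by move=> t Ht; rewrite !mulr_ge0 ?powR_ge0 ?(ltW (v0' t Ht)) ?phi0.
- by move=> t Dt; rewrite mulr_ge0 ?powR_ge0.
Qed.

(** Hoelder's inequality again: the additional factor [t^-1] outweighs the slowly
    varying [v^-1] at infinity. *)
Lemma integral_le_weighted_norm_above v : slowly_varying v ->
  exists2 C : R, 0 < C & forall phi : T -> R,
    measurable_fun H phi -> (forall t, H t -> 0 <= phi t) ->
  (\int[mu]_(t in (`[1%R, +oo[%classic : set R)) ((t : R)^-1 * ((t : R)^-1 * phi t))%:E <=
    C%:E * weighted_norm v phi)%E.
Proof.
move=> sv; have [v0 _ _] := sv.
have v1 : 0 < v 1 by exact: v0.
have DH : `[1%R, +oo[%classic `<=` half_line R.
  by move=> t /=; rewrite in_itv/= andbT => t1; apply/half_lineP/(lt_le_trans ltr01).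
have h12 : 0 < 2^-1 :> R by rewrite invr_gt0.
have [C C0 bd] := slowly_varying_bounds sv h12.
have [K K0 KE] : exists2 K : R, 0 < K & K = C / v 1.
  by exists (C / v 1); rewrite // divr_gt0.
pose C2 := 2 / (1 - 2 `^ (- 2^-1)) : R.
have C20 : 0 < C2.
  have one : 1 `^ 2^-1 = 1 :> R by rewrite powR1.
  rewrite divr_gt0// subr_gt0 powRN invf_lt1 ?powR_gt0//.
  by rewrite -[ltLHS]one gt0_ltr_powR ?nnegrE// ltr1n.
exists ((K `^ p * C2) `^ p^-1); first by rewrite powR_gt0// mulr_gt0// powR_gt0.
move=> phi mphi phi0; rewrite muleC.
have t0' (t : T) : `[1%R, +oo[%classic t -> 0 < (t : R) by move=> /DH /half_lineP.
have v0' (t : T) : H t -> 0 < v t by move=> /half_lineP; exact: v0.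
have := @hoelder_Lq R q `[1%R, +oo[%classic (fun t : T => (t : R) `^ (- r) * v t * phi t)
  (fun t => (t : R) `^ (- p^-1 - 1) * v t `^ (-1)) q1 (measurable_leb_itv _) DH
  (weighted_measurable sv (@subset_refl _ _) mphi).
have mG : measurable_fun (`[1%R, +oo[%classic : set T)
    (fun t : T => (t : R) `^ (- p^-1 - 1) * v t `^ (-1)).
  apply: measurable_funM; first exact: measurable_leb_powR.
  exact: (measurableT_comp (measurable_powR _) (measurable_slowly_varying sv DH)).
move=> /(_ mG _ _)h; apply: le_trans (le_trans (h _ _) _).
- apply: le_integral_on => t Dt; have t0 := t0' t Dt.
    by rewrite lee_fin !mulr_ge0 ?invr_ge0 ?(ltW t0)// phi0//; exact: DH.
  have vt : 0 < v t by apply: v0'; exact: DH.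
  rewrite lee_fin [leRHS](_ : _ = (t : R) `^ (- r) * (t : R) `^ (- p^-1 - 1) *
     (v t * v t `^ (-1)) * phi t); last by ring.
  rewrite powR_inv1 ?(ltW vt)// divff ?gt_eqF// mulr1 -powRD_gt0//.
  rewrite addrA -opprD addrC [r + _]addrC (conj_expV q1) powRD_gt0//.
  by rewrite powR_inv1 ?(ltW t0)// mulrA.
- by move=> t Ht; rewrite !mulr_ge0 ?powR_ge0 ?(ltW (v0' t Ht)) ?phi0.
- by move=> t Dt; rewrite mulr_ge0 ?powR_ge0.
apply: lee_wpmul2l; first exact: Lq_norm_ge0.
rewrite -poweR_EFin; apply: le_poweR; first by rewrite invr_ge0 ltW.
  by apply: integral_ge0 => t _; rewrite lee_fin powR_ge0.
apply: (@le_trans _ _ (\int[mu]_(t in (`[1%R, +oo[%classic : set R))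
    ((K `^ p)%:E * ((t : R) `^ (- (1 + 2^-1)))%:E))%E).
  apply: le_integral_on => t Dt; first by rewrite lee_fin powR_ge0.
  have t0 := t0' t Dt; have t1 : 1 <= (t : R) by move: Dt; rewrite /= in_itv/= andbT.
  have vt : 0 < v t by exact: v0.
  rewrite -EFinM lee_fin.
  have vV : v t `^ (-1) <= K * (t : R) `^ 2^-1.
    have [+ _] := bd 1 t ltr01 t1; rewrite divr1 => h1.
    rewrite powR_inv1 ?(ltW vt)// invf_ple ?posrE//; last by rewrite (mulr_gt0 K0)// powR_gt0.
    rewrite [leLHS](_ : _ = v 1 / (C * (t : R) `^ 2^-1)); last first.
      by rewrite KE; field; rewrite !gt_eqF ?powR_gt0.
    by rewrite ler_pdivrMr ?mulr_gt0 ?powR_gt0// mulrC.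
  apply: (@le_trans _ _ (((t : R) `^ (- p^-1 - 1) * (K * (t : R) `^ 2^-1)) `^ p)).
    apply: ge0_ler_powR; rewrite ?nnegrE ?(ltW p0)//.
    - by rewrite mulr_ge0 ?powR_ge0.
    - by rewrite !mulr_ge0 ?powR_ge0// ltW.
    by rewrite ler_wpM2l ?powR_ge0.
  rewrite mulrCA powRM ?(ltW K0) ?mulr_ge0 ?powR_ge0// ler_wpM2l ?powR_ge0//.
  rewrite -powRD_gt0// -powRrM ler_powR//.
  have -> : (- p^-1 - 1 + 2^-1) * p = - 1 - p / 2.
    by field; rewrite gt_eqF.
  rewrite opprD lerD2l lerN2 -[leLHS]mul1r ler_wpM2r ?(ltW h12)//.
  exact: conj_exp_ge1.
rewrite ge0_integralZl; last 4 first.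
- exact: measurable_leb_itv.
- by apply/measurable_EFinP; exact: measurable_leb_powR.
- by move=> t _; rewrite lee_fin powR_ge0.
- by rewrite lee_fin powR_ge0.
rewrite EFinM; apply: lee_wpmul2l; first by rewrite lee_fin powR_ge0.
by apply: (le_trans (integral_powR_above ltr01)); rewrite powR1 mulr1.
Qed.

(** The dual weight is made for Hardy's inequality: with [w] the density, it is
    [w^(1/q)] divided by the primitive of [w]. *)
Lemma dual_weightE v (t : R) : slowly_varying v -> 0 < t ->
  t `^ (- r) * dual_weight q v t =
  sv_density q v t `^ r * (primitive (sv_density q v) t)^-1.
Proof.
move=> [v0 _ _] t0; rewrite /dual_weight mulrA; congr (_ * _).
rewrite /sv_density powRM ?invr_ge0 ?(ltW t0) ?powR_ge0// -powRrM mulNr.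
by rewrite -powR_inv1 ?(ltW t0)// -powRrM mulN1r.
Qed.

Lemma dual_weight_ge0 v (t : R) : weight (sv_density q v) -> 0 <= dual_weight q v t.
Proof.
move=> ww; rewrite mulr_ge0 ?powR_ge0// invr_ge0.
exact: (primitive_ge0 ww t).
Qed.

(** Slow variation bounds the mass of [[t/2, t]] from below. *)
Lemma dual_weight_le v : slowly_varying v -> weight (sv_density q v) ->
  exists2 C : R, 0 < C & forall t : R, 0 < t -> dual_weight q v t <= C * v t.
Proof.
move=> sv ww; have [v0 _ _] := sv.
have [C C0 bd] := slowly_varying_bounds sv ltr01.
(* On [[t/2, t[] the density is at least [t^-1 (2 C v(t))^-p]. *)
pose K := 2 * (C * 2) `^ p; have K0 : 0 < K by rewrite mulr_gt0// powR_gt0// mulr_gt0.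
exists K => // t t0; have vt := v0 t t0.
have t20 : 0 < t / 2 by rewrite divr_gt0.
have t2t : t / 2 <= t by rewrite ler_pdivrMr// ler_peMr ?ler1n// ltW.
have Pt : 0 < primitive (sv_density q v) t by exact: (primitive_gt0 ww).
have PK : v t `^ (- p) <= K * primitive (sv_density q v) t.
  rewrite mulrC -ler_pdivrMr// (@le_trans _ _ (primitive (sv_density q v) t -
      primitive (sv_density q v) (t / 2)))//; last first.
    by rewrite gerBl (primitive_ge0 ww).
  rewrite -lee_fin -(primitiveB ww t20 t2t).
  apply: (@le_trans _ _ (\int[mu]_(s in (`[(t / 2)%R, t[%classic : set R))
     (t^-1 * ((C * 2) `^ (- p) * v t `^ (- p)))%:E)%E).
    rewrite integral_cst; last exact: measurable_leb_itv.
    rewrite [X in (_ * X)%E](leb_itvco t2t) -EFinM lee_fin /K.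
    rewrite [(C * 2) `^ (- p)]powRN le_eqVlt; apply/orP; left; apply/eqP.
    by field; rewrite !gt_eqF// powR_gt0// mulr_gt0.
  apply: le_integral_on => s /=; rewrite in_itv/= => /andP[ts st].
    by rewrite lee_fin !mulr_ge0 ?powR_ge0// invr_ge0 ltW.
  have s0 : 0 < s by exact: lt_le_trans ts.
  have vs := v0 s s0.
  rewrite lee_fin /sv_density; apply: ler_pM.
  - by rewrite invr_ge0 ltW.
  - by rewrite mulr_ge0 ?powR_ge0.
  - by rewrite lef_pV2 ?posrE// ltW.
  rewrite -powRM ?(ltW vt) ?mulr_ge0 ?(ltW C0)// !powRN lef_pV2 ?posrE ?powR_gt0//; last first.
    by rewrite !mulr_gt0.
  apply: ge0_ler_powR; rewrite ?nnegrE ?(ltW p0) ?(ltW vs)//.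
    by rewrite !mulr_ge0 ?(ltW vt) ?(ltW C0).
  have [+ _] := bd s t s0 (ltW st); rewrite powRr1 ?divr_ge0 ?(ltW t0) ?(ltW s0)//.
  move=> /le_trans; apply; rewrite ler_wpM2r ?(ltW vt)// ler_wpM2l ?(ltW C0)//.
  by rewrite ler_pdivrMr// mulrC -ler_pdivrMr.
rewrite /dual_weight -/(primitive (sv_density q v) t) ler_pdivrMr//.
have -> : - (p * r) = 1 - p by rewrite (conj_expMrecip q1) opprB.
rewrite powRD_gt0// powRr1 ?(ltW vt)// mulrAC mulrC ler_wpM2r ?(ltW vt)//.
Qed.

Lemma hardy_dual_below v : slowly_varying v -> weight (sv_density q v) ->
  exists2 C : R, 0 < C & forall phi : T -> R,
    measurable_fun H phi -> (forall t, H t -> 0 <= phi t) ->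
  (Lq_norm q (fun t => ((t : R) `^ (- r) * dual_weight q v t)%:E *
     \int[mu]_(s in (`]0%R, (t : R)[%classic : set R)) ((s : R)^-1 * phi s)%:E) <=
   C%:E * weighted_norm v phi)%E.
Proof.
move=> sv ww; have [v0 _ _] := sv; have [C C0 hardy] := hardy_below q1 ww.
exists C => // phi mphi phi0.
have v0' (t : T) : H t -> 0 < v t by move=> /half_lineP; exact: v0.
have t0' (t : T) : H t -> 0 < (t : R) by move=> /half_lineP.
have := hardy _ (weighted_measurable sv (@subset_refl _ _) mphi).
move=> /(_ (fun t Ht => mulr_ge0 (mulr_ge0 (powR_ge0 _ _) (ltW (v0' t Ht))) (phi0 t Ht))).
apply: le_trans; apply: le_Lq_norm => // t Ht.
  rewrite mule_ge0//.
    by rewrite lee_fin mulr_ge0 ?powR_ge0 ?(dual_weight_ge0 _ ww).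
  apply: integral_ge0 => s /itv0_half_line Hs.
  by rewrite lee_fin mulr_ge0 ?phi0// invr_ge0 ltW// t0'.
rewrite dual_weightE ?t0'//; apply: lee_wpmul2l.
  by rewrite lee_fin mulr_ge0 ?powR_ge0// invr_ge0 (primitive_ge0 ww).
apply: le_integral_on => s /itv0_half_line Hs.
  by rewrite lee_fin mulr_ge0 ?phi0// invr_ge0 ltW// t0'.
have s0 := t0' s Hs; have vs := v0' s Hs.
rewrite lee_fin /sv_density powRM ?invr_ge0 ?(ltW s0) ?powR_ge0//.
rewrite -powRrM mulNr divff ?gt_eqF// -[(s : R)^-1]powR_inv1 ?(ltW s0)// -powRrM mulN1r.
rewrite [leRHS](_ : _ = ((s : R) `^ (- p^-1) * (s : R) `^ (- r)) *
    (v s `^ (-1) * v s) * phi s); last by ring.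
rewrite -powRD_gt0// -opprD (conj_expV q1) [v s `^ (-1)]powR_inv1 ?(ltW vs)//.
by rewrite mulVf ?gt_eqF// mulr1.
Qed.

(** The bound of the dual weight by [v], and the slow variation of [v] between [t]
    and [s], reduce this to the inequality with powers. *)
Lemma hardy_dual_above v : slowly_varying v -> weight (sv_density q v) ->
  exists2 C : R, 0 < C & forall phi : T -> R,
    measurable_fun H phi -> (forall t, H t -> 0 <= phi t) ->
  (Lq_norm q (fun t => ((t : R) `^ (- r) * dual_weight q v t)%:E * ((t : R)%:E *
     \int[mu]_(s in (`[(t : R), +oo[%classic : set R)) ((s : R)^-1 * ((s : R)^-1 * phi s))%:E)) <=
   C%:E * weighted_norm v phi)%E.
Proof.
move=> sv ww; have [v0 _ _] := sv; have [C C0 hardy] := hardy_above q1.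
have [C' C'0 dwle] := dual_weight_le sv ww.
have h12 : 0 < 2^-1 :> R by rewrite invr_gt0.
have [D D0 bd] := slowly_varying_bounds sv h12.
have K0 : 0 < C' * D by rewrite mulr_gt0.
exists (C' * D * C); first by rewrite mulr_gt0.
move=> phi mphi phi0.
have v0' (t : T) : H t -> 0 < v t by move=> /half_lineP; exact: v0.
have t0' (t : T) : H t -> 0 < (t : R) by move=> /half_lineP.
pose g1 (t : T) := (t : R) `^ (- r) * v t * phi t.
have g10 t : H t -> 0 <= g1 t.
  by move=> Ht; rewrite !mulr_ge0 ?powR_ge0 ?(ltW (v0' t Ht)) ?phi0.
have mg1 : measurable_fun H g1 by exact: weighted_measurable.
pose g (t : T) := (C' * D) * g1 t.
have g0 t : H t -> 0 <= g t by move=> Ht; rewrite mulr_ge0 ?g10// ltW.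
have mg : measurable_fun H g by apply: measurable_funM; [exact: measurable_cst|exact: mg1].
apply: (@le_trans _ _ (C%:E * Lq_norm q (EFin \o g))%E); last first.
  rewrite [C' * D * C]mulrC EFinM -muleA; apply: lee_wpmul2l; first by rewrite lee_fin ltW.
  apply: (Lq_normZ (f := EFin \o g1)) => //; first exact: ltW.
    exact/measurable_EFinP.
apply: le_trans (hardy g mg g0).
pose G (t : T) := (\int[mu]_(s in (`[(t : R), +oo[%classic : set R))
        ((s : R) `^ (- p^-1 - 2^-1) * g s)%:E)%E.
have DH (t : T) : H t -> `[(t : R), +oo[%classic `<=` half_line R.
  move=> /half_lineP t0 s /=; rewrite in_itv/= andbT => ts.
  by apply/half_lineP/(lt_le_trans t0).
have G0 t : H t -> (0 <= G t)%E.
  move=> Ht; apply: integral_ge0 => s /(DH _ Ht) Hs.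
  by rewrite lee_fin mulr_ge0 ?powR_ge0 ?g0.
have bound (t : T) : H t -> (((t : R) `^ (- r) * dual_weight q v t)%:E * ((t : R)%:E *
     \int[mu]_(s in (`[(t : R), +oo[%classic : set R)) ((s : R)^-1 * ((s : R)^-1 * phi s))%:E) <=
   ((t : R) `^ (p^-1 - 2^-1))%:E * G t)%E.
  move=> Ht; have t0 := t0' t Ht; have vt := v0' t Ht.
  have nn (s : T) : `[(t : R), +oo[%classic s -> (0 <= ((s : R)^-1 * ((s : R)^-1 * phi s))%:E)%E.
    by move=> /(DH _ Ht) Hs; rewrite lee_fin !mulr_ge0 ?invr_ge0 ?phi0 ?(ltW (t0' s Hs)).
  have mphi2 : measurable_fun (`[(t : R), +oo[%classic : set T)
      (fun s : T => (s : R)^-1 * ((s : R)^-1 * phi s)).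
    apply: measurable_funM; first by apply: measurable_leb_inv; exact: DH.
    apply: measurable_funM; first by apply: measurable_leb_inv; exact: DH.
    exact: (measurable_funS measurable_half_line (DH _ Ht)).
  rewrite muleA -EFinM.
  apply: (@le_trans _ _ ((C' * (t : R) `^ p^-1 * v t)%:E *
     \int[mu]_(s in (`[(t : R), +oo[%classic : set R)) ((s : R)^-1 * ((s : R)^-1 * phi s))%:E)%E).
    apply: lee_wpmul2r; first exact: integral_ge0.
    rewrite lee_fin mulrAC -[X in _ * X * _](powRr1 (ltW t0)) -powRD_gt0//.
    have -> : - r + 1 = p^-1 by rewrite -(conj_expV q1); ring.
    rewrite mulrC [leRHS](_ : _ = C' * v t * (t : R) `^ p^-1); last by ring.
    by rewrite ler_wpM2r ?powR_ge0// dwle.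
  rewrite -ge0_integralZl; last 4 first.
  - exact: measurable_leb_itv.
  - exact/measurable_EFinP.
  - exact: nn.
  - by rewrite lee_fin !mulr_ge0 ?powR_ge0 ?(ltW C'0) ?(ltW vt).
  rewrite -ge0_integralZl; last 4 first.
  - exact: measurable_leb_itv.
  - apply/measurable_EFinP; apply: measurable_funM; first exact: measurable_leb_powR.
    exact: (measurable_funS measurable_half_line (DH _ Ht)).
  - by move=> s /(DH _ Ht) Hs; rewrite lee_fin mulr_ge0 ?powR_ge0 ?g0.
  - by rewrite lee_fin powR_ge0.
  apply: le_integral_on => s Ds.
    by rewrite mule_ge0 ?nn// lee_fin !mulr_ge0 ?powR_ge0 ?(ltW C'0) ?(ltW vt).
  have Hs := DH _ Ht s Ds; have s0 := t0' s Hs; have vs := v0' s Hs.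
  have ts : (t : R) <= s by move: Ds; rewrite /= in_itv/= andbT.
  have [+ _] := bd t s t0 ts.
  rewrite powRM ?invr_ge0 ?(ltW s0) ?(ltW t0)// -[(t : R)^-1]powR_inv1 ?(ltW t0)//.
  rewrite -powRrM mulN1r => vle.
  rewrite -!EFinM lee_fin /g /g1.
  rewrite [leLHS](_ : _ = C' * (t : R) `^ p^-1 * ((s : R)^-1 * ((s : R)^-1 * phi s)) * v t);
    last by ring.
  apply: (le_trans (ler_wpM2l _ vle)).
    by rewrite !mulr_ge0 ?powR_ge0 ?invr_ge0 ?phi0 ?(ltW C'0) ?(ltW s0).
  rewrite le_eqVlt; apply/orP; left; apply/eqP.
  rewrite -[(s : R)^-1]powR_inv1 ?(ltW s0)// powRD_gt0//.
  rewrite [LHS](_ : _ = C' * D * ((t : R) `^ p^-1 * (t : R) `^ (- 2^-1)) *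
    ((s : R) `^ (-1) * (s : R) `^ (-1) * (s : R) `^ 2^-1) * phi s * v s); last by ring.
  rewrite [RHS](_ : _ = C' * D * ((t : R) `^ p^-1 * (t : R) `^ (- 2^-1)) *
    ((s : R) `^ (- p^-1 - 2^-1) * (s : R) `^ (- r)) * phi s * v s); last by ring.
  congr (_ * _ * _ * _); rewrite -!powRD_gt0//; congr (_ `^ _).
  by rewrite (recipE q1); field; rewrite gt_eqF.
apply: le_Lq_norm => // t Ht; rewrite !mule_ge0//.
- by rewrite lee_fin mulr_ge0 ?powR_ge0 ?(dual_weight_ge0 _ ww).
- by rewrite lee_fin ltW// t0'.
apply: integral_ge0 => s /(DH _ Ht) Hs.
by rewrite lee_fin !mulr_ge0 ?invr_ge0 ?phi0 ?(ltW (t0' s Hs)).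
Qed.

End slowly_varying_weights.

(** * Simple functions *)

From mathcomp Require Import finmap.

Section simple_maps.
Context {R : realType}.
Notation T := (lebR R).
Notation mu := (leb R).
Notation H := (half_line R : set T).

Definition level (I : Type) (r : T -> I) (x : I) : set T := H `&` r @^-1` [set x].

(** Simple maps into an arbitrary type: several simple functions are handled
    as one simple map into a product. *)
Definition simple_map (I : Type) (r : T -> I) : Prop :=
  finite_set (r @` H) /\ forall x, measurable (level r x).

Lemma simple_map_preimage (I : choiceType) (r : T -> I) (P : set I) :
  simple_map r -> measurable (H `&` r @^-1` P).
Proof.
move=> [fr mr].
rewrite (_ : _ `&` _ = \bigcup_(x in (r @` H) `&` P) level r x).
  apply: fin_bigcup_measurable => [|x _]; last exact: mr.
  by apply: sub_finite_set fr => x [].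
apply/seteqP; split => [t [Ht Prt]|t [x [_ Px] [Ht rt]]].
  by exists (r t) => //; split => //; exists t.
by split => //=; rewrite rt.
Qed.

Lemma simple_map_comp (I J : choiceType) (F : I -> J) (r : T -> I) :
  simple_map r -> simple_map (F \o r).
Proof.
move=> sr; split; first by rewrite -image_comp; apply: finite_image; case: sr.
move=> y; rewrite (_ : level _ _ = H `&` r @^-1` (F @^-1` [set y])) //.
exact: simple_map_preimage.
Qed.

Lemma simple_map_pair (I J : choiceType) (r : T -> I) (r' : T -> J) :
  simple_map r -> simple_map r' -> simple_map (fun t => (r t, r' t)).
Proof.
move=> [fr mr] [fr' mr']; split.
  apply: (sub_finite_set _ (finite_setX fr fr')) => _ [t Ht <-].
  by split; exists t.
move=> [x y]; rewrite (_ : level _ _ = level r x `&` level r' y).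
  exact: measurableI.
apply/seteqP; split => [t [Ht [rt r't]]|t [[Ht rt] [_ r't]]]; first by [].
by split => //=; rewrite rt r't.
Qed.

Lemma simple_map_cst (I : Type) (x : I) : simple_map (fun=> x).
Proof.
split; first by apply: (sub_finite_set _ (finite_set1 x)) => _ [t _ <-].
move=> y; have [xy|xy] := pselect (x = y).
  by rewrite (_ : level _ _ = H)//; apply/seteqP; split => [t []|t Ht].
rewrite (_ : level _ _ = set0)//; apply/seteqP; split => // t [].
by [].
Qed.

Lemma simple_map_mem (E : set T) : measurable E -> simple_map (fun t => t \in E).
Proof.
move=> mE; split.
  by apply: (sub_finite_set (B := [set: bool])).
move=> [].
  rewrite (_ : level _ _ = H `&` E); first exact: measurableI.
  apply/seteqP; split => t [Ht] /= Et; first by split=> //; exact: set_mem.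
  by split=> //=; exact: mem_set.
rewrite (_ : level _ _ = H `\` E); first exact: measurableD.
apply/seteqP; split => t [Ht] /=; first by move=> /negbT; rewrite notin_setE.
by move=> nE; split => //=; apply/negbTE; rewrite notin_setE.
Qed.

Lemma measurable_simple_map d (I : choiceType) (J : measurableType d) (G : I -> J)
  (r : T -> I) : simple_map r -> measurable_fun H (G \o r).
Proof.
by move=> sr _ Y mY; rewrite comp_preimage; exact: simple_map_preimage.
Qed.

Lemma haar_ge0 (A : set T) : A `<=` H -> (0 <= haar A)%E.
Proof.
by move=> AH; apply: integral_ge0 => t /AH /half_lineP t0; rewrite lee_fin invr_ge0 ltW.
Qed.

Lemma le_haar (A B : set T) : A `<=` B -> B `<=` H -> (haar A <= haar B)%E.
Proof.
by move=> AB BH; apply: le_integral_subset => // t => [/AB|] /BH /half_lineP t0;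
  rewrite lee_fin invr_ge0 ltW.
Qed.

Lemma level_sub (I : Type) (r : T -> I) x : level r x `<=` H.
Proof. by move=> t []. Qed.

(** Valid for infinite terms also: the integrand is constant on each of the
    finitely many level sets. *)
Lemma integral_simple_map (I : choiceType) (r : T -> I) (G : I -> \bar R) :
  simple_map r -> (forall x, 0 <= G x)%E ->
  (\int[mu]_(t in H) (((t : R)^-1)%:E * G (r t)) =
   \sum_(x <- fset_set (r @` H)) haar (level r x) * G x)%E.
Proof.
move=> sr G0; have [fr mr] := sr.
have HE : H = \big[setU/set0]_(x <- fset_set (r @` H)) level r x.
  rewrite bigsetU_fset_set//.
  apply/seteqP; split => [t Ht|t [x _ []]//].
  by exists (r t) => //; exists t.
have mf : measurable_fun H (fun t : T => ((t : R)^-1)%:E * G (r t))%E.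
  apply: emeasurable_funM; first by apply/measurable_EFinP; exact: measurable_leb_inv.
  exact: (measurable_simple_map G sr).
have f0 (t : T) : H t -> (0 <= ((t : R)^-1)%:E * G (r t))%E.
  by move=> /half_lineP t0; rewrite mule_ge0// lee_fin invr_ge0 ltW.
rewrite [in LHS]HE ge0_integral_bigsetU; last 5 first.
- exact: mr.
- exact: fset_uniq.
- by move=> x y _ _ [t [[_ rx] [_ ry]]]; rewrite -rx -ry.
- by rewrite -HE.
- by rewrite -HE.
apply: eq_bigr => x _.
rewrite muleC /haar -ge0_integralZl; last 4 first.
- exact: mr.
- by apply/measurable_EFinP; apply: measurable_leb_inv; exact: level_sub.
- by move=> t [/half_lineP t0 _]; rewrite lee_fin invr_ge0 ltW.
- exact: G0.
by apply: eq_integral => t /set_mem[_ /= ->]; rewrite muleC.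
Qed.

Lemma haar_level_comp (I J : choiceType) (F : I -> J) (r : T -> I) (y : J) :
  simple_map r ->
  haar (level (F \o r) y) =
  (\sum_(x <- fset_set (r @` H) | F x == y) haar (level r x))%E.
Proof.
move=> sr; rewrite big_mkcond.
pose G x : \bar R := if F x == y then 1%E else 0%E.
rewrite (eq_bigr (fun x => haar (level r x) * G x)%E); last first.
  by move=> x _; rewrite /G; case: ifPn => _; rewrite ?mule1 ?mule0.
rewrite -integral_simple_map//; last by move=> x; rewrite /G; case: ifPn.
rewrite /haar integral_mkcond [RHS]integral_mkcond.
apply: eq_integral => t _; rewrite /patch /G.
case: ifPn => [/set_mem[Ht /= Fy]|].
  by rewrite mem_set// Fy eqxx mule1.
rewrite notin_setE => nl; case: ifPn => // /set_mem Ht.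
by case: ifPn; rewrite ?mule0// => /eqP Fy; exfalso; apply: nl.
Qed.

Context {V : topologicalLmodType R}.

Lemma simple_integralE (s : R -> V) : finite_set (s @` half_line R) ->
  simple_integral s =
  \sum_(v <- fset_set (s @` half_line R)) fine (haar (level_set s v)) *: v.
Proof. by move=> fs; rewrite /simple_integral fsbig_finite. Qed.

(** The values of [r] are grouped by their images under [F].  With [r] a pair of
    simple functions this computes the integral of any combination of them. *)
Lemma simple_integral_comp (I : choiceType) (F : I -> V) (r : T -> I) :
  simple_map r ->
  (forall x, F x != 0 -> (haar (level r x) < +oo)%E) ->
  simple_integral (F \o r) =
  \sum_(x <- fset_set (r @` H)) fine (haar (level r x)) *: F x.
Proof.
move=> sr fin_h; have [fr mr] := sr.
have [fFr _] := simple_map_comp F sr.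
rewrite simple_integralE//.
transitivity (\sum_(v <- fset_set ((F \o r) @` half_line R))
    \sum_(x <- fset_set (r @` H) | F x == v) fine (haar (level r x)) *: F x).
  apply: eq_bigr => v _.
  have [->|v0] := eqVneq v 0.
    by rewrite scaler0 big1// => x /eqP ->; rewrite scaler0.
  rewrite (_ : haar _ = \sum_(x <- fset_set (r @` H) | F x == v) haar (level r x))%E;
    last exact: haar_level_comp.
  rewrite -sum_fine; last first.
    move=> x /eqP Fx; rewrite ge0_fin_numE; first by apply: fin_h; rewrite Fx.
    exact/haar_ge0/level_sub.
  by rewrite scaler_suml; apply: eq_bigr => x /eqP ->.
rewrite (exchange_big_dep xpredT)//=; apply: eq_big_seq => x.
rewrite in_fset_set// => /set_mem[t Ht rt].
rewrite -big_filter (_ : [seq v <- _ | _] = [:: F x]) ?big_seq1//.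
have Fin : F x \in fset_set ((F \o r) @` half_line R).
  by rewrite in_fset_set//; apply/mem_set; exists t => //=; rewrite rt.
rewrite -(filter_pred1_uniq _ Fin); last exact: fset_uniq.
by apply: eq_filter => v /=; rewrite eq_sym.
Qed.

End simple_maps.

(** * Normed subspaces *)

Section normed_spaces.
Context {R : realType} {V : topologicalLmodType R}.
Notation T := (lebR R).
Notation mu := (leb R).
Notation H := (half_line R : set T).
Implicit Types (X Y : Defs.space R V) (u : T -> V).

(** The values of [snorm] are extended reals and are defined for all vectors;
    these properties make it a norm on the carrier. *)
Record normed X : Prop := Normed {
  normed0 : X 0;
  normedD : forall f g, X f -> X g -> X (f + g);
  normedZ : forall (c : R) f, X f -> X (c *: f);
  snorm_fin : forall f, X f -> snorm X f \is a fin_num;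
  snorm_ge0 : forall f, (0 <= snorm X f)%E;
  snormZ : forall (c : R) f, X f -> snorm X (c *: f) = (`|c|%:E * snorm X f)%E;
  snormD : forall f g, X f -> X g -> (snorm X (f + g) <= snorm X f + snorm X g)%E;
  snorm_eq0 : forall f, X f -> snorm X f = 0%E -> f = 0 }.

Definition nrm X (f : V) : R := fine (snorm X f).

Section one_space.
Context (X : Defs.space R V) (nX : normed X).

Lemma snormE f : X f -> snorm X f = (nrm X f)%:E.
Proof. by move=> Xf; rewrite /nrm fineK// (snorm_fin nX). Qed.

Lemma nrm_ge0 f : 0 <= nrm X f.
Proof. exact/fine_ge0/(snorm_ge0 nX). Qed.

Lemma normedN f : X f -> X (- f).
Proof. by move=> Xf; rewrite -scaleN1r; exact: (normedZ nX). Qed.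

Lemma normedB f g : X f -> X g -> X (f - g).
Proof. by move=> Xf Xg; apply: (normedD nX) => //; exact: normedN. Qed.

Lemma nrmZ (c : R) f : X f -> nrm X (c *: f) = `|c| * nrm X f.
Proof. by move=> Xf; rewrite /nrm (snormZ nX)// fineM// (snorm_fin nX). Qed.

Lemma nrmN f : X f -> nrm X (- f) = nrm X f.
Proof. by move=> Xf; rewrite -scaleN1r nrmZ// normrN1 mul1r. Qed.

Lemma nrm0 : nrm X 0 = 0.
Proof. by rewrite -(scale0r (0 : V)) nrmZ ?normr0 ?mul0r//; exact: normed0. Qed.

Lemma ler_nrmD f g : X f -> X g -> nrm X (f + g) <= nrm X f + nrm X g.
Proof.
move=> Xf Xg; rewrite -lee_fin EFinD -!snormE//; first exact: snormD.
exact: (normedD nX).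
Qed.

Lemma ler_nrmB f g : X f -> X g -> nrm X (f - g) <= nrm X f + nrm X g.
Proof. by move=> Xf Xg; rewrite -(nrmN Xg); apply: ler_nrmD => //; exact: normedN. Qed.

Lemma nrm_distC f g : X f -> X g -> nrm X (f - g) = nrm X (g - f).
Proof. by move=> Xf Xg; rewrite -nrmN ?opprB//; exact: normedB. Qed.

Lemma ler_nrm_tri f g h : X f -> X g -> X h ->
  nrm X (f - h) <= nrm X (f - g) + nrm X (g - h).
Proof.
by move=> Xf Xg Xh; rewrite -[f - h](subrKA g); apply: ler_nrmD; exact: normedB.
Qed.

Lemma ler_dist_nrm f g : X f -> X g -> `|nrm X f - nrm X g| <= nrm X (f - g).
Proof.
move=> Xf Xg; rewrite ler_norml; apply/andP; split.
  rewrite lerNl opprB lerBlDr nrm_distC//.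
  by rewrite -{1}(subrK f g); apply: ler_nrmD => //; exact: normedB.
by rewrite lerBlDr -{1}(subrK g f); apply: ler_nrmD => //; exact: normedB.
Qed.

Lemma nrm_eq0 f : X f -> nrm X f = 0 -> f = 0.
Proof. by move=> Xf n0; apply: (snorm_eq0 nX) => //; rewrite snormE// n0. Qed.

Lemma normed_sum (I : eqType) (s : seq I) (c : I -> R) (F : I -> V) :
  (forall i, i \in s -> X (F i)) -> X (\sum_(i <- s) c i *: F i).
Proof.
elim: s => [|i s IH] sX; first by rewrite big_nil; exact: normed0.
rewrite big_cons; apply: (normedD nX).
  by apply: (normedZ nX); apply: sX; rewrite mem_head.
by apply: IH => j js; apply: sX; rewrite in_cons js orbT.
Qed.

Lemma ler_nrm_sum (I : eqType) (s : seq I) (c : I -> R) (F : I -> V) :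
  (forall i, i \in s -> X (F i)) -> (forall i, 0 <= c i) ->
  nrm X (\sum_(i <- s) c i *: F i) <= \sum_(i <- s) c i * nrm X (F i).
Proof.
move=> + c0; elim: s => [|i s IH] sX; first by rewrite !big_nil nrm0.
have Xi : X (F i) by apply: sX; rewrite mem_head.
have sX' j : j \in s -> X (F j) by move=> js; apply: sX; rewrite in_cons js orbT.
rewrite !big_cons; apply: (le_trans (ler_nrmD _ _)).
- exact: (normedZ nX).
- exact: normed_sum.
by apply: lerD; [rewrite nrmZ// ger0_norm|exact: IH].
Qed.

(** ** Integrable simple functions *)

Lemma simple_funP (s : T -> V) :
  simple_fun X s <-> (forall t : R, 0 < t -> X (s t)) /\ simple_map s.
Proof. by split => [[]|[? []]]. Qed.

Lemma image_half_line (s : T -> V) : (forall t : R, 0 < t -> X (s t)) ->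
  forall v, (s @` H) v -> X v.
Proof. by move=> sX _ [t /half_lineP t0 <-]; exact: sX. Qed.

Definition integrable_map (I : Type) (r : T -> I) (F : I -> V) : Prop :=
  forall x, F x != 0 -> (haar (level r x) < +oo)%E.

Lemma level_comp_sub (I J : Type) (F : I -> J) (r : T -> I) x :
  level r x `<=` level (F \o r) (F x).
Proof. by move=> t [Ht rt]; split => //=; rewrite rt. Qed.

Lemma integrable_simple_map_comp (I : choiceType) (r : T -> I) (F : I -> V) :
  (forall v, v != 0 -> (haar (level_set (F \o r) v) < +oo)%E) ->
  integrable_map r F.
Proof.
move=> h x Fx; apply: le_lt_trans (h _ Fx); apply: le_haar.
  exact: level_comp_sub.
by move=> t [].
Qed.

Lemma integrable_map_comp (I : choiceType) (r : T -> I) (F : I -> V) :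
  simple_map r -> integrable_map r F ->
  forall v, v != 0 -> (haar (level_set (F \o r) v) < +oo)%E.
Proof.
move=> sr ir v v0; rewrite (_ : haar _ =
    \sum_(x <- fset_set (r @` H) | F x == v) haar (level r x))%E;
  last exact: haar_level_comp.
by apply: lte_sum_pinfty => x /eqP Fx; apply: ir; rewrite Fx.
Qed.

Let pair_fst (s s' : T -> V) : s = fst \o (fun t => (s t, s' t)). Proof. by []. Qed.
Let pair_snd (s s' : T -> V) : s' = snd \o (fun t => (s t, s' t)). Proof. by []. Qed.

(** A combination that vanishes at [0] is non-zero only where one of the two
    functions is. *)
Lemma integrable_simple_pair (s s' : T -> V) :
  integrable_simple_fun X s -> integrable_simple_fun X s' ->
  simple_map (fun t => (s t, s' t)) /\
  forall F : V * V -> V, F 0 = 0 -> integrable_map (fun t => (s t, s' t)) F.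
Proof.
move=> [/simple_funP[_ ss] si] [/simple_funP[_ ss'] si'].
split; first exact: simple_map_pair.
have i1 := @integrable_simple_map_comp _ (fun t => (s t, s' t)) fst si.
have i2 := @integrable_simple_map_comp _ (fun t => (s t, s' t)) snd si'.
move=> F F0 [x y] Fxy; have [x0|x0] := eqVneq x 0; last exact: i1.
by apply: i2; apply: contraNneq Fxy => /= y0; rewrite x0 y0 F0.
Qed.

Lemma integrable_simpleD (s s' : T -> V) :
  integrable_simple_fun X s -> integrable_simple_fun X s' ->
  integrable_simple_fun X (fun t => s t + s' t) /\
  simple_integral (fun t => s t + s' t) = simple_integral s + simple_integral s'.
Proof.
move=> is_ is'; have [sp ip] := integrable_simple_pair is_ is'.
pose r t := (s t, s' t).
pose F (x : V * V) := x.1 + x.2.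
have iF : integrable_map r F by apply: ip; rewrite /F/= addr0.
split.
  split; last exact: (@integrable_map_comp _ r F).
  apply/simple_funP; split; last exact: (simple_map_comp F sp).
  move=> t t0; apply: (normedD nX).
    by case: is_ => -[sX _ _] _; exact: sX.
  by case: is' => -[sX _ _] _; exact: sX.
rewrite [LHS](simple_integral_comp (F := F) sp iF).
rewrite [in RHS](pair_fst s s') [X in _ + simple_integral X](pair_snd s s').
rewrite (simple_integral_comp (F := fst) sp (ip fst erefl)).
rewrite (simple_integral_comp (F := snd) sp (ip snd erefl)).
by rewrite -big_split/=; apply: eq_bigr => x _; rewrite scalerDr.
Qed.

Lemma simple_integral_in (s : T -> V) : integrable_simple_fun X s ->
  X (simple_integral s).
Proof.
move=> [[sX fs _] _]; rewrite simple_integralE//; apply: normed_sum => v.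
rewrite in_fset_set// => /set_mem; exact: image_half_line.
Qed.

(** Both functions factor through the pair [(s, s')], over whose finitely many
    values the triangle inequality is applied. *)
Lemma nrm_simple_integralB (s s' : T -> V) :
  integrable_simple_fun X s -> integrable_simple_fun X s' ->
  ((nrm X (simple_integral s - simple_integral s'))%:E <=
   \int[mu]_(t in H) (((t : R)^-1)%:E * (nrm X (s t - s' t))%:E))%E.
Proof.
move=> is_ is'; have [sp ip] := integrable_simple_pair is_ is'.
pose r t := (s t, s' t).
have [sX _ _] := is_.1; have [s'X _ _] := is'.1.
have fr : finite_set (r @` H) by case: sp.
have rX x : x \in fset_set (r @` H) -> X x.1 /\ X x.2.
  rewrite in_fset_set// => /set_mem[t /half_lineP t0 <-].
  by split; [exact: sX|exact: s'X].
have -> : simple_integral s - simple_integral s' =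
    \sum_(x <- fset_set (r @` H)) fine (haar (level r x)) *: (x.1 - x.2).
  rewrite {1}(pair_fst s s') {1}(pair_snd s s').
  rewrite (simple_integral_comp (F := fst) sp (ip fst erefl)).
  rewrite (simple_integral_comp (F := snd) sp (ip snd erefl)).
  by rewrite -sumrB; apply: eq_bigr => x _; rewrite scalerBr.
have h0 x : 0 <= fine (haar (level r x)) by exact/fine_ge0/haar_ge0/level_sub.
apply: (@le_trans _ _ (\sum_(x <- fset_set (r @` H))
    fine (haar (level r x)) * nrm X (x.1 - x.2))%:E).
  rewrite lee_fin; apply: ler_nrm_sum => // x /rX[x1 x2]; exact: normedB.
rewrite (integral_simple_map (G := fun x : V * V => (nrm X (x.1 - x.2))%:E) sp); last first.
  by move=> x; rewrite lee_fin nrm_ge0.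
rewrite -sumEFin big_seq [leRHS]big_seq; apply: lee_sum => x xr.
have [->|x0] := eqVneq (x.1 - x.2) 0; first by rewrite nrm0 mulr0 mule0.
rewrite EFinM fineK// ge0_fin_numE; last exact/haar_ge0/level_sub.
by apply: (ip (fun x => x.1 - x.2) _ x x0); rewrite /= subrr.
Qed.

(** ** Strongly measurable functions *)

Lemma strongly_measurable_in u (t : R) : strongly_measurable X u -> 0 < t -> X (u t).
Proof. by move=> [uX _]; exact: uX. Qed.

Lemma measurable_nrm_simple (s : T -> V) : simple_map s ->
  measurable_fun H (fun t => nrm X (s t)).
Proof. by move=> ss; exact: (measurable_simple_map (nrm X) ss). Qed.

(** The definitions speak of extended norms; the proofs use real ones. *)
Lemma cvg_snorm (f_ : nat -> V) : (forall n, X (f_ n)) ->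
  (snorm X (f_ n) @[n --> \oo] --> 0%E) <-> (nrm X (f_ n) @[n --> \oo] --> 0).
Proof.
move=> fX; have -> : (fun n => snorm X (f_ n)) = EFin \o (fun n => nrm X (f_ n)).
  by apply/funext => n /=; rewrite snormE.
split; first by move=> /fine_cvg.
by move=> ?; apply: cvg_EFin => //; near=> n.
Unshelve. all: by end_near. Qed.

(** Completeness of Lebesgue measure turns an almost everywhere limit of
    measurable functions into a measurable function. *)
Lemma measurable_nrm u : strongly_measurable X u ->
  measurable_fun H (fun t => nrm X (u t)).
Proof.
move=> [uX [s_ [ss aes]]].
pose f t := limn_esup (fun n => (nrm X (s_ n t))%:E).
have mf : measurable_fun H f.
  apply: measurable_fun_limn_esup => n; apply/measurable_EFinP.
  by apply: measurable_nrm_simple; have /simple_funP[] := ss n.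
apply/measurable_EFinP.
suff aeE : {ae mu, forall t, H t -> f t = (nrm X (u t))%:E}.
  exact: (ae_measurable_fun completed_lebesgue_measure_is_complete aeE mf).
apply: (@filterS _ _ (ae_filter_ringOfSetsType mu) _ _ _ aes) => t ht Ht; have t0 : 0 < (t : R) by exact/half_lineP.
have sX n : X (s_ n t) by have /simple_funP[sX _] := ss n; exact: sX.
have {ht} : nrm X (u t - s_ n t) @[n --> \oo] --> 0.
  by apply/cvg_snorm => [n|]; [apply: normedB => //; exact: uX|exact: ht].
move=> hn; have : nrm X (s_ n t) @[n --> \oo] --> nrm X (u t).
  apply/cvgrPdist_le => e e0; move/cvgrPdist_le : hn => /(_ e e0).
  apply: filterS => n; rewrite sub0r normrN ger0_norm ?nrm_ge0// => /(le_trans _); apply.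
  by apply: ler_dist_nrm => //; exact: uX.
move=> h; have hE : (nrm X (s_ n t))%:E @[n --> \oo] --> (nrm X (u t))%:E.
  by apply: cvg_EFin => //; near=> n.
by rewrite /f is_cvg_limn_esupE; [exact/cvg_lim|apply/cvg_ex; eexists; exact: hE].
Unshelve. all: by end_near. Qed.

End one_space.

End normed_spaces.

(** * The Bochner integral *)

Lemma cvg0_squeeze (R : realType) (a b : nat -> R) :
  (forall n, 0 <= a n <= b n) -> b n @[n --> \oo] --> 0 -> a n @[n --> \oo] --> 0.
Proof.
by move=> ab b0; apply: (squeeze_cvgr _ (cvg_cst 0) b0); exact: nearW.
Qed.

Lemma ecvg0_squeeze (R : realType) (a b : nat -> \bar R) :
  (forall n, 0 <= a n <= b n)%E -> b n @[n --> \oo] --> 0%E -> a n @[n --> \oo] --> 0%E.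
Proof.
by move=> ab b0; apply: (squeeze_cvge _ (cvg_cst 0%E) b0); exact: nearW.
Qed.

Section bochner.
Context {R : realType} {V : topologicalLmodType R}.
Notation T := (lebR R).
Notation mu := (leb R).
Notation H := (half_line R : set T).
Implicit Types (X Y : Defs.space R V) (u : T -> V).

Definition restr (E : set T) u : T -> V := fun t => if t \in E then u t else 0.

Definition sub_space X Y : Prop :=
  forall f, X f -> Y f /\ nrm Y f <= nrm X f.

Definition complete_space X : Prop := forall f_ : nat -> V,
  (forall n, X (f_ n)) ->
  (forall e : R, 0 < e -> exists N, forall m n, (N <= m)%N -> (N <= n)%N ->
     nrm X (f_ m - f_ n) <= e) ->
  exists2 f, X f & nrm X (f - f_ n) @[n --> \oo] --> 0.

Section one_space.
Context (X : Defs.space R V) (nX : normed X).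

Lemma simple_strongly_measurable (s : T -> V) : simple_fun X s -> strongly_measurable X s.
Proof.
move=> ss; have /simple_funP[sX _] := ss; split => //.
exists (fun=> s); split => //; apply/nearW => t t0.
rewrite subrr (snormE nX); last exact: (normed0 nX).
by rewrite (nrm0 nX); exact: cvg_cst.
Qed.

Lemma strongly_measurableP u : strongly_measurable X u <->
  (forall t : R, 0 < t -> X (u t)) /\ exists s_ : nat -> T -> V,
   (forall n, simple_fun X (s_ n)) /\
   {ae mu, forall t : T, 0 < (t : R) -> nrm X (u t - s_ n t) @[n --> \oo] --> 0}.
Proof.
split=> [[uX [s_ [ss aes]]]|[uX [s_ [ss aes]]]]; split => //; exists s_; split => //.
  apply: (@filterS _ _ (ae_filter_ringOfSetsType mu) _ _ _ aes) => t ht t0.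
  apply/(cvg_snorm nX) => [n|]; last exact: ht.
  by apply: (normedB nX); [exact: uX|have /simple_funP[sX _] := ss n; exact: sX].
apply: (@filterS _ _ (ae_filter_ringOfSetsType mu) _ _ _ aes) => t ht t0.
apply/(cvg_snorm nX) => [n|]; last exact: ht.
by apply: (normedB nX); [exact: uX|have /simple_funP[sX _] := ss n; exact: sX].
Qed.

(** An operation that is Lipschitz in its two arguments can be applied to simple
    approximations of them. *)
Lemma strongly_measurable_map2 u v (F : V -> V -> V) (K : R) :
  (forall f g, X f -> X g -> X (F f g)) ->
  (forall f g f' g', X f -> X g -> X f' -> X g' ->
     nrm X (F f g - F f' g') <= K * (nrm X (f - f') + nrm X (g - g'))) ->
  strongly_measurable X u -> strongly_measurable X v ->
  strongly_measurable X (fun t => F (u t) (v t)).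
Proof.
move=> FX FK /strongly_measurableP[uX [s_ [ss us]]] /strongly_measurableP[vX [z_ [sz vz]]].
have sX n t : 0 < (t : R) -> X (s_ n t) by have /simple_funP[h _] := ss n; exact: h.
have zX n t : 0 < (t : R) -> X (z_ n t) by have /simple_funP[h _] := sz n; exact: h.
apply/strongly_measurableP; split; first by move=> t t0; apply: FX; [exact: uX|exact: vX].
exists (fun n t => F (s_ n t) (z_ n t)); split.
  move=> n; apply/simple_funP; split.
    by move=> t t0; apply: FX; [exact: sX|exact: zX].
  have /simple_funP[_ h] := ss n; have /simple_funP[_ k] := sz n.
  exact: (simple_map_comp (fun x : V * V => F x.1 x.2) (simple_map_pair h k)).
apply: (@filterS2 _ _ (ae_filter_ringOfSetsType mu) _ _ _ _ us vz) => t ut vt t0.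
have h : K * (nrm X (u t - s_ n t) + nrm X (v t - z_ n t)) @[n --> \oo] --> 0.
  rewrite -(mulr0 K) -(addr0 (0 : R)).
  by apply: cvgM; [exact: cvg_cst|exact: cvgD (ut t0) (vt t0)].
apply: (cvg0_squeeze _ h) => n.
rewrite (nrm_ge0 nX)/=; apply: FK; by [exact: uX|exact: vX|exact: sX|exact: zX].
Qed.

Lemma strongly_measurableD u v : strongly_measurable X u -> strongly_measurable X v ->
  strongly_measurable X (fun t => u t + v t).
Proof.
apply: (@strongly_measurable_map2 _ _ +%R 1) => [f g|f g f' g'] *.
  exact: (normedD nX).
have -> : f + g - (f' + g') = (f - f') + (g - g') by rewrite opprD addrACA.
by rewrite mul1r; apply: (ler_nrmD nX); exact: (normedB nX).
Qed.

Lemma strongly_measurableB u v : strongly_measurable X u -> strongly_measurable X v ->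
  strongly_measurable X (fun t => u t - v t).
Proof.
apply: (@strongly_measurable_map2 _ _ (fun f g => f - g) 1) => [f g|f g f' g' Xf Xg Xf' Xg'].
  exact: (normedB nX).
have -> : f - g - (f' - g') = (f - f') - (g - g') by rewrite !opprD !opprK addrACA.
by rewrite mul1r; apply: (ler_nrmB nX); exact: (normedB nX).
Qed.

Lemma strongly_measurable_restr (E : set T) u : measurable E ->
  strongly_measurable X u -> strongly_measurable X (restr E u).
Proof.
move=> mE /strongly_measurableP[uX [s_ [ss us]]].
have sX n t : 0 < (t : R) -> X (s_ n t) by have /simple_funP[h _] := ss n; exact: h.
have X0 := normed0 nX.
apply/strongly_measurableP; split.
  by move=> t t0; rewrite /restr; case: ifPn => // _; exact: uX.
exists (fun n => restr E (s_ n)); split.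
  move=> n; apply/simple_funP; split.
    by move=> t t0; rewrite /restr; case: ifPn => // _; exact: sX.
  have /simple_funP[_ h] := ss n.
  exact: (simple_map_comp (fun x : V * bool => if x.2 then x.1 else 0)
    (simple_map_pair h (simple_map_mem mE))).
apply: (@filterS _ _ (ae_filter_ringOfSetsType mu) _ _ _ us) => t ut t0.
rewrite /restr; case: ifPn => _; first exact: ut.
by rewrite subrr (nrm0 nX); exact: cvg_cst.
Qed.

Lemma measurable_nrmB u v : strongly_measurable X u -> strongly_measurable X v ->
  measurable_fun H (fun t => nrm X (u t - v t)).
Proof. by move=> mu_ mv; apply: (measurable_nrm nX); exact: strongly_measurableB. Qed.

(** ** The distance [\int |u - v| dt/t] *)

Definition L1_dist u v : \bar R :=
  (\int[mu]_(t in H) (((t : R)^-1)%:E * (nrm X (u t - v t))%:E))%E.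

Lemma L1_dist_ge0 u v : (0 <= L1_dist u v)%E.
Proof.
apply: integral_ge0 => t /half_lineP t0.
by rewrite -EFinM lee_fin mulr_ge0 ?invr_ge0 ?(nrm_ge0 nX)// ltW.
Qed.

Let inX u (t : T) : strongly_measurable X u -> H t -> X (u t).
Proof. by move=> [uX _] /half_lineP; exact: uX. Qed.

Lemma measurable_inv_half_line : measurable_fun H (fun t : T => (t : R)^-1).
Proof. exact: measurable_leb_inv. Qed.

Lemma L1_distC u v : strongly_measurable X u -> strongly_measurable X v ->
  L1_dist u v = L1_dist v u.
Proof.
move=> mu_ mv; apply: eq_integral => t /set_mem Ht.
by rewrite (nrm_distC nX)//; exact: inX.
Qed.

Lemma L1_dist_tri u v x : strongly_measurable X u -> strongly_measurable X v ->
  strongly_measurable X x -> (L1_dist u x <= L1_dist u v + L1_dist v x)%E.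
Proof.
move=> mu_ mv mx; rewrite /L1_dist -ge0_integralD; last 5 first.
- exact: measurable_half_line.
- move=> t /half_lineP t0.
  by rewrite -EFinM lee_fin mulr_ge0 ?invr_ge0 ?(nrm_ge0 nX)// ltW.
- apply: emeasurable_funM; apply/measurable_EFinP; first exact: measurable_inv_half_line.
  exact: measurable_nrmB.
- move=> t /half_lineP t0.
  by rewrite -EFinM lee_fin mulr_ge0 ?invr_ge0 ?(nrm_ge0 nX)// ltW.
- apply: emeasurable_funM; apply/measurable_EFinP; first exact: measurable_inv_half_line.
  exact: measurable_nrmB.
apply: le_integral_on => t Ht; have t0 : 0 < (t : R) by exact/half_lineP.
  by rewrite -EFinM lee_fin mulr_ge0 ?invr_ge0 ?(nrm_ge0 nX)// ltW.
rewrite -!EFinM -EFinD lee_fin -mulrDr ler_wpM2l ?invr_ge0 ?(ltW t0)//.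
by apply: (ler_nrm_tri nX); exact: inX.
Qed.

Lemma bochnerP u f : bochner_integral X u f <->
  [/\ X f, strongly_measurable X u & exists s_ : nat -> T -> V,
  [/\ forall n, integrable_simple_fun X (s_ n),
     L1_dist u (s_ n) @[n --> \oo] --> 0%E &
     nrm X (f - simple_integral (s_ n)) @[n --> \oo] --> 0]].
Proof.
have distE s_ : strongly_measurable X u -> (forall n, integrable_simple_fun X (s_ n)) ->
    (fun n => \int[mu]_(t in H) (((t : R)^-1)%:E * snorm X (u t - s_ n t)%R))%E =
    (fun n => L1_dist u (s_ n)).
  move=> mu_ si; apply/funext => n; apply: eq_integral => t /set_mem Ht.
  rewrite (snormE nX)//; apply: (normedB nX); first exact: inX.
  have [/simple_funP[sX _] _] := si n; apply: sX; exact/half_lineP.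
split=> [[Xf mu_ [s_ [si sc fc]]]|[Xf mu_ [s_ [si sc fc]]]]; split => //; exists s_; split => //.
- by rewrite -distE.
- apply/(cvg_snorm nX) => // n; apply: (normedB nX) => //.
  exact: (simple_integral_in nX).
- by rewrite distE.
- apply/(cvg_snorm nX) => // n; apply: (normedB nX) => //.
  exact: (simple_integral_in nX).
Qed.

Lemma ecvg0_le (a_ : nat -> \bar R) (e : R) : a_ n @[n --> \oo] --> 0%E ->
  0 < e -> (forall n, 0 <= a_ n)%E -> \forall n \near \oo, (a_ n <= e%:E)%E.
Proof.
move=> ac e0 a0; have /fine_cvgP[afin afc] := ac.
move/cvgrPdist_le : afc => /(_ e e0) h.
apply: filterS2 h afin => n /= h an.
rewrite -(fineK an) lee_fin; move: h; rewrite sub0r normrN ger0_norm//.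
exact: fine_ge0.
Qed.

Lemma cvg0_le (a_ : nat -> R) (e : R) : a_ n @[n --> \oo] --> 0 ->
  0 < e -> \forall n \near \oo, a_ n <= e.
Proof.
move=> /cvgrPdist_le ac e0; have := ac e e0; apply: filterS => n.
by rewrite sub0r normrN => /(le_trans (ler_norm _)).
Qed.

(** Passing to the limit in the inequality for simple functions; uniqueness of the
    integral and the bound of its norm are special cases. *)
Lemma bochner_distance u v f g :
  bochner_integral X u f -> bochner_integral X v g ->
  ((nrm X (f - g))%:E <= L1_dist u v)%E.
Proof.
move=> /bochnerP[Xf mu_ [s_ [si sc fc]]] /bochnerP[Xg mv [z_ [zi zc gc]]].
have ms n : strongly_measurable X (s_ n).
  by apply: simple_strongly_measurable; case: (si n).
have mz n : strongly_measurable X (z_ n).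
  by apply: simple_strongly_measurable; case: (zi n).
apply/lee_addgt0Pr => e e0.
have e4 : 0 < e / 4 by rewrite divr_gt0.
near \oo => n.
have h1 : (L1_dist u (s_ n) <= (e / 4)%:E)%E.
  by near: n; apply: ecvg0_le => // n; exact: L1_dist_ge0.
have h2 : (L1_dist v (z_ n) <= (e / 4)%:E)%E.
  by near: n; apply: ecvg0_le => // n; exact: L1_dist_ge0.
have h3 : nrm X (f - simple_integral (s_ n)) <= e / 4.
  by near: n; exact: cvg0_le.
have h4 : nrm X (g - simple_integral (z_ n)) <= e / 4.
  by near: n; exact: cvg0_le.
have Is := simple_integral_in nX (si n).
have Iz := simple_integral_in nX (zi n).
have tri : nrm X (f - g) <= e / 4 +
    (nrm X (simple_integral (s_ n) - simple_integral (z_ n)) + e / 4).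
  apply: (le_trans (ler_nrm_tri nX Xf Is Xg)); apply: lerD => //.
  apply: (le_trans (ler_nrm_tri nX Is Iz Xg)); apply: lerD => //.
  by rewrite (nrm_distC nX).
have mid : (L1_dist (s_ n) (z_ n) <= (e / 4)%:E + (L1_dist u v + (e / 4)%:E))%E.
  apply: (le_trans (L1_dist_tri (ms n) mu_ (mz n))); apply: leeD.
    by rewrite L1_distC.
  by apply: (le_trans (L1_dist_tri mu_ mv (mz n))); apply: leeD.
have := nrm_simple_integralB nX (si n) (zi n) => /le_trans /(_ mid) h.
apply: (@le_trans _ _ ((e / 4)%:E + ((e / 4)%:E + (L1_dist u v + (e / 4)%:E) + (e / 4)%:E))%E).
  apply: (le_trans (_ : _ <= (e / 4 + (nrm X (simple_integral (s_ n) -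
    simple_integral (z_ n)) + e / 4))%:E)%E); first by rewrite lee_fin.
  by rewrite !EFinD; apply: leeD => //; apply: leeD.
rewrite le_eqVlt; apply/orP; left; apply/eqP.
move: (L1_dist u v) => [d| |] //=.
by rewrite -!EFinD; congr EFin; field.
Unshelve. all: by end_near. Qed.

Lemma bochnerD u v f g : bochner_integral X u f -> bochner_integral X v g ->
  bochner_integral X (fun t => u t + v t) (f + g).
Proof.
move=> /bochnerP[Xf mu_ [s_ [si sc fc]]] /bochnerP[Xg mv [z_ [zi zc gc]]].
have ms n : strongly_measurable X (s_ n).
  by apply: simple_strongly_measurable; case: (si n).
have mz n : strongly_measurable X (z_ n).
  by apply: simple_strongly_measurable; case: (zi n).
apply/bochnerP; split; [exact: (normedD nX)|exact: strongly_measurableD|].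
exists (fun n t => s_ n t + z_ n t); split.
- by move=> n; have [] := integrable_simpleD nX (si n) (zi n).
- have h : (L1_dist u (s_ n) + L1_dist v (z_ n))%E @[n --> \oo] --> 0%E.
    by rewrite -(adde0 (0 : \bar R)); exact: cvgeD.
  apply: (ecvg0_squeeze _ h) => n.
  rewrite L1_dist_ge0/= /L1_dist -ge0_integralD; last 5 first.
  + exact: measurable_half_line.
  + move=> t /half_lineP t0.
    by rewrite -EFinM lee_fin mulr_ge0 ?invr_ge0 ?(nrm_ge0 nX)// ltW.
  + apply: emeasurable_funM; apply/measurable_EFinP; first exact: measurable_inv_half_line.
    exact: measurable_nrmB.
  + move=> t /half_lineP t0.
    by rewrite -EFinM lee_fin mulr_ge0 ?invr_ge0 ?(nrm_ge0 nX)// ltW.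
  + apply: emeasurable_funM; apply/measurable_EFinP; first exact: measurable_inv_half_line.
    exact: measurable_nrmB.
  apply: le_integral_on => t Ht; have t0 : 0 < (t : R) by exact/half_lineP.
    by rewrite -EFinM lee_fin mulr_ge0 ?invr_ge0 ?(nrm_ge0 nX)// ltW.
  rewrite -!EFinM -EFinD lee_fin -mulrDr ler_wpM2l ?invr_ge0 ?(ltW t0)//.
  by rewrite opprD addrACA; apply: (ler_nrmD nX); apply: (normedB nX); exact: inX.
have h : nrm X (f - simple_integral (s_ n)) + nrm X (g - simple_integral (z_ n))
    @[n --> \oo] --> 0.
  by rewrite -(addr0 (0 : R)); exact: cvgD.
apply: (cvg0_squeeze _ h) => n.
rewrite (nrm_ge0 nX)/=; have [_ ->] := integrable_simpleD nX (si n) (zi n).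
rewrite opprD addrACA; apply: (ler_nrmD nX); apply: (normedB nX) => //;
  exact: (simple_integral_in nX).
Qed.

Lemma eq_bochner u v f : (forall t : R, 0 < t -> u t = v t) ->
  bochner_integral X u f -> bochner_integral X v f.
Proof.
move=> uv /bochnerP[Xf mu_ [s_ [si sc fc]]].
apply/bochnerP; split => //.
  move: mu_ => [uX [z_ [zs uz]]]; split; first by move=> t t0; rewrite -uv//; exact: uX.
  exists z_; split => //; apply: (@filterS _ _ (ae_filter_ringOfSetsType mu) _ _ _ uz) => t ut t0.
  by rewrite -uv//; exact: ut.
exists s_; split => //.
rewrite (_ : (fun n => L1_dist v (s_ n)) = (fun n => L1_dist u (s_ n)))//.
apply/funext => n; apply: eq_integral => t /set_mem /half_lineP t0.
by rewrite uv.
Qed.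

Lemma bochner_simple (s : T -> V) : integrable_simple_fun X s ->
  bochner_integral X s (simple_integral s).
Proof.
move=> si; apply/bochnerP; split.
- exact: (simple_integral_in nX).
- by apply: simple_strongly_measurable; case: si.
exists (fun=> s); split => //.
  rewrite (_ : (fun n => L1_dist s s) = cst 0%E); first exact: cvg_cst.
  apply/funext => n; rewrite /L1_dist; apply: integral0_eq => t _.
  by rewrite subrr (nrm0 nX) mule0.
by rewrite subrr (nrm0 nX); exact: cvg_cst.
Qed.

Lemma bochner0 : bochner_integral X (fun=> 0) 0.
Proof.
have X0 := normed0 nX.
have si : integrable_simple_fun X (fun=> 0).
  split; first by apply/simple_funP; split; [by []|exact: simple_map_cst].
  move=> v v0; rewrite (_ : level_set _ _ = set0).
    by rewrite /haar integral_set0 ltry.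
  by apply/seteqP; split => // t [_ /= v0']; move: v0; rewrite -v0' eqxx.
have := bochner_simple si; rewrite (_ : simple_integral _ = 0)//.
have [[_ fs _] _] := si.
rewrite simple_integralE// big_seq big1// => v.
by rewrite in_fset_set// => /set_mem[t _ <-]; rewrite scaler0.
Qed.

Lemma nrm_bochner_le u f : bochner_integral X u f ->
  ((nrm X f)%:E <= \int[mu]_(t in H) (((t : R)^-1)%:E * (nrm X (u t))%:E))%E.
Proof.
move=> bu; have := bochner_distance bu bochner0; rewrite subr0 => /le_trans; apply.
by rewrite le_eqVlt; apply/orP; left; apply/eqP; apply: eq_integral => t _; rewrite subr0.
Qed.

Lemma bochner_unique u f g :
  bochner_integral X u f -> bochner_integral X u g -> f = g.
Proof.
move=> uf ug; have := bochner_distance uf ug.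
rewrite /L1_dist integral0_eq; last by move=> t _; rewrite subrr (nrm0 nX) mule0.
have [Xf _ _] := uf; have [Xg _ _] := ug.
rewrite lee_fin => fg; apply/eqP; rewrite -subr_eq0; apply/eqP/(nrm_eq0 nX).
  exact: (normedB nX).
by apply/eqP; rewrite eq_le fg (nrm_ge0 nX).
Qed.

End one_space.

Section two_spaces.
Context (X Y : Defs.space R V) (nX : normed X) (nY : normed Y) (XY : sub_space X Y).

Lemma simple_fun_sub_space (s : T -> V) : simple_fun X s -> simple_fun Y s.
Proof.
move=> /simple_funP[sX ss]; apply/simple_funP; split => // t t0.
by have [] := XY (sX t t0).
Qed.

Lemma strongly_measurable_sub_space u :
  strongly_measurable X u -> strongly_measurable Y u.
Proof.
move=> /(strongly_measurableP nX)[uX [s_ [ss us]]]; apply/(strongly_measurableP nY).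
split; first by move=> t t0; have [] := XY (uX t t0).
exists s_; split; first by move=> n; exact: simple_fun_sub_space.
apply: (@filterS _ _ (ae_filter_ringOfSetsType mu) _ _ _ us) => t ut t0.
apply: (cvg0_squeeze _ (ut t0)) => n.
rewrite (nrm_ge0 nY)/=; apply: (XY _).2; apply: (normedB nX); first exact: uX.
by have /simple_funP[sX _] := ss n; exact: sX.
Qed.

(** The approximating simple functions and their integrals are the same in the
    larger space. *)
Lemma bochner_sub_space u f : bochner_integral X u f -> bochner_integral Y u f.
Proof.
move=> /(bochnerP nX)[Xf mu_ [s_ [si sc fc]]]; apply/(bochnerP nY); split.
- by have [] := XY Xf.
- exact: strongly_measurable_sub_space.
exists s_; split.
- by move=> n; have [ss sh] := si n; split => //; exact: simple_fun_sub_space.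
- apply: (ecvg0_squeeze _ sc) => n.
  rewrite L1_dist_ge0//=; apply: le_integral_on => t /half_lineP t0.
    by rewrite -EFinM lee_fin mulr_ge0 ?invr_ge0 ?(nrm_ge0 nY)// ltW.
  rewrite -!EFinM lee_fin ler_wpM2l ?invr_ge0 ?(ltW t0)//.
  apply: (XY _).2; apply: (normedB nX); first by case: mu_ => uX _; exact: uX.
  by have [/simple_funP[sX _] _] := si n; exact: sX.
apply: (cvg0_squeeze _ fc) => n.
rewrite (nrm_ge0 nY)/=; apply: (XY _).2; apply: (normedB nX) => //.
exact: (simple_integral_in nX).
Qed.

End two_spaces.

End bochner.

Import HBSimple HBNNSimple.

Section bochner_existence.
Context {R : realType} {V : topologicalLmodType R}.
Notation T := (lebR R).
Notation mu := (leb R).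
Notation H := (half_line R : set T).
Context (X : Defs.space R V) (nX : normed X).
Implicit Types (u : T -> V).

Let inv0 (t : T) : H t -> 0 <= (t : R)^-1.
Proof. by move=> /half_lineP t0; rewrite invr_ge0 ltW. Qed.

Lemma measurable_haar_integrand (phi : T -> R) : measurable_fun H phi ->
  measurable_fun H (fun t : T => ((t : R)^-1 * phi t)%:E).
Proof.
move=> mphi; apply/measurable_EFinP; apply: measurable_funM; last exact: mphi.
exact: measurable_inv_half_line.
Qed.

(** Dominated convergence for the measure [dt/t]. *)
Lemma haar_dominated (f_ : nat -> T -> R) (g : T -> R) :
  (forall n, measurable_fun H (f_ n)) -> measurable_fun H g ->
  (forall n t, H t -> 0 <= f_ n t <= g t) ->
  {ae mu, forall t : T, 0 < (t : R) -> f_ n t @[n --> \oo] --> 0} ->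
  (\int[mu]_(t in H) ((t : R)^-1 * g t)%:E < +oo)%E ->
  (\int[mu]_(t in H) (((t : R)^-1)%:E * (f_ n t)%:E))%E @[n --> \oo] --> 0%E.
Proof.
move=> mf mg fg aef gfin.
have g0 t : H t -> 0 <= g t.
  by move=> Ht; have /andP[] := fg 0%N t Ht; exact: le_trans.
have := @dominated_convergence _ T R mu H measurable_half_line
  (fun n t => ((t : R)^-1 * f_ n t)%:E) (cst 0%E)
  (fun t => ((t : R)^-1 * g t)%:E).
move=> /(_ (fun n => measurable_haar_integrand (mf n)) (@measurable_cst _ _ _ _ _ _)).
have aec : \forall t \ae mu, H t ->
    ((t : R)^-1 * f_ n t)%:E @[n --> \oo] --> (cst 0%E : T -> \bar R) t.
  apply: (@filterS _ _ (ae_filter_ringOfSetsType mu) _ _ _ aef) => t ft Ht.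
  have {}ft := ft ((half_lineP _).1 Ht).
  apply: cvg_EFin; first by near=> n.
  rewrite -[X in _ --> X](mulr0 ((t : R)^-1)).
  by apply: cvgM; [exact: cvg_cst|exact: ft].
have ig : mu.-integrable H (fun t : T => ((t : R)^-1 * g t)%:E).
  apply/integrableP; split; first exact: measurable_haar_integrand.
  apply: le_lt_trans gfin; apply: le_integral_on => t Ht; first exact: abse_ge0.
  by rewrite gee0_abs// lee_fin mulr_ge0 ?inv0 ?g0.
move=> /(_ aec ig).
have dom : \forall t \ae mu, forall n, H t ->
    (`|((t : R)^-1 * f_ n t)%:E| <= ((t : R)^-1 * g t)%:E)%E.
  apply/nearW => t n Ht; have /andP[f0 fgt] := fg n t Ht.
  by rewrite gee0_abs ?lee_fin ?mulr_ge0 ?inv0// ler_wpM2l ?inv0.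
move=> /(_ dom)[_ _]; rewrite integral0.
by apply: cvg_trans; apply: near_eq_cvg; apply/nearW => n; apply: eq_integral.
Unshelve. all: by end_near. Qed.

(** The simple approximations are truncated where they exceed twice the norm of
    [u]; then dominated convergence applies, and their integrals form a Cauchy
    sequence. *)
Lemma bochner_exists u : complete_space X -> strongly_measurable X u ->
  (\int[mu]_(t in H) ((t : R)^-1 * nrm X (u t))%:E < +oo)%E ->
  exists f, bochner_integral X u f.
Proof.
move=> cX mu_ ufin; have /(strongly_measurableP nX)[uX [s_ [ss us]]] := mu_.
have uX' t : H t -> X (u t) by move=> /half_lineP; exact: uX.
have sX n t : H t -> X (s_ n t).
  by move=> /half_lineP t0; have /simple_funP[h _] := ss n; exact: h.
(* Off [E n] the approximation is replaced by [0]; where [u] does not vanish, each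
   point belongs to [E n] for large [n]. *)
pose E n : set T := H `&` [set t | nrm X (s_ n t) <= 2 * nrm X (u t)].
have mnu : measurable_fun H (fun t => nrm X (u t)) by exact: (measurable_nrm nX).
have mE n : measurable (E n).
  have mns : measurable_fun H (fun t => nrm X (s_ n t)).
    by apply: measurable_nrm_simple; have /simple_funP[] := ss n.
  have := measurable_fun_ler mns (measurable_funM (measurable_cst (2 : R)) mnu).
  by move=> /(_ measurable_half_line [set true] I).
pose z_ n := restr (E n) (s_ n).
have zX n t : H t -> X (z_ n t).
  by move=> Ht; rewrite /z_ /restr; case: ifPn => _; [exact: sX|exact: (normed0 nX)].
have zle n t : H t -> nrm X (z_ n t) <= 2 * nrm X (u t).
  move=> Ht; rewrite /z_ /restr; case: ifPn => [/set_mem[]//|_].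
  by rewrite (nrm0 nX) mulr_ge0// (nrm_ge0 nX).
have zs n : simple_fun X (z_ n).
  apply/simple_funP; split; first by move=> t t0; apply: zX; exact/half_lineP.
  have /simple_funP[_ h] := ss n.
  exact: (simple_map_comp (fun x : V * bool => if x.2 then x.1 else 0)
    (simple_map_pair h (simple_map_mem (mE n)))).
have zi n : integrable_simple_fun X (z_ n).
  split; first exact: zs.
  move=> v v0; have [[t0 [Ht0 zt0]]|nov] := pselect (exists t, level_set (z_ n) v t); last first.
    rewrite (_ : level_set _ _ = set0) ?/haar ?integral_set0 ?ltry//.
    by apply/seteqP; split => // t tv; apply: nov; exists t.
  have Xv : X v by rewrite -zt0; exact: zX.
  have nv0 : 0 < nrm X v.
    rewrite lt_neqAle (nrm_ge0 nX) andbT eq_sym; apply/eqP => /(nrm_eq0 nX Xv) v00.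
    by move: v0; rewrite v00 eqxx.
  apply: (@le_lt_trans _ _ ((2 / nrm X v)%:E *
      \int[mu]_(t in H) ((t : R)^-1 * nrm X (u t))%:E)%E); last first.
    by rewrite lte_mul_pinfty// lee_fin divr_ge0// ltW.
  rewrite -ge0_integralZl; last 4 first.
  - exact: measurable_half_line.
  - exact: measurable_haar_integrand.
  - by move=> t Ht; rewrite lee_fin mulr_ge0 ?inv0 ?(nrm_ge0 nX).
  - by rewrite lee_fin divr_ge0// ltW.
  apply: le_integral_subset => [t []//|t [Ht _]|t Ht|t [Ht zv]].
  - by rewrite lee_fin inv0.
  - by rewrite mule_ge0// lee_fin ?divr_ge0 ?(ltW nv0)// mulr_ge0 ?inv0 ?(nrm_ge0 nX).
  rewrite -EFinM lee_fin mulrCA ler_peMr ?inv0//.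
  rewrite mulrAC ler_pdivlMr// mul1r.
  by move: zv => /= <-; exact: zle.
have zu : L1_dist X u (z_ n) @[n --> \oo] --> 0%E.
  apply: (@haar_dominated (fun n t => nrm X (u t - z_ n t)) (fun t => 3 * nrm X (u t))).
  - move=> n; apply: (measurable_nrmB nX) => //.
    exact: (simple_strongly_measurable nX).
  - by apply: measurable_funM; [exact: measurable_cst|exact: mnu].
  - move=> n t Ht; rewrite (nrm_ge0 nX)/=.
    apply: (le_trans (ler_nrmB nX (uX' t Ht) (zX n t Ht))).
    have := zle n t Ht; lra.
  - apply: (@filterS _ _ (ae_filter_ringOfSetsType mu) _ _ _ us) => t ut t0.
    have Ht : H t by exact/half_lineP.
    have [u0|u0] := eqVneq (nrm X (u t)) 0.
      rewrite (_ : (fun n => _) = cst 0); first exact: cvg_cst.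
      apply/funext => n; apply/eqP; rewrite eq_le (nrm_ge0 nX) andbT.
      apply: (le_trans (ler_nrmB nX (uX' t Ht) (zX n t Ht))).
      by have := zle n t Ht; rewrite /= u0; lra.
    have up : 0 < nrm X (u t) by rewrite lt_neqAle eq_sym u0 (nrm_ge0 nX).
    have eqz : \forall n \near \oo, nrm X (u t - s_ n t) = nrm X (u t - z_ n t).
      apply: filterS (cvg0_le (ut t0) up) => n h; rewrite /z_ /restr mem_set//.
      split => //=; rewrite mulr_natl mulr2n -lerBlDr.
      apply: le_trans h; rewrite (nrm_distC nX (uX' t Ht) (sX n t Ht)).
      by apply: (le_trans (ler_norm _)); apply: (ler_dist_nrm nX); [exact: sX|exact: uX'].
    apply: cvg_trans (ut t0); exact: near_eq_cvg.
  rewrite (eq_integral (fun t : T => (3%:E * ((t : R)^-1 * nrm X (u t))%:E)%E)); last first.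
    by move=> t _; rewrite -EFinM mulrCA.
  rewrite ge0_integralZl; last 4 first.
  - exact: measurable_half_line.
  - exact: measurable_haar_integrand.
  - by move=> t Ht; rewrite lee_fin mulr_ge0 ?inv0 ?(nrm_ge0 nX).
  - by rewrite lee_fin.
  by rewrite lte_mul_pinfty// lee_fin.
have mz n : strongly_measurable X (z_ n) by exact: (simple_strongly_measurable nX).
have cauchy (e : R) : 0 < e -> exists N, forall m n, (N <= m)%N -> (N <= n)%N ->
    nrm X (simple_integral (z_ m) - simple_integral (z_ n)) <= e.
  move=> e0; have e2 : 0 < e / 2 by rewrite divr_gt0.
  have [N _ hN] := ecvg0_le zu e2 (fun n => L1_dist_ge0 nX u (z_ n)).
  exists N => m n Nm Nn; rewrite -lee_fin.
  apply: (le_trans (nrm_simple_integralB nX (zi m) (zi n))).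
  apply: (le_trans (L1_dist_tri nX (mz m) mu_ (mz n))).
  rewrite (L1_distC nX (mz m) mu_) (splitr e) EFinD.
  by apply: leeD; apply: hN.
have [f Xf fc] := cX _ (fun n => simple_integral_in nX (zi n)) cauchy.
exists f; apply/(bochnerP nX); split => //.
by exists z_.
Qed.

Lemma simple_approximation (phi : T -> R) :
  measurable_fun H phi -> (forall t, H t -> 0 <= phi t) ->
  exists g : nat -> T -> R,
    [/\ forall n, simple_map (g n) /\ measurable_fun H (g n),
        forall n t, 0 <= g n t,
        forall n t, H t -> g n t <= phi t &
        forall t, H t -> g n t @[n --> \oo] --> phi t].
Proof.
move=> mphi phi0.
have mphi' : measurable_fun H (EFin \o phi) by exact/measurable_EFinP.
have phi0' t : H t -> (0 <= (EFin \o phi) t)%E by move=> Ht; rewrite lee_fin phi0.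
have [g_ [gnd gc]] := approximation measurable_half_line mphi' phi0'.
pose g n : T -> R := g_ n.
have gc' t : H t -> g n t @[n --> \oo] --> phi t.
  by move=> Ht; exact: (fine_cvg (gc t Ht)).
exists g; split => [n|n t|n t Ht|//].
- split; last by apply: measurable_funTS; exact: measurable_funP.
  split; first by apply: sub_finite_set (fimfunP (g_ n)) => _ [t _ <-]; exists t.
  by move=> x; apply: measurableI; [exact: measurable_half_line|exact: measurable_sfunP].
- exact: fun_ge0.
have := gc' t Ht => gct.
rewrite -(cvg_lim _ gct)//; apply: (@nondecreasing_cvgn_le _ (fun n => g n t)).
  by move=> i j ij; exact/lefP/gnd.
by apply/cvg_ex; exists (phi t).
Qed.

(** The simple approximations cut the countable partition after finitely many
    pieces and replace the scalar factor by a simple one. *)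
Lemma strongly_measurable_scale (phi : T -> R) (k : T -> nat) (d : nat -> V) :
  measurable_fun H phi -> (forall t, H t -> 0 <= phi t) ->
  (forall j, measurable (level k j)) -> (forall j, X (d j)) ->
  strongly_measurable X (fun t => phi t *: d (k t)).
Proof.
move=> mphi phi0 mk Xd; have [g [sg g0 gle gc]] := simple_approximation mphi phi0.
apply/(strongly_measurableP nX); split; first by move=> t _; exact: (normedZ nX).
have sk n : simple_map (fun t => minn (k t) n).
  split.
    apply: (@sub_finite_set _ _ `I_n.+1); last exact: finite_II.
    by move=> _ [t _ <-] /=; rewrite ltnS geq_minr.
  move=> j; rewrite (_ : level _ _ = \bigcup_(i in [set i | minn i n = j]) level k i).
    by apply: bigcup_measurable => i _; exact: mk.
  by apply/seteqP; split => [t [Ht /= kt]|t [i /= <- [Ht /= <-]]]; [exists (k t)|].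
pose F n (x : R * nat) := (if (x.2 < n)%N then x.1 else 0) *: d x.2.
exists (fun n t => F n (g n t, minn (k t) n)); split.
  move=> n; apply/simple_funP; split; first by move=> t _; exact: (normedZ nX).
  exact: (simple_map_comp (F n) (simple_map_pair (sg n).1 (sk n))).
apply/nearW => t t0; have Ht : H t by exact/half_lineP.
apply: (@cvg_trans _ ((fun n => (phi t - g n t) * nrm X (d (k t))) @ \oo)).
  apply: near_eq_cvg; exists (k t).+1 => // n /= kn.
  rewrite /F/= (minn_idPl (ltnW kn)) kn -scalerBl (nrmZ nX) ?Xd// ger0_norm//.
  by rewrite subr_ge0 gle.
suff : (phi t - g n t) * nrm X (d (k t)) @[n --> \oo] --> 0 by [].
rewrite -[X in _ --> X](mul0r (nrm X (d (k t)))); apply: cvgMl.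
rewrite -[X in _ --> X](subrr (phi t)).
by apply: cvgB; [exact: cvg_cst|exact: gc].
Qed.

(** Simple functions below [phi], times [d], have multiples of [d] as their
    integrals. *)
Lemma bochner_scalar (phi : T -> R) (d : V) (c : R) : X d ->
  measurable_fun H phi -> (forall t, H t -> 0 <= phi t) ->
  (\int[mu]_(t in H) ((t : R)^-1 * phi t)%:E = c%:E)%E ->
  bochner_integral X (fun t => phi t *: d) (c *: d).
Proof.
move=> Xd mphi phi0 phic; have [g [sg' g0 gle gc]] := simple_approximation mphi phi0.
have sg n := (sg' n).1; have mg n := (sg' n).2.
have hg n x : x != 0 -> (haar (level (g n) x) < +oo)%E.
  move=> x0; have [xlt|xge] := ltP x 0.
    rewrite (_ : level _ _ = set0) ?/haar ?integral_set0 ?ltry//.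
    by apply/seteqP; split => // t [_ /= gx]; move: xlt; rewrite -gx ltNge g0.
  have xp : 0 < x by rewrite lt_neqAle eq_sym x0.
  apply: (@le_lt_trans _ _ ((x^-1)%:E *
      \int[mu]_(t in H) ((t : R)^-1 * phi t)%:E)%E); last by rewrite phic -EFinM ltry.
  rewrite -ge0_integralZl; last 4 first.
  - exact: measurable_half_line.
  - exact: measurable_haar_integrand.
  - by move=> t Ht; rewrite lee_fin mulr_ge0 ?inv0 ?phi0.
  - by rewrite lee_fin invr_ge0.
  apply: le_integral_subset => [t []//|t [Ht _]|t Ht|t [Ht /= gx]].
  - by rewrite lee_fin inv0.
  - by rewrite -EFinM lee_fin mulr_ge0 ?invr_ge0// mulr_ge0 ?inv0 ?phi0.
  by rewrite -EFinM lee_fin mulrCA ler_peMr ?inv0// mulrC ler_pdivlMr// mul1r -gx gle.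
pose a_ n := \sum_(x <- fset_set (g n @` H)) fine (haar (level (g n) x)) * x.
have aE n : ((a_ n)%:E = \int[mu]_(t in H) ((t : R)^-1 * g n t)%:E)%E.
  rewrite (eq_integral (fun t : T => (((t : R)^-1)%:E * `|g n t|%:E)%E)); last first.
    by move=> t _; rewrite ger0_norm ?EFinM.
  rewrite (integral_simple_map (G := fun x : R => `|x|%:E) (sg n)); last by move=> x; rewrite lee_fin.
  rewrite /a_ -sumEFin big_seq [RHS]big_seq.
  apply: eq_bigr => x; rewrite in_fset_set; last by have [] := sg n.
  move=> /set_mem[t _ <-]; rewrite ger0_norm//.
  have [->|x0] := eqVneq (g n t) 0; first by rewrite mulr0 mule0.
  rewrite EFinM fineK// ge0_fin_numE ?hg//; apply: haar_ge0; exact: level_sub.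
have sE n : simple_integral (fun t => g n t *: d) = a_ n *: d.
  rewrite (simple_integral_comp (F := fun x : R => x *: d) (sg n)); last first.
    by move=> x xd; apply: hg; apply: contra_neq xd => ->; rewrite scale0r.
  by rewrite /a_ scaler_suml; apply: eq_bigr => x _; rewrite scalerA.
pose e_ n := (\int[mu]_(t in H) (((t : R)^-1)%:E * (phi t - g n t)%:E))%E.
have e0 : e_ n @[n --> \oo] --> 0%E.
  apply: (@haar_dominated (fun n t => phi t - g n t) phi).
  - by move=> n; apply: measurable_funB; [exact: mphi|exact: mg].
  - exact: mphi.
  - by move=> n t Ht; rewrite subr_ge0 gle//= gerBl.
  - apply/nearW => t t0; rewrite -[X in _ --> X](subrr (phi t)).
    by apply: cvgB; [exact: cvg_cst|apply: gc; exact/half_lineP].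
  - by rewrite phic ltry.
have ce n : (c%:E = (a_ n)%:E + e_ n)%E.
  rewrite aE -phic -ge0_integralD; last 5 first.
  - exact: measurable_half_line.
  - by move=> t Ht; rewrite lee_fin mulr_ge0 ?inv0.
  - exact: measurable_haar_integrand.
  - by move=> t Ht; rewrite -EFinM lee_fin mulr_ge0 ?inv0// subr_ge0 gle.
  - apply: (@measurable_haar_integrand (fun t => phi t - g n t)).
    by apply: measurable_funB; [exact: mphi|exact: mg].
  by apply: eq_integral => t _; rewrite -EFinM -EFinD -mulrDr addrC subrK.
have eE n : e_ n = (c - a_ n)%:E.
  by rewrite EFinB (ce n) addeAC subee ?add0e.
have si n : integrable_simple_fun X (fun t => g n t *: d).
  split.
    apply/simple_funP; split; first by move=> t _; exact: (normedZ nX).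
    exact: (simple_map_comp (fun x : R => x *: d) (sg n)).
  apply: (integrable_map_comp (F := fun x : R => x *: d) (sg n)).
  by move=> x xd; apply: hg; apply: contra_neq xd => ->; rewrite scale0r.
have distE n t : H t ->
    nrm X (phi t *: d - g n t *: d) = (phi t - g n t) * nrm X d.
  by move=> Ht; rewrite -scalerBl (nrmZ nX)// ger0_norm// subr_ge0 gle.
apply/(bochnerP nX); split; first exact: (normedZ nX).
  apply: (@strongly_measurable_scale phi (fun=> 0%N) (fun=> d)) => // j.
  exact: (simple_map_cst 0%N).2.
exists (fun n t => g n t *: d); split => //.
  rewrite (_ : (fun n => _) = fun n => ((nrm X d)%:E * e_ n)%E).
    rewrite -[X in _ --> X](mule0 (nrm X d)%:E).
    by apply: cvgeZl.
  apply/funext => n; rewrite /L1_dist /e_ -ge0_integralZl; last 4 first.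
  - exact: measurable_half_line.
  - apply: (@measurable_haar_integrand (fun t => phi t - g n t)).
    by apply: measurable_funB; [exact: mphi|exact: mg].
  - by move=> t Ht; rewrite -EFinM lee_fin mulr_ge0 ?inv0// subr_ge0 gle.
  - by rewrite lee_fin (nrm_ge0 nX).
  apply: eq_integral => t /set_mem Ht; rewrite distE// -!EFinM; congr EFin; ring.
rewrite (_ : (fun n => _) = fun n => (c - a_ n) * nrm X d).
  rewrite -[X in _ --> X](mul0r (nrm X d)); apply: cvgMl.
  rewrite (_ : (fun n => _) = fine \o e_); first exact: (fine_cvg e0).
  by apply/funext => n; rewrite /= eE.
apply/funext => n; rewrite sE -scalerBl (nrmZ nX)// ger0_norm//.
rewrite -lee_fin -eE; apply: integral_ge0 => t Ht.
by rewrite -EFinM lee_fin mulr_ge0 ?inv0// subr_ge0 gle.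
Qed.

End bochner_existence.

(** * The spaces of a compatible couple *)

Section embedded_space.
Context {R : realType} {V : topologicalLmodType R} (B : normedModType R).
Context (i : {linear B -> V}).
Hypothesis i_inj : injective i.
Notation X := (embedded i).

Lemma snorm_embedded x : snorm X (i x) = `|x|%:E.
Proof.
rewrite /embedded/= (_ : [set _ | _ in _] = [set `|x|%:E]) ?ereal_inf1//.
by apply/seteqP; split => [_ [y /= /i_inj -> <-]|_ ->]; [|exists x].
Qed.

Lemma nrm_embedded x : nrm X (i x) = `|x|.
Proof. by rewrite /nrm snorm_embedded. Qed.

(** The norm is carried over along the injection. *)
Lemma normed_embedded : normed X.
Proof.
split.
- by exists 0; rewrite ?linear0.
- by move=> _ _ [x _ <-] [y _ <-]; exists (x + y); rewrite ?linearD.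
- by move=> c _ [x _ <-]; exists (c *: x); rewrite ?linearZ.
- by move=> _ [x _ <-]; rewrite snorm_embedded.
- by move=> f; apply: le_ereal_inf_tmp => _ [x _ <-]; rewrite lee_fin.
- by move=> c _ [x _ <-]; rewrite -linearZ !snorm_embedded normrZ EFinM.
- by move=> _ _ [x _ <-] [y _ <-]; rewrite -linearD !snorm_embedded -EFinD lee_fin ler_normD.
- move=> _ [x _ <-]; rewrite snorm_embedded => /eqP; rewrite eqe normr_eq0 => /eqP ->.
  by rewrite linear0.
Qed.

End embedded_space.

Lemma complete_embedded (R : realType) (V : topologicalLmodType R)
  (B : completeNormedModType R) (i : {linear B -> V}) :
  injective i -> complete_space (embedded i).
Proof.
move=> i_inj f_ Xf cf.
have /choice[x_ xf] : forall n, exists x, i x = f_ n.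
  by move=> n; have [x _ xf] := Xf n; exists x.
have cx : cvgn x_.
  apply/cauchy_cvgP/cauchy_ballP => e e0.
  have e20 : 0 < e / 2 by rewrite divr_gt0.
  have [N hN] := cf _ e20.
  pose A : set B := x_ @` [set n | (N <= n)%N].
  have FA : (x_ @ \oo) A by exists N => // n Nn; exists n.
  exists (A, A) => // -[_ _] [[m Nm <-] [n Nn <-]]; rewrite -ball_normE/=.
  apply: (@le_lt_trans _ _ (e / 2)); last by rewrite gtr_pMr ?invf_lt1// ltr1n.
  by rewrite -(nrm_embedded i_inj) linearB !xf; exact: hN.
exists (i (limn x_)); first by exists (limn x_).
rewrite (_ : (fun n => _) = fun n => `|limn x_ - x_ n|).
  by apply/norm_cvg0P; rewrite -[X in _ --> X](subrr (limn x_)); apply: cvgB => //; exact: cvg_cst.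
by apply/funext => n; rewrite -xf -linearB (nrm_embedded i_inj).
Qed.

Section intersection_space.
Context {R : realType} {V : topologicalLmodType R}.
Context (X Y : Defs.space R V) (nX : normed X) (nY : normed Y).
Notation XY := (space_cap X Y).

Lemma nrm_cap f : X f -> Y f -> nrm XY f = Num.max (nrm X f) (nrm Y f).
Proof. by move=> Xf Yf; rewrite /nrm/= (snormE nX Xf) (snormE nY Yf) -EFin_max. Qed.

Lemma normed_cap : normed XY.
Proof.
have capE f : XY f -> snorm XY f = (Num.max (nrm X f) (nrm Y f))%:E.
  by move=> [Xf Yf]; rewrite /= (snormE nX Xf) (snormE nY Yf) EFin_max.
have D f g : XY f -> XY g -> XY (f + g).
  by move=> [? ?] [? ?]; split; [exact: (normedD nX)|exact: (normedD nY)].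
have Z (c : R) f : XY f -> XY (c *: f).
  by move=> [? ?]; split; [exact: (normedZ nX)|exact: (normedZ nY)].
split => //.
- by split; [exact: (normed0 nX)|exact: (normed0 nY)].
- by move=> f Xf; rewrite capE.
- by move=> f; rewrite /= le_max (snorm_ge0 nX).
- move=> c f [Xf Yf]; rewrite !capE//; last by apply: Z.
  by rewrite (nrmZ nX)// (nrmZ nY)// -EFinM -maxr_pMr.
- move=> f g [Xf Yf] [Xg Yg]; rewrite !capE//; last by apply: D.
  rewrite -EFinD lee_fin ge_max; apply/andP; split.
    by apply: (le_trans (ler_nrmD nX Xf Xg)); apply: lerD; rewrite le_max lexx.
  by apply: (le_trans (ler_nrmD nY Yf Yg)); apply: lerD; rewrite le_max lexx orbT.
- move=> f [Xf Yf]; rewrite capE// => -[m0]; apply: (nrm_eq0 nX Xf).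
  by apply/eqP; rewrite eq_le (nrm_ge0 nX) andbT -m0 le_max lexx.
Qed.

Lemma sub_space_capl : sub_space XY X.
Proof. by move=> f [Xf Yf]; split => //; rewrite nrm_cap// le_max lexx. Qed.

Lemma sub_space_capr : sub_space XY Y.
Proof. by move=> f [Xf Yf]; split => //; rewrite nrm_cap// le_max lexx orbT. Qed.

End intersection_space.

Section couple.
Context {R : realType} (C : compatible_couple R).
Notation V := (ambient C).
Notation X := (X0 C).
Notation Y := (X1 C).
Notation S := (space_sum X Y).
Implicit Types (f g : V) (t : R).

Lemma normed0_couple : normed X.
Proof. exact: (normed_embedded (@emb0_inj _ C)). Qed.

Lemma normed1_couple : normed Y.
Proof. exact: (normed_embedded (@emb1_inj _ C)). Qed.

Let nX := normed0_couple.
Let nY := normed1_couple.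

Lemma Kfun_le f0 f1 t : X f0 -> Y f1 ->
  (Kfun (f0 + f1)%R t <= (nrm X f0 + t * nrm Y f1)%:E)%E.
Proof.
move=> Xf0 Yf1; apply: ereal_inf_lbound; exists f0, f1; split => //.
by rewrite (snormE nX Xf0) (snormE nY Yf1) -EFinM -EFinD.
Qed.

Lemma Kfun_ge0 f t : 0 <= t -> (0 <= Kfun f t)%E.
Proof.
move=> t0; apply: le_ereal_inf_tmp => _ [f0 [f1 [_ _ _ ->]]].
by rewrite adde_ge0 ?mule_ge0 ?(snorm_ge0 nX) ?(snorm_ge0 nY).
Qed.

Lemma KfunE f t : S f -> 0 <= t -> Kfun f t = (fine (Kfun f t))%:E.
Proof.
move=> [f0 [f1 [Xf0 Yf1 ->]]] t0; rewrite fineK// ge0_fin_numE ?Kfun_ge0//.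
by apply: le_lt_trans (Kfun_le _ Xf0 Yf1) _; rewrite ltry.
Qed.

Lemma Kfun_decomposition f t e : S f -> 0 <= t -> 0 < e ->
  exists f0 f1, [/\ X f0, Y f1, f = f0 + f1 &
    nrm X f0 + t * nrm Y f1 < fine (Kfun f t) + e].
Proof.
move=> Sf t0 e0; have KE := KfunE Sf t0.
have Kfin : Kfun f t \is a fin_num by rewrite KE.
have [_ [f0 [f1 [Xf0 Yf1 fE ->]]]] := lb_ereal_inf_adherent e0 Kfin.
rewrite -/(Kfun f t) KE (snormE nX Xf0) (snormE nY Yf1) -EFinM -!EFinD lte_fin => lt.
by exists f0, f1.
Qed.

(** A vector whose K-functional vanishes is the limit of the constant
    sequence of its decompositions, both of whose parts tend to zero in a
    Hausdorff space. *)
Lemma Kfun_eq0 f t : S f -> 0 < t -> Kfun f t = 0%E -> f = 0.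
Proof.
move=> Sf t0 K0.
have /choice[x_ hx] : forall n, exists z : banach0 C * banach1 C,
    f = emb0 C z.1 + emb1 C z.2 /\ `|z.1| + t * `|z.2| < n.+1%:R^-1.
  move=> n; have e0 : 0 < n.+1%:R^-1 :> R by rewrite invr_gt0.
  have [_ [_ [[x _ <-] [y _ <-] fE]]] := Kfun_decomposition Sf (ltW t0) e0.
  rewrite K0/= add0r (nrm_embedded (@emb0_inj _ C)) (nrm_embedded (@emb1_inj _ C)) => lt.
  by exists (x, y).
have c0 : (x_ n).1 @[n --> \oo] --> 0.
  apply/norm_cvg0P; apply: (@cvg0_squeeze _ _ (fun n => n.+1%:R^-1)).
    move=> n; rewrite normr_ge0/= (le_trans _ (ltW (hx n).2))// lerDl.
    by rewrite mulr_ge0// ltW.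
  exact: cvg_harmonic.
have c1 : (x_ n).2 @[n --> \oo] --> 0.
  apply/norm_cvg0P; apply: (@cvg0_squeeze _ _ (fun n => t^-1 * n.+1%:R^-1)).
    move=> n; rewrite normr_ge0/= ler_pdivlMl// (le_trans _ (ltW (hx n).2))//.
    by rewrite lerDr.
  rewrite -[X in _ --> X](mulr0 t^-1); apply: cvgMr; exact: cvg_harmonic.
have cf : emb0 C (x_ n).1 + emb1 C (x_ n).2 @[n --> \oo] --> (0 : V).
  rewrite (_ : (0 : V) = emb0 C 0 + emb1 C 0); last by rewrite !linear0 addr0.
  apply: continuous2_cvg.
  - exact: (@add_continuous V (_, _)).
  - by apply: (continuous_cvg _ _ c0); exact: (@emb0_continuous _ C).
  - by apply: (continuous_cvg _ _ c1); exact: (@emb1_continuous _ C).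
have cf' : (fun n : nat => f) @ \oo --> (0 : V).
  by rewrite (_ : (fun n => f) = fun n => emb0 C (x_ n).1 + emb1 C (x_ n).2)//;
    apply/funext => n; have [<-] := hx n.
have cff : (fun n : nat => f) @ \oo --> f by exact: cvg_cst.
exact: (@cvg_unique V (@ambient_hausdorff _ C) _ (fmap_proper_filter (fun=> f) eventually_filter) f 0 cff cf').
Qed.

(** Hence the norm axioms for the sum are statements about the K-functional. *)
Lemma snorm_sumE f : snorm S f = Kfun f 1.
Proof.
congr ereal_inf; apply/funext => k; apply/propext.
by split => -[f0 [f1 [Xf0 Yf1 fE ->]]]; exists f0, f1; split; rewrite ?mul1e.
Qed.

Lemma normed_sum_couple : normed S.
Proof.
have D f g : S f -> S g -> S (f + g).
  move=> [f0 [f1 [Xf0 Yf1 ->]]] [g0 [g1 [Xg0 Yg1 ->]]].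
  exists (f0 + g0), (f1 + g1); split; [exact: (normedD nX)|exact: (normedD nY)|].
  by rewrite addrACA.
have Z (c : R) f : S f -> S (c *: f).
  move=> [f0 [f1 [Xf0 Yf1 ->]]].
  exists (c *: f0), (c *: f1); split; [exact: (normedZ nX)|exact: (normedZ nY)|].
  by rewrite scalerDr.
have Kfin f : S f -> snorm S f = (fine (Kfun f 1))%:E.
  by move=> Sf; rewrite snorm_sumE KfunE.
have S0 : S 0 by exists 0, 0; split; [exact: (normed0 nX)|exact: (normed0 nY)|rewrite addr0].
have ZK (c : R) f : S f -> fine (Kfun (c *: f) 1) <= `|c| * fine (Kfun f 1).
  move=> Sf; have [->|c0] := eqVneq c 0.
    rewrite scale0r normr0 mul0r -lee_fin -KfunE//.
    have := @Kfun_le 0 0 1 (normed0 nX) (normed0 nY).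
    by rewrite (nrm0 nX) (nrm0 nY) mulr0 !addr0.
  have c0' : 0 < `|c| by rewrite normr_gt0.
  apply/ler_addgt0Pr => e e0.
  have [f0 [f1 [Xf0 Yf1 fE lt]]] := Kfun_decomposition Sf ler01 (divr_gt0 e0 c0').
  rewrite -lee_fin -KfunE//; last exact: Z.
  rewrite fE scalerDr; apply: (le_trans (Kfun_le _ (normedZ nX c Xf0) (normedZ nY c Yf1))).
  rewrite lee_fin (nrmZ nX)// (nrmZ nY)// mul1r -mulrDr -[e in leRHS](mulfVK (lt0r_neq0 c0')).
  rewrite [_ / _ * _]mulrC -mulrDr ler_wpM2l//; move: lt; rewrite mul1r -fE; exact: ltW.
split => //.
- by move=> f Sf; rewrite Kfin.
- by move=> f; rewrite snorm_sumE Kfun_ge0.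
- move=> c f Sf; rewrite !Kfin//; last exact: Z.
  rewrite -EFinM; congr EFin; apply/eqP; rewrite eq_le ZK//=.
  have [->|c0] := eqVneq c 0.
    by rewrite normr0 mul0r fine_ge0// Kfun_ge0.
  have := ZK c^-1 _ (Z c f Sf); rewrite scalerA mulVf// scale1r normfV.
  by rewrite ler_pdivlMl ?normr_gt0.
- move=> f g Sf Sg; rewrite !Kfin//; last exact: D.
  rewrite -EFinD lee_fin; apply/ler_addgt0Pr => e e0.
  have e20 : 0 < e / 2 by rewrite divr_gt0.
  have [f0 [f1 [Xf0 Yf1 fE flt]]] := Kfun_decomposition Sf ler01 e20.
  have [g0 [g1 [Xg0 Yg1 gE glt]]] := Kfun_decomposition Sg ler01 e20.
  rewrite -lee_fin -KfunE//; last exact: D.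
  rewrite {1}fE {1}gE addrACA.
  apply: (le_trans (Kfun_le _ (normedD nX Xf0 Xg0) (normedD nY Yf1 Yg1))); rewrite lee_fin.
  have := ler_nrmD nX Xf0 Xg0; have := ler_nrmD nY Yf1 Yg1; lra.
- by move=> f Sf; rewrite snorm_sumE; exact: Kfun_eq0.
Qed.

Let nS := normed_sum_couple.

Lemma nrm_sumE f : nrm S f = fine (Kfun f 1).
Proof. by rewrite /nrm snorm_sumE. Qed.

Lemma sub_space0_sum : sub_space X S.
Proof.
move=> f Xf; have Sf : S f.
  by exists f, 0; split => //; [exact: (normed0 nY)|rewrite addr0].
split => //; rewrite nrm_sumE -lee_fin -KfunE//.
by have := Kfun_le 1 Xf (normed0 nY); rewrite (nrm0 nY) mulr0 !addr0.
Qed.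

Lemma sub_space1_sum : sub_space Y S.
Proof.
move=> f Yf; have Sf : S f.
  by exists 0, f; split => //; [exact: (normed0 nX)|rewrite add0r].
split => //; rewrite nrm_sumE -lee_fin -KfunE//.
by have := Kfun_le 1 (normed0 nX) Yf; rewrite (nrm0 nX) mul1r !add0r.
Qed.

Lemma sub_space_cap_sum : sub_space (space_cap X Y) S.
Proof.
move=> f XYf; have [Xf le0] := sub_space_capl nX nY XYf.
by have [Sf le1] := sub_space0_sum Xf; split => //; exact: le_trans le1 le0.
Qed.

(** When the K-functional vanishes the trivial decomposition is exact. *)
Lemma Kfun_near_optimal f t : S f -> 0 < t ->
  exists f0 f1, [/\ X f0, Y f1, f = f0 + f1 &
    nrm X f0 + t * nrm Y f1 <= 2 * fine (Kfun f t)].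
Proof.
move=> Sf t0; have KE := KfunE Sf (ltW t0).
have [K0|K0] := eqVneq (fine (Kfun f t)) 0.
  exists 0, 0; split; [exact: (normed0 nX)|exact: (normed0 nY)| |].
    by rewrite addr0; apply: (Kfun_eq0 Sf t0); rewrite KE K0.
  by rewrite (nrm0 nX) (nrm0 nY) K0 mulr0 addr0 mulr0.
have Kp : 0 < fine (Kfun f t).
  by rewrite lt_neqAle eq_sym K0 fine_ge0// Kfun_ge0// ltW.
have [f0 [f1 [Xf0 Yf1 fE lt]]] := Kfun_decomposition Sf (ltW t0) Kp.
by exists f0, f1; split => //; rewrite mulr_natl mulr2n ltW.
Qed.

Lemma le_Kfun f s t : S f -> 0 <= s -> s <= t -> fine (Kfun f s) <= fine (Kfun f t).
Proof.
move=> Sf s0 st; have t0 : 0 <= t by exact: le_trans st.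
apply/ler_addgt0Pr => e e0.
have [f0 [f1 [Xf0 Yf1 fE lt]]] := Kfun_decomposition Sf t0 e0.
apply: le_trans (ltW lt); rewrite -lee_fin -KfunE// [in leLHS]fE.
apply: (le_trans (Kfun_le _ Xf0 Yf1)).
by rewrite lee_fin lerD2l ler_wpM2r// (nrm_ge0 nY).
Qed.

Lemma Kfun_le_nrm0 f t : X f -> (Kfun f t <= (nrm X f)%:E)%E.
Proof.
by move=> Xf; have := Kfun_le t Xf (normed0 nY); rewrite (nrm0 nY) mulr0 !addr0.
Qed.

End couple.

(** * Representations of vectors as integrals *)

Section bochner_restriction.
Context {R : realType} {V : topologicalLmodType R}.
Context (X : Defs.space R V) (nX : normed X).
Notation T := (lebR R).
Notation mu := (leb R).
Notation H := (half_line R : set T).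

Lemma integral_restr (E : set T) (u : T -> V) : E `<=` H ->
  (\int[mu]_(t in H) ((t : R)^-1 * nrm X (restr E u t))%:E =
   \int[mu]_(t in E) ((t : R)^-1 * nrm X (u t))%:E)%E.
Proof.
move=> EH; rewrite -[in RHS](setIidr EH) integral_mkcondr.
apply: eq_integral => t _; rewrite /patch /restr; case: ifP => // _.
by rewrite (nrm0 nX) mulr0.
Qed.

Lemma bochner_exists_restr (E : set T) (u : T -> V) : complete_space X ->
  measurable E -> E `<=` H -> strongly_measurable X u ->
  (\int[mu]_(t in E) ((t : R)^-1 * nrm X (u t))%:E < +oo)%E ->
  exists2 f, bochner_integral X (restr E u) f &
    ((nrm X f)%:E <= \int[mu]_(t in E) ((t : R)^-1 * nrm X (u t))%:E)%E.
Proof.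
move=> cX mE EH mu_ fin.
have [|f hf] := bochner_exists nX cX (strongly_measurable_restr nX mE mu_).
  by rewrite integral_restr.
by exists f => //; rewrite -integral_restr//; exact: (nrm_bochner_le nX hf).
Qed.

End bochner_restriction.

Section representations.
Context {R : realType} (C : compatible_couple R).
Notation V := (ambient C).
Notation T := (lebR R).
Notation mu := (leb R).
Notation H := (half_line R : set T).
Notation X := (X0 C).
Notation Y := (X1 C).
Notation XY := (space_cap X Y).
Notation S := (space_sum X Y).
Implicit Types (f g h : V) (u : T -> V) (v w : R -> R) (q : \bar R).

Let nX : normed X := normed0_couple C.
Let nY : normed Y := normed1_couple C.
Let nXY : normed XY := normed_cap nX nY.
Let nS : normed S := normed_sum_couple C.
Let cX : complete_space X := complete_embedded (@emb0_inj _ C).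
Let cY : complete_space Y := complete_embedded (@emb1_inj _ C).

(** The real value of [Jfun (u t) t] along a function [u] with values in the
    intersection. *)
Definition Jnrm u (t : T) : R := Num.max (nrm X (u t)) ((t : R) * nrm Y (u t)).

Lemma Jnrm_ge0 u t : 0 <= Jnrm u t.
Proof. by rewrite le_max (nrm_ge0 nX). Qed.

Lemma measurable_Jnrm u : strongly_measurable XY u -> measurable_fun H (Jnrm u).
Proof.
move=> su; apply: measurable_maxr.
  exact: (measurable_nrm nX (strongly_measurable_sub_space nXY nX (sub_space_capl nX nY) su)).
apply: measurable_funM; first exact: measurable_leb_id.
exact: (measurable_nrm nY (strongly_measurable_sub_space nXY nY (sub_space_capr nX nY) su)).
Qed.

Lemma Lq_norm_Jfun q v u : strongly_measurable XY u ->
  Lq_norm q (fun t => (t `^ (- recip q) * v t)%:E * Jfun (u t) t)%E =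
  weighted_norm q v (Jnrm u).
Proof.
move=> su; apply: eq_Lq_norm => t /half_lineP t0.
have [Xu Yu] := strongly_measurable_in su t0.
by rewrite /Jfun (snormE nX Xu) (snormE nY Yu) -EFinM -EFin_max -EFinM.
Qed.

Lemma J_norm_le q v f u : J_representation f u ->
  (J_norm q v f <= weighted_norm q v (Jnrm u))%E.
Proof.
by move=> fu; apply: ereal_inf_lbound; exists u => //; apply: Lq_norm_Jfun; have [] := fu.
Qed.

Lemma le_J_norm q v f (y : \bar R) :
  (forall u, J_representation f u -> (y <= weighted_norm q v (Jnrm u))%E) ->
  (y <= J_norm q v f)%E.
Proof.
move=> h; apply: le_ereal_inf_tmp => _ [u fu <-].
by rewrite Lq_norm_Jfun; [exact: h|have [] := fu].
Qed.

Lemma J_norm_finite q v f : (J_norm q v f < +oo)%E ->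
  exists2 u, J_representation f u & (weighted_norm q v (Jnrm u) < +oo)%E.
Proof.
move=> /ereal_inf_lt[_ [u fu <-]]; rewrite Lq_norm_Jfun; last by have [] := fu.
by exists u.
Qed.

Lemma integral_nrm0_le (E : set T) u : E `<=` H ->
  (\int[mu]_(t in E) ((t : R)^-1 * nrm X (u t))%:E <=
   \int[mu]_(t in E) ((t : R)^-1 * Jnrm u t)%:E)%E.
Proof.
move=> EH; apply: le_integral_on => t /EH/half_lineP t0.
  by rewrite lee_fin mulr_ge0 ?(nrm_ge0 nX)// invr_ge0 ltW.
by rewrite lee_fin ler_wpM2l ?invr_ge0 ?(ltW t0)// le_max lexx.
Qed.

Lemma integral_nrm1_le (E : set T) u : E `<=` H ->
  (\int[mu]_(t in E) ((t : R)^-1 * nrm Y (u t))%:E <=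
   \int[mu]_(t in E) ((t : R)^-1 * ((t : R)^-1 * Jnrm u t))%:E)%E.
Proof.
move=> EH; apply: le_integral_on => t /EH/half_lineP t0.
  by rewrite lee_fin mulr_ge0 ?(nrm_ge0 nY)// invr_ge0 ltW.
rewrite lee_fin ler_wpM2l ?invr_ge0 ?(ltW t0)// ler_pdivlMl//.
by rewrite le_max lexx orbT.
Qed.

Lemma half_lineco (t : R) : 0 < t -> (`[t, +oo[%classic : set R) `<=` half_line R.
Proof.
by move=> t0 s /=; rewrite in_itv/= andbT => ts; apply/half_lineP/(lt_le_trans t0).
Qed.

(** Cutting a representation at [t] decomposes the vector between the two
    spaces; absolute convergence in each of them suffices. *)
Lemma representation_split f u (t : R) : 0 < t -> J_representation f u ->
  (\int[mu]_(s in (`]0%R, t[%classic : set R)) ((s : R)^-1 * Jnrm u s)%:E < +oo)%E ->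
  (\int[mu]_(s in (`[t, +oo[%classic : set R)) ((s : R)^-1 * ((s : R)^-1 * Jnrm u s))%:E
    < +oo)%E ->
  exists h g, [/\ f = h + g, bochner_integral X (restr (`]0%R, t[%classic : set R) u) h,
    Y g,
    ((nrm X h)%:E <=
      \int[mu]_(s in (`]0%R, t[%classic : set R)) ((s : R)^-1 * Jnrm u s)%:E)%E &
    ((nrm Y g)%:E <=
      \int[mu]_(s in (`[t, +oo[%classic : set R)) ((s : R)^-1 * ((s : R)^-1 * Jnrm u s))%:E)%E].
Proof.
move=> t0 [su fu] fin0 fin1.
have E0H : (`]0%R, t[%classic : set R) `<=` H by exact: itv0_half_line.
have E1H := half_lineco t0.
have su0 := strongly_measurable_sub_space nXY nX (sub_space_capl nX nY) su.
have su1 := strongly_measurable_sub_space nXY nY (sub_space_capr nX nY) su.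
have [|h hh hle] := bochner_exists_restr nX cX (measurable_leb_itv _) E0H su0.
  exact: le_lt_trans (integral_nrm0_le _ E0H) fin0.
have [|g gg gle] := bochner_exists_restr nY cY (measurable_leb_itv _) E1H su1.
  exact: le_lt_trans (integral_nrm1_le _ E1H) fin1.
exists h, g; split.
- apply: (bochner_unique nS fu).
  have sum := bochnerD nS
    (bochner_sub_space nX nS (@sub_space0_sum _ C) hh)
    (bochner_sub_space nY nS (@sub_space1_sum _ C) gg).
  apply: (eq_bochner nS _ sum) => s s0; rewrite /restr.
  have [st|ts] := ltP s t.
    rewrite mem_set/= ?in_itv/= ?s0// memNset ?addr0//=.
    by rewrite in_itv/= andbT leNgt st.
  rewrite memNset/= ?in_itv/= ?s0/= ?ltNge ?ts// mem_set/= ?in_itv/= ?ts ?add0r//.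
- exact: hh.
- by have [] := gg.
- by apply: (le_trans hle); exact: integral_nrm0_le.
- by apply: (le_trans gle); exact: integral_nrm1_le.
Qed.

(** Trivial when one of the integrals diverges; otherwise the representation is
    cut at [t]. *)
Lemma Kfun_le_integrals f u (t : R) : 0 < t -> J_representation f u ->
  (Kfun f t <=
    \int[mu]_(s in (`]0%R, t[%classic : set R)) ((s : R)^-1 * Jnrm u s)%:E +
    t%:E * \int[mu]_(s in (`[t, +oo[%classic : set R))
      ((s : R)^-1 * ((s : R)^-1 * Jnrm u s))%:E)%E.
Proof.
move=> t0 fu.
have E0H : (`]0%R, t[%classic : set R) `<=` H by exact: itv0_half_line.
have E1H := half_lineco t0.
have i0 : (0 <= \int[mu]_(s in (`]0%R, t[%classic : set R)) ((s : R)^-1 * Jnrm u s)%:E)%E.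
  apply: integral_ge0 => s /E0H/half_lineP s0.
  by rewrite lee_fin mulr_ge0 ?Jnrm_ge0// invr_ge0 ltW.
have i1 : (0 <= \int[mu]_(s in (`[t, +oo[%classic : set R))
      ((s : R)^-1 * ((s : R)^-1 * Jnrm u s))%:E)%E.
  apply: integral_ge0 => s /E1H/half_lineP s0.
  by rewrite lee_fin !mulr_ge0 ?Jnrm_ge0// invr_ge0 ltW.
have [fin0|] := ltP (\int[mu]_(s in (`]0%R, t[%classic : set R)) ((s : R)^-1 * Jnrm u s)%:E)%E
  +oo%E; last first.
  rewrite leye_eq => /eqP ->; rewrite addye ?leey// gt_eqF//.
  by apply: (lt_le_trans (ltNyr 0)); rewrite mule_ge0// lee_fin ltW.
have [fin1|] := ltP (\int[mu]_(s in (`[t, +oo[%classic : set R))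
      ((s : R)^-1 * ((s : R)^-1 * Jnrm u s))%:E)%E +oo%E; last first.
  rewrite leye_eq => /eqP ->; rewrite gt0_muley ?lte_fin// addey ?leey// gt_eqF//.
  exact: (lt_le_trans (ltNyr 0)).
have [h [g [-> [Xh _ _] Yg hle gle]]] := representation_split t0 fu fin0 fin1.
apply: (le_trans (Kfun_le _ Xh Yg)).
by rewrite EFinD EFinM leeD// lee_pmul2l ?lte_fin.
Qed.

End representations.

Section gluing.
Context {R : realType} (C : compatible_couple R) (q : \bar R).
Hypothesis q1 : (1 < q)%E.
Notation V := (ambient C).
Notation T := (lebR R).
Notation mu := (leb R).
Notation H := (half_line R : set T).
Notation X := (X0 C).
Notation Y := (X1 C).
Notation XY := (space_cap X Y).
Notation S := (space_sum X Y).
Notation p := (conj_exp q).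
Notation r := (recip q).
Implicit Types (f g h : V) (u : T -> V) (v w : R -> R).

Let nX : normed X := normed0_couple C.
Let nY : normed Y := normed1_couple C.
Let nXY : normed XY := normed_cap nX nY.
Let nS : normed S := normed_sum_couple C.
Let cX : complete_space X := complete_embedded (@emb0_inj _ C).

Lemma weighted_norm_finite v (phi : T -> R) : (weighted_norm q v phi < +oo)%E ->
  exists2 N : R, 0 <= N & weighted_norm q v phi = N%:E.
Proof.
move=> Nfin; have Ny : weighted_norm q v phi != +oo%E by rewrite lt_eqF.
by have [NE N0] := Lq_norm_finite Ny; exists (fine (weighted_norm q v phi)).
Qed.

(** The factor [t] cancels the [t^-1] of the measure [dt/t]. *)
Definition bump (t : T) : R := if (t : R) \in `[1%R, 2%R[%classic then (t : R) else 0.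

Lemma bump_ge0 t : 0 <= bump t.
Proof.
rewrite /bump; case: ifPn => // /set_mem/=; rewrite in_itv/= => /andP[t1 _].
exact: le_trans ler01 t1.
Qed.

Lemma measurable_bump (D : set T) : measurable_fun D bump.
Proof.
rewrite (_ : bump = fun t : T =>
    (t : R) * (if (t : R) \in (`[1%R, 2%R[%classic : set R) then 1 else 0)); last first.
  by apply/funext => t; rewrite /bump; case: ifP => _; rewrite ?mulr1 ?mulr0.
apply: measurable_funM; first exact: measurable_leb_id.
exact: (measurable_two_valued _ _ (measurable_leb_itv _)).
Qed.

Lemma integral_bump : (\int[mu]_(t in H) ((t : R)^-1 * bump t)%:E = 1%:E)%E.
Proof.
rewrite (_ : (\int[mu]_(t in H) _)%E = (\int[mu]_(t in H)
    ((fun=> 1%:E) \_ (`[1%R, 2%R[%classic : set T)) t)%E).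
  rewrite -integral_mkcondr setIidr; last first.
    by move=> t /=; rewrite in_itv/= => /andP[t1 _]; apply/half_lineP/(lt_le_trans ltr01).
  rewrite integral_cst; last exact: measurable_leb_itv.
  rewrite mul1e; transitivity ((2 - 1 : R)%:E); first by apply: leb_itvco; rewrite ler1n.
  by congr EFin; lra.
apply: eq_integral => t /set_mem/half_lineP t0; rewrite /patch /bump.
by case: ifPn => _; rewrite ?mulr0// mulVf// gt_eqF.
Qed.

Lemma Jnrm_addition u u' (t : R) : 0 < t -> XY (u t) -> XY (u' t) ->
  Jnrm (fun s => u s + u' s) t <= Jnrm u t + Jnrm u' t.
Proof.
move=> t0 [Xu Yu] [Xu' Yu']; rewrite /Jnrm ge_max; apply/andP; split.
  by apply: (le_trans (ler_nrmD nX Xu Xu')); apply: lerD; rewrite le_max lexx.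
apply: (@le_trans _ _ (t * nrm Y (u t) + t * nrm Y (u' t))).
  by rewrite -mulrDr ler_wpM2l ?(ltW t0)// (ler_nrmD nY).
by apply: lerD; rewrite le_max lexx orbT.
Qed.

(** A vector of the intersection can be added to the integral at the price of
    its two norms, by spreading it over [[1, 2[], where a slowly varying
    weight is bounded. *)
Lemma glue_representation w : slowly_varying w ->
  exists2 K : R, 0 < K & forall u h g,
    strongly_measurable XY u -> bochner_integral X u h -> XY g ->
    J_representation (h + g) (fun t => u t + bump t *: g) /\
    (weighted_norm q w (Jnrm (fun t => (u t + bump t *: g)%R)) <=
      K%:E * (weighted_norm q w (Jnrm u) + (nrm X g + nrm Y g)%:E))%E.
Proof.
move=> sw; have [w0 _ _] := sw.
have [l [L [_ L0 lL]]] := slowly_varying_locally_bounded sw ltr01 (ler1n R 2).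
have r0 := recip_ge0 q1.
(* [4] is the constant of the quasi-triangle inequality, and [L (4 G)] bounds the
   weighted value of [J] on the added piece. *)
exists (4 + 16 * L); first by rewrite addr_gt0// mulr_gt0.
move=> u h g su uh [Xg Yg]; split.
  have sb : strongly_measurable XY (fun t => bump t *: g).
    apply: (strongly_measurable_scale nXY (k := fun=> 0%N) (d := fun=> g)).
    - exact: measurable_bump.
    - by move=> t _; exact: bump_ge0.
    - by move=> j; exact: (simple_map_cst 0%N).2.
    - by move=> j; split.
  split; first exact: (strongly_measurableD nXY su sb).
  apply: (bochnerD nS); first exact: (bochner_sub_space nX nS (@sub_space0_sum _ C) uh).
  rewrite -[X in bochner_integral _ _ X]scale1r.
  apply: (bochner_scalar nS).
  - exact: (@sub_space_cap_sum _ C g _).1.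
  - exact: measurable_bump.
  - by move=> t _; exact: bump_ge0.
  - exact: integral_bump.
have [Nfin|] := ltP (weighted_norm q w (Jnrm u)) +oo%E; last first.
  by rewrite leye_eq => /eqP ->; rewrite addye// gt0_muley ?leey// lte_fin addr_gt0// mulr_gt0.
pose G := nrm X g + nrm Y g.
have G0 : 0 <= G by rewrite addr_ge0 ?(nrm_ge0 nX) ?(nrm_ge0 nY).
pose b := L * (4 * G).
have b0 : 0 <= b by rewrite !mulr_ge0// ltW.
have wJ0 (t : T) : H t -> 0 <= (t : R) `^ (- r) * w t.
  by move=> /half_lineP t0; rewrite mulr_ge0 ?powR_ge0// ltW// w0.
apply: (@le_trans _ _ (Lq_norm q (fun t : T => (((t : R) `^ (- r) * w t * Jnrm u t)%:E +
    (if (t : R) \in `[1%R, 2%R[%classic then b else 0)%:E)%E))).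
  apply: (le_Lq_norm q1) => t Ht; first by rewrite lee_fin mulr_ge0 ?wJ0 ?Jnrm_ge0.
  have t0 : 0 < (t : R) by exact/half_lineP.
  have XYu := strongly_measurable_in su t0.
  have XYg : XY (bump t *: g) by exact: (normedZ nXY).
  rewrite -EFinD lee_fin.
  have le1 := Jnrm_addition (u' := fun t => bump t *: g) t0 XYu XYg.
  apply: (le_trans (ler_wpM2l (wJ0 t Ht) le1)).
  rewrite mulrDr lerD2l /Jnrm (nrmZ nX)// (nrmZ nY)// ger0_norm ?bump_ge0// /bump.
  case: ifPn => [|_]; last by rewrite !(mul0r, mulr0) maxxx mulr0.
  move=> /set_mem/=; rewrite in_itv/= => /andP[t1 t2].
  have tr : (t : R) `^ (- r) <= 1.
    have e1 : (1 : R) `^ r = 1 by rewrite powR1.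
    by rewrite powRN invf_le1 ?powR_gt0// -e1 ge0_ler_powR ?nnegrE ?ler01 ?(ltW t0).
  have /andP[_ wL] := lL t t1 (ltW t2).
  have Xg0 := nrm_ge0 nX g; have Yg0 := nrm_ge0 nY g.
  apply: ler_pM.
  - exact: wJ0.
  - by rewrite le_max mulr_ge0// ltW.
  - by rewrite -[L]mul1r ler_pM ?powR_ge0// ltW// w0.
  - have le4 (x y : R) : 0 <= x <= 2 -> 0 <= y -> x * y <= 2 * y.
      by move=> /andP[_ x2] y0; exact: ler_wpM2r.
    have t02 : 0 <= (t : R) <= 2 by rewrite (ltW t0) ltW.
    have ty0 : 0 <= (t : R) * nrm Y g by rewrite mulr_ge0 ?(ltW t0).
    have := le4 _ _ t02 Xg0; have := le4 _ _ t02 Yg0; have := le4 _ _ t02 ty0.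
    by rewrite /G ge_max => ? ? ?; apply/andP; split; lra.
apply: (le_trans (Lq_normD q1 _ _ _ _)).
- apply/measurable_EFinP; exact: (weighted_measurable q sw (@subset_refl _ _) (measurable_Jnrm su)).
- by move=> t Ht; rewrite lee_fin mulr_ge0 ?wJ0 ?Jnrm_ge0.
- by apply/measurable_EFinP; exact: (measurable_two_valued _ _ (measurable_leb_itv _)).
- by move=> t _; rewrite lee_fin; case: ifP.
have [N N0 NE] := weighted_norm_finite Nfin.
rewrite -/(weighted_norm q w (Jnrm u)) NE.
apply: (@le_trans _ _ (4%:E * (N%:E + b%:E))%E).
  by rewrite lee_pmul2l ?lte_fin// leeD2l// Lq_norm_bump.
rewrite -!EFinD -!EFinM lee_fin -/G /b.
have := mulr_ge0 (ltW L0) N0; have := mulr_ge0 (ltW L0) G0; nra.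
Qed.

End gluing.

(** * From representations to the K-functional and between weights *)

Section embeddings.
Context {R : realType} (C : compatible_couple R) (q : \bar R).
Hypothesis q1 : (1 < q)%E.
Notation V := (ambient C).
Notation T := (lebR R).
Notation mu := (leb R).
Notation H := (half_line R : set T).
Notation X := (X0 C).
Notation Y := (X1 C).
Notation XY := (space_cap X Y).
Notation S := (space_sum X Y).
Notation p := (conj_exp q).
Notation r := (recip q).
Implicit Types (f g h : V) (u : T -> V) (v w : R -> R).

Let nX : normed X := normed0_couple C.
Let nY : normed Y := normed1_couple C.
Let nXY : normed XY := normed_cap nX nY.
Let nS : normed S := normed_sum_couple C.
Let cX : complete_space X := complete_embedded (@emb0_inj _ C).

(** The infimum over the representations is taken in an estimate whose right-hand
    side is affine in the norm of the representation. *)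
Lemma le_affine_J_norm v f (K c : R) (y : \bar R) : 0 < K ->
  (forall u, J_representation f u -> (weighted_norm q v (Jnrm u) < +oo)%E ->
    (y <= K%:E * (c%:E + weighted_norm q v (Jnrm u)))%E) ->
  (y <= K%:E * (c%:E + J_norm q v f))%E.
Proof.
move=> K0 h; rewrite -lee_pdivrMl// -leeBlDl//; apply: le_J_norm => u fu.
rewrite leeBlDl// lee_pdivrMl//.
have [fin|] := ltP (weighted_norm q v (Jnrm u)) +oo%E; first exact: h.
by rewrite leye_eq => /eqP ->; rewrite addey// gt0_muley ?leey// lte_fin.
Qed.

Lemma integral_le_multiple v (D : set T) : slowly_varying v -> measurable D ->
  D `<=` H -> (weight_integral q v D < +oo)%E ->
  exists2 K : R, 0 < K & forall phi : T -> R,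
    measurable_fun H phi -> (forall t, H t -> 0 <= phi t) ->
    (\int[mu]_(t in D) ((t : R)^-1 * phi t)%:E <= K%:E * weighted_norm q v phi)%E.
Proof.
move=> sv mD DH fin; have [v0 _ _] := sv.
have I0 : (0 <= weight_integral q v D)%E.
  apply: integral_ge0 => t /DH/half_lineP t0.
  by rewrite lee_fin mulr_ge0 ?powR_ge0// invr_ge0 ltW.
have IE : weight_integral q v D = (fine (weight_integral q v D))%:E.
  by rewrite fineK// ge0_fin_numE.
exists (1 + fine (weight_integral q v D) `^ p^-1).
  by rewrite ltr_pwDl// powR_ge0.
move=> phi mphi phi0; apply: (le_trans (integral_le_weighted_norm q1 sv mD DH mphi phi0)).
rewrite -/(weight_integral q v D) IE poweR_EFin muleC lee_wpmul2r//.
  exact: Lq_norm_ge0.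
by rewrite lee_fin lerDr.
Qed.

(** The part of the integral beyond [1] converges in [X_1] and, as a difference,
    belongs to [X_0]; it can be moved to [[1, 2[], so that inside [X_0] only the
    weight near [0] matters. *)
Lemma J_norm_change_weight v w : slowly_varying v -> slowly_varying w ->
  (forall t : R, 0 < t < 1 -> v t = w t) ->
  (weight_integral q v `]0%R, 1%R[ < +oo)%E ->
  exists2 K : R, 0 < K & forall f, X f ->
    (J_norm q w f <= K%:E * ((nrm X f)%:E + J_norm q v f))%E.
Proof.
move=> sv sw vw fin.
have E0H : (`]0%R, 1%R[%classic : set R) `<=` H by exact: itv0_half_line.
have [K0 K00 hK0] := integral_le_multiple sv (measurable_leb_itv _) E0H fin.
have [K1 K10 hK1] := integral_le_weighted_norm_above q1 sv.
have [K2 K20 glue] := glue_representation C q1 sw.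
exists (K2 * (1 + K0 + K1)); first by rewrite mulr_gt0// !addr_gt0.
move=> f Xf; apply: le_affine_J_norm => [|u fu Nfin]; first by rewrite mulr_gt0// !addr_gt0.
have [su _] := fu.
have mJ := measurable_Jnrm su; have J0 t : H t -> 0 <= Jnrm u t by rewrite Jnrm_ge0.
have [N N0 NE] := weighted_norm_finite Nfin.
have i0 := hK0 _ mJ J0; have i1 := hK1 _ mJ J0; rewrite NE -EFinM in i0 i1.
have [h [g [fE hh Yg hle gle]]] := representation_split ltr01 fu
  (le_lt_trans i0 (ltry _)) (le_lt_trans i1 (ltry _)).
have {hle}hle : nrm X h <= K0 * N by rewrite -lee_fin; exact: le_trans hle i0.
have {gle}gle : nrm Y g <= K1 * N by rewrite -lee_fin; exact: le_trans gle i1.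
have Xh : X h by have [] := hh.
have gE : g = f - h by rewrite fE addrAC subrr add0r.
have Xg : X g by rewrite gE; exact: (normedB nX).
have gle0 : nrm X g <= nrm X f + K0 * N.
  by rewrite gE (le_trans (ler_nrmB nX Xf Xh))// lerD2l.
have su' := strongly_measurable_restr nXY (measurable_leb_itv `]0%R, 1%R[) su.
have [fu' le'] := glue _ _ _ su' hh (conj Xg Yg); rewrite -fE in fu'.
apply: (le_trans (J_norm_le q w fu')); apply: (le_trans le').
have le_w : (weighted_norm q w (Jnrm (restr (`]0%R, 1%R[%classic : set R) u)) <= N%:E)%E.
  rewrite -NE; apply: (le_Lq_norm q1) => t /half_lineP t0.
    by rewrite lee_fin mulr_ge0 ?Jnrm_ge0// mulr_ge0 ?powR_ge0// ltW//; have [] := sw; auto.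
  rewrite /Jnrm /restr lee_fin; case: ifPn => [/set_mem/=|_].
    by rewrite in_itv/= => t01; rewrite vw.
  rewrite (nrm0 nX) (nrm0 nY) mulr0 maxxx mulr0 mulr_ge0 ?Jnrm_ge0//.
  by rewrite mulr_ge0 ?powR_ge0// ltW//; have [] := sv; auto.
apply: (@le_trans _ _ (K2%:E * (N%:E + (nrm X g + nrm Y g)%:E))%E).
  by rewrite lee_pmul2l ?lte_fin// leeD2r.
rewrite NE -!EFinD -!EFinM lee_fin -mulrA ler_pM2l//.
have := nrm_ge0 nX f; have := mulr_ge0 (ltW K00) (nrm_ge0 nX f).
have := mulr_ge0 (ltW K10) (nrm_ge0 nX f); nra.
Qed.

(** When the weight integral converges on the whole half-line, Hoelder's
    inequality makes every representation absolutely convergent in [X_0]. *)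
Lemma J_space_sub_X0 v : slowly_varying v -> (weight_integral q v H < +oo)%E ->
  exists2 K : R, 0 < K & forall f, (J_norm q v f < +oo)%E ->
    X f /\ ((nrm X f)%:E <= K%:E * J_norm q v f)%E.
Proof.
move=> sv fin.
have [K K0 hK] := integral_le_multiple sv measurable_half_line (@subset_refl _ _) fin.
have rep f u : J_representation f u -> (weighted_norm q v (Jnrm u) < +oo)%E ->
    X f /\ ((nrm X f)%:E <= K%:E * weighted_norm q v (Jnrm u))%E.
  move=> [su fu] Nfin; have [N N0 NE] := weighted_norm_finite Nfin.
  have mJ := measurable_Jnrm su; have J0 t : H t -> 0 <= Jnrm u t by rewrite Jnrm_ge0.
  have i0 : (\int[mu]_(t in H) ((t : R)^-1 * nrm X (u t))%:E <= (K * N)%:E)%E.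
    apply: (le_trans (integral_nrm0_le _ (@subset_refl _ _))).
    by rewrite EFinM -NE; exact: hK.
  have su0 := strongly_measurable_sub_space nXY nX (sub_space_capl nX nY) su.
  have [h hh] := bochner_exists nX cX su0 (le_lt_trans i0 (ltry _)).
  have <- : h = f.
    exact: (bochner_unique nS (bochner_sub_space nX nS (@sub_space0_sum _ C) hh) fu).
  split; first by have [] := hh.
  by rewrite NE -EFinM; exact: le_trans (nrm_bochner_le nX hh) i0.
exists K => // f ffin; have [u fu Nfin] := J_norm_finite ffin.
split; first exact: (rep f u fu Nfin).1.
rewrite -[J_norm q v f]add0e; apply: (le_affine_J_norm K0) => u' fu' Nfin'.
by rewrite add0e; exact: (rep _ _ fu' Nfin').2.
Qed.

(** The J-representation bounds the K-functional by the two Hardy operators. *)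
Lemma K_norm_le_J_norm v : slowly_varying v -> weight (sv_density q v) ->
  exists2 K : R, 0 < K & forall f,
    (K_norm q (dual_weight q v) f <= K%:E * J_norm q v f)%E.
Proof.
move=> sv ww; have [C0 C00 hC0] := hardy_dual_below q1 sv ww.
have [C1 C10 hC1] := hardy_dual_above q1 sv ww.
have K0 : 0 < 4 * (C0 + C1) by rewrite mulr_gt0// addr_gt0.
exists (4 * (C0 + C1)) => // f.
rewrite -[J_norm q v f]add0e; apply: (le_affine_J_norm K0) => u fu Nfin.
rewrite add0e; have [su _] := fu; have [N N0 NE] := weighted_norm_finite Nfin.
have mJ := measurable_Jnrm su; have J0 t : H t -> 0 <= Jnrm u t by rewrite Jnrm_ge0.
have := hC1 _ mJ J0; have := hC0 _ mJ J0; rewrite NE.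
set F0 := (fun t => _%:E * \int[mu]_(s in `]0%R, _[%classic) _)%E.
set F1 := (fun t => _%:E * (_ * _))%E => h0 h1.
have B0 (t : R) : H t -> 0 <= t `^ (- r) * dual_weight q v t.
  by move=> _; rewrite mulr_ge0 ?powR_ge0// dual_weight_ge0.
have i00 (t : R) : (0 <= \int[mu]_(s in (`]0%R, t[%classic : set R)) ((s : R)^-1 * Jnrm u s)%:E)%E.
  apply: integral_ge0 => s /=; rewrite in_itv/= => /andP[s0 _].
  by rewrite lee_fin mulr_ge0 ?Jnrm_ge0// invr_ge0 ltW.
have i10 (t : R) : 0 < t -> (0 <= \int[mu]_(s in (`[t, +oo[%classic : set R))
      ((s : R)^-1 * ((s : R)^-1 * Jnrm u s))%:E)%E.
  move=> t0; apply: integral_ge0 => s /=; rewrite in_itv/= andbT => ts.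
  have s0 : 0 < (s : R) by exact: lt_le_trans ts.
  by rewrite lee_fin !mulr_ge0 ?Jnrm_ge0// invr_ge0 ltW.
have F00 t : H t -> (0 <= F0 t)%E.
  by move=> Ht; rewrite mule_ge0// lee_fin B0.
have F10 t : H t -> (0 <= F1 t)%E.
  move=> Ht; have t0 : 0 < (t : R) by exact/half_lineP.
  by rewrite mule_ge0 ?lee_fin ?B0// mule_ge0 ?lee_fin ?(ltW t0)// i10.
have mB : measurable_fun H (fun t : T => ((t : R) `^ (- r) * dual_weight q v t)%:E).
  apply/measurable_EFinP; apply: (eq_measurable_fun (fun t : T =>
    sv_density q v t `^ r * primitive (sv_density q v) t `^ (-1))).
    move=> t /set_mem/half_lineP t0; rewrite dual_weightE//.
    by rewrite powR_inv1// (primitive_ge0 ww).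
  apply: measurable_funM.
    exact: (measurableT_comp (measurable_powR _) (measurable_sv_density q sv)).
  exact: (measurableT_comp (measurable_powR _) (measurable_primitive ww (D := H))).
have mF0 : measurable_fun H F0.
  apply: emeasurable_funM; first exact: mB.
  apply: measurable_nondecreasing => s t s0 st; apply: le_integral_subset.
  - by apply: subset_itvl; rewrite bnd_simp.
  - move=> x /=; rewrite in_itv/= => /andP[x0 _].
    by rewrite lee_fin mulr_ge0 ?Jnrm_ge0// invr_ge0 ltW.
  - move=> x /=; rewrite in_itv/= => /andP[x0 _].
    by rewrite lee_fin mulr_ge0 ?Jnrm_ge0// invr_ge0 ltW.
  - by [].
have mF1 : measurable_fun H F1.
  apply: emeasurable_funM; first exact: mB.
  apply: emeasurable_funM; first by apply/measurable_EFinP; exact: measurable_leb_id.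
  apply: measurable_nonincreasing => s t s0 st; apply: le_integral_subset.
  - by apply: subset_itvr; rewrite bnd_simp.
  - move=> x /=; rewrite in_itv/= andbT => tx.
    have x0 : 0 < (x : R) by exact: lt_le_trans (lt_le_trans s0 st) tx.
    by rewrite lee_fin !mulr_ge0 ?Jnrm_ge0// invr_ge0 ltW.
  - move=> x /=; rewrite in_itv/= andbT => tx.
    have x0 : 0 < (x : R) by exact: lt_le_trans s0 tx.
    by rewrite lee_fin !mulr_ge0 ?Jnrm_ge0// invr_ge0 ltW.
  - by [].
apply: (@le_trans _ _ (Lq_norm q (fun t => F0 t + F1 t)%E)).
  apply: (le_Lq_norm q1) => t Ht; have t0 : 0 < (t : R) by exact/half_lineP.
    by rewrite mule_ge0 ?lee_fin ?B0// Kfun_ge0// ltW.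
  rewrite /F0 /F1 -muleDr//; last 1 first.
    by rewrite ge0_adde_def// inE ?i00// mule_ge0 ?lee_fin ?(ltW t0)// i10.
  by rewrite lee_wpmul2l ?lee_fin ?B0//; exact: Kfun_le_integrals.
apply: (le_trans (Lq_normD q1 mF0 F00 mF1 F10)).
rewrite -!EFinM in h0 h1.
apply: (@le_trans _ _ (4%:E * ((C0 * N)%:E + (C1 * N)%:E))%E).
  by rewrite lee_pmul2l ?lte_fin// leeD.
by rewrite -EFinD -!EFinM lee_fin -mulrDl mulrA.
Qed.

End embeddings.

(** * From the K-functional to representations *)

Section discretization.
Context {R : realType} (C : compatible_couple R) (q : \bar R) (v : R -> R).
Hypothesis q1 : (1 < q)%E.
Notation V := (ambient C).
Notation T := (lebR R).
Notation mu := (leb R).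
Notation H := (half_line R : set T).
Notation X := (X0 C).
Notation Y := (X1 C).
Notation XY := (space_cap X Y).
Notation S := (space_sum X Y).
Notation p := (conj_exp q).
Notation r := (recip q).
Notation w := (sv_density q v).
Notation Phi := (primitive w).
Context (sv : slowly_varying v) (ww : weight w).
Context (tau : nat -> R) (tauP : level_points w tau).
Notation E k := (level_interval tau k).

Let nX : normed X := normed0_couple C.
Let nY : normed Y := normed1_couple C.
Let nXY : normed XY := normed_cap nX nY.
Let nS : normed S := normed_sum_couple C.
Let cX : complete_space X := complete_embedded (@emb0_inj _ C).

Context (f : V) (Xf : X f).
Let Sf : S f. Proof. exact: (@sub_space0_sum _ C f Xf).1. Qed.
Notation kappa t := (fine (Kfun f t)).
Context (f0 f1 : nat -> V).
Hypothesis decomposition : forall k, [/\ X (f0 k), Y (f1 k), f = f0 k + f1 k &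
    nrm X (f0 k) + tau k * nrm Y (f1 k) <= 2 * kappa (tau k)].
Context (M : R) (M0 : 0 <= M).
Hypothesis normM :
  (Lq_norm q (fun t => (w t `^ r * (Phi t)^-1 * kappa t)%:E) <= M%:E)%E.

Let Xf0 k : X (f0 k). Proof. by have [] := decomposition k. Qed.
Let Yf1 k : Y (f1 k). Proof. by have [] := decomposition k. Qed.
Let tau0 k : 0 < tau k. Proof. exact: (level_point_gt0 tauP). Qed.
Let v0 t : 0 < t -> 0 < v t. Proof. by have [h _ _] := sv; exact: h. Qed.
Let P1 : 0 < Phi 1. Proof. exact: (primitive_gt0 ww). Qed.

Let kappa_ge0 (t : R) : 0 < t -> 0 <= kappa t.
Proof. by move=> t0; rewrite fine_ge0// Kfun_ge0// ltW. Qed.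

Let kappa_mono (s t : R) : 0 < s -> s <= t -> kappa s <= kappa t.
Proof. by move=> s0; apply: le_Kfun => //; exact: ltW. Qed.

Let nrm_f0 k : nrm X (f0 k) <= 2 * kappa (tau k).
Proof.
have [_ _ _] := decomposition k; apply: le_trans.
by rewrite lerDl mulr_ge0 ?(nrm_ge0 nY)// ltW.
Qed.

Let nrm_f1 k : tau k * nrm Y (f1 k) <= 2 * kappa (tau k).
Proof.
by have [_ _ _] := decomposition k; apply: le_trans; rewrite lerDr (nrm_ge0 nX).
Qed.

Let m k := 2^-1 ^+ k.+3 * Phi 1.
Let m_gt0 k : 0 < m k. Proof. by rewrite /m mulr_gt0// exprn_gt0// invr_gt0. Qed.

Let d k := f0 k.+1 - f0 k.+2.

(** Both decompositions add up to [f]; therefore the difference lies in both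
    spaces. *)
Let dE k : d k = f1 k.+2 - f1 k.+1.
Proof.
have [_ _ e1 _] := decomposition k.+1; have [_ _ e2 _] := decomposition k.+2.
apply/eqP; rewrite /d subr_eq addrAC -subr_eq opprK; apply/eqP.
by rewrite -e1 [RHS]addrC -e2.
Qed.

Let XYd k : XY (d k).
Proof. by split; [exact: (normedB nX)|rewrite /= dE; exact: (normedB nY)]. Qed.

Let nrm_d0 k : nrm X (d k) <= 4 * kappa (tau k.+1).
Proof.
apply: (le_trans (ler_nrmB nX (Xf0 _) (Xf0 _))).
have := nrm_f0 k.+1; have := nrm_f0 k.+2.
have := kappa_mono (tau0 k.+2) (ltW (lt_level_point ww tauP k.+1)); lra.
Qed.

Let nrm_d1 k (t : R) : 0 < t -> t <= tau k.+2 -> t * nrm Y (d k) <= 4 * kappa (tau k.+1).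
Proof.
move=> t0 tk; rewrite dE; have lt12 := ltW (lt_level_point ww tauP k.+1).
apply: (@le_trans _ _ (t * (nrm Y (f1 k.+2) + nrm Y (f1 k.+1)))).
  by rewrite ler_wpM2l ?(ltW t0)// (ler_nrmB nY).
rewrite mulrDr.
have b2 : t * nrm Y (f1 k.+2) <= 2 * kappa (tau k.+2).
  by apply: le_trans (nrm_f1 _); rewrite ler_wpM2r ?(nrm_ge0 nY).
have b1 : t * nrm Y (f1 k.+1) <= 2 * kappa (tau k.+1).
  by apply: le_trans (nrm_f1 _); rewrite ler_wpM2r ?(nrm_ge0 nY)// (le_trans tk).
have := kappa_mono (tau0 k.+2) lt12; lra.
Qed.

(** Above [tau 2] the index is [0], where the factor [rho] vanishes. *)
Let idx (t : T) : nat := xget 0%N [set j | E j.+2 t].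

Let idxE j t : E j.+2 t -> idx t = j.
Proof.
move=> Et; have : E (idx t).+2 t by exact: (@xgetI _ 0%N [set j | E j.+2 t] j Et).
by move=> /(level_interval_inj ww tauP Et)[].
Qed.

Let low (t : T) : (t : R) \in `]0, tau 2%N[ -> exists j, E j.+2 t.
Proof.
rewrite in_itv/= => /andP[t0 t2].
have [|k] := @level_interval_cover _ _ ww _ tauP t.
  by rewrite t0 (lt_le_trans t2)// (level_point_le1 ww tauP).
rewrite /level_interval/= in_itv/= => /andP[kt tk].
case: k kt tk => [|[|k]] kt tk.
- have := le_level_point ww tauP (leqnSn 1); rewrite leNgt; move/negP; case.
  exact: le_lt_trans kt t2.
- by move: t2; rewrite ltNge kt.
by exists k; rewrite /level_interval/= in_itv/= kt.
Qed.

Let E_low j t : E j.+2 t -> (t : R) \in `]0, tau 2%N[.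
Proof.
rewrite /level_interval/= !in_itv/= => /andP[jt tj].
rewrite (lt_le_trans (tau0 _) jt)/= (lt_le_trans tj)//.
exact: (le_level_point ww tauP).
Qed.

Let measurable_idx j : measurable (level idx j).
Proof.
rewrite (_ : level idx j = E j.+2 `|` (if j == 0%N then `[tau 2%N, +oo[%classic else set0)).
  apply: measurableU; first exact: measurable_level_interval.
  by case: ifP => _; [exact: measurable_leb_itv|exact: measurable0].
apply/seteqP; split => t.
  move=> [/half_lineP t0 /= tj]; have [t2|t2] := ltP t (tau 2%N).
    have [k Ek] : exists j, E j.+2 t by apply: low; rewrite in_itv/= t0.
    by left; rewrite -tj (idxE Ek).
  right; have -> : j = 0%N; last by rewrite /= in_itv/= t2.
  rewrite -tj /idx xgetPN// => k /= /E_low; rewrite in_itv/= => /andP[_].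
  by rewrite ltNge t2.
move=> [Ej|]; first by split; [exact: (level_interval_half_line tauP Ej)|exact: idxE].
case: eqP => // -> /=; rewrite in_itv/= andbT => t2; split.
  by apply/half_lineP; exact: lt_le_trans t2.
rewrite /= /idx xgetPN// => k /= /E_low; rewrite in_itv/= => /andP[_].
by rewrite ltNge t2.
Qed.

Let rho (t : T) : R := if (t : R) \in `]0, tau 2%N[%classic then v t `^ (- p) else 0.

Let rho_ge0 t : 0 <= rho t. Proof. by rewrite /rho; case: ifP => _; rewrite ?powR_ge0. Qed.

Let measurable_on (B : set R) : measurable (B : set T) ->
  measurable_fun H (fun t : T => if (t : R) \in B then v t `^ (- p) else 0).
Proof.
move=> mB; apply: (eq_measurable_fun (fun t : T =>
    v t `^ (- p) * (if (t : R) \in B then 1 else 0))).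
  by move=> t _; case: ifP => _; rewrite ?mulr1 ?mulr0.
apply: measurable_funM.
  exact: (measurableT_comp (measurable_powR _) (measurable_slowly_varying sv (@subset_refl _ _))).
exact: (measurable_two_valued _ _ mB).
Qed.

(** On the level interval [E j.+2] the vector [d j] is spread with the density
    [v^(-q') / m j], of mass one for [dt/t]. *)
Let u (t : T) : V := rho t *: ((m (idx t))^-1 *: d (idx t)).

Let u_level j t : E j.+2 t -> u t = (v t `^ (- p) / m j) *: d j.
Proof.
move=> Et; rewrite /u (idxE Et) scalerA /rho mem_set//.
exact: (E_low Et).
Qed.

Let u_high (t : T) : ~ (t : R) \in `]0, tau 2%N[ -> u t = 0.
Proof. by move=> ht; rewrite /u /rho memNset// scale0r. Qed.

Let su : strongly_measurable XY u.
Proof.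
apply: (strongly_measurable_scale nXY (k := idx) (d := fun j => (m j)^-1 *: d j)).
- by apply: measurable_on; exact: measurable_leb_itv.
- by move=> t _; exact: rho_ge0.
- exact: measurable_idx.
- by move=> j; exact: (normedZ nXY).
Qed.

Let Jnrm_level j t : E j.+2 t ->
  Jnrm u t <= 4 * (v t `^ (- p) / m j * kappa (tau j.+1)).
Proof.
move=> Et; have := E_low Et; rewrite in_itv/= => /andP[t0 _].
have [Xd Yd] := XYd j.
have c0 : 0 <= v t `^ (- p) / m j by rewrite divr_ge0 ?powR_ge0// ltW.
rewrite /Jnrm (u_level Et) (nrmZ nX)// (nrmZ nY)// ger0_norm// mulrCA -maxr_pMr//.
rewrite mulrCA ler_wpM2l// ge_max nrm_d0 nrm_d1//.
by move: Et; rewrite /level_interval/= in_itv/= => /andP[_ /ltW].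
Qed.

Let Jnrm_high (t : T) : ~ (t : R) \in `]0, tau 2%N[ -> Jnrm u t = 0.
Proof. by move=> ht; rewrite /Jnrm u_high// (nrm0 nX) (nrm0 nY) mulr0 maxxx. Qed.

(** On [E j.+2] the weighted value of [J] is at most [4 w^(1/q) / m j] times the
    K-functional at [tau j.+1], the left end of the interval two steps up. *)
Let norm_u : (weighted_norm q v (Jnrm u) <= (32 * M)%:E)%E.
Proof.
have mJ := measurable_Jnrm su.
have mF := weighted_measurable q sv (@subset_refl _ _) mJ.
pose F (t : T) := 4^-1 * ((t : R) `^ (- r) * v t * Jnrm u t).
have F0 t : H t -> 0 <= F t.
  move=> /half_lineP t0; rewrite !mulr_ge0 ?invr_ge0 ?powR_ge0 ?Jnrm_ge0//.
  by rewrite ltW// v0.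
have mF' : measurable_fun H F by apply: measurable_funM => //; exact: measurable_cst.
have mk : measurable_fun H (fun t : T => kappa t).
  apply: (measurableT_comp (f := fine)); first exact: fine_measurable.
  apply: measurable_nondecreasing => s t s0 st.
  rewrite (KfunE Sf (ltW s0)) (KfunE Sf (le_trans (ltW s0) st)) lee_fin.
  exact: kappa_mono.
have k0 t : H t -> 0 <= kappa t by move=> /half_lineP; exact: kappa_ge0.
have Flevel k t : E k.+2 t ->
    F t <= w t `^ r * (2^-1 ^+ k.+3 * Phi 1)^-1 * kappa (tau k.+1).
  move=> Et; have := E_low Et; rewrite in_itv/= => /andP[t0 _].
  have vt := v0 t0.
  have wE : w t `^ r = (t : R) `^ (- r) * v t * v t `^ (- p).
    rewrite /sv_density powRM ?invr_ge0 ?(ltW t0) ?powR_ge0//.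
    rewrite -powR_inv1 ?(ltW t0)// -!powRrM mulN1r mulNr (conj_expMrecip q1).
    by rewrite opprB addrC powRD_gt0// powRr1 ?(ltW vt)// -mulrA [v t * _]mulrC.
  rewrite /F -/(m k) wE mulrCA -!mulrA ler_wpM2l ?powR_ge0// ler_wpM2l ?(ltW vt)//.
  by rewrite ler_pdivrMl// (le_trans (Jnrm_level Et))// -!mulrA.
have Fhigh t : H t -> (forall k, ~ E k.+2 t) -> F t = 0.
  by move=> Ht noE; rewrite /F Jnrm_high ?mulr0// => /low[j]; exact: noE.
have le8 : (Lq_norm q (EFin \o F) <= (8 * M)%:E)%E.
  exact: (@Lq_norm_level_shift R w ww tau tauP q (fun t => kappa t) F M
    q1 M0 mk k0 kappa_mono normM mF' F0 Flevel Fhigh).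
rewrite (_ : weighted_norm _ _ _ = Lq_norm q (fun t => 4%:E * (EFin \o F) t)%E); last first.
  apply: eq_Lq_norm => t _; rewrite /F/= -EFinM mulrA mulfV// mul1r//.
have mF4 : measurable_fun H (EFin \o F) by exact/measurable_EFinP.
have F04 t : H t -> (0 <= (EFin \o F) t)%E by move=> Ht; rewrite lee_fin F0.
apply: (le_trans (Lq_normZ q1 (ler0n _ 4) mF4 F04)).
apply: (@le_trans _ _ (4%:E * (8 * M)%:E)%E); first by rewrite lee_pmul2l ?lte_fin.
by rewrite -EFinM lee_fin; lra.
Qed.

Let integral_piece n : (\int[mu]_(t in H) ((t : R)^-1 *
  (if (t : R) \in E n.+2 then v t `^ (- p) else 0))%:E = (m n)%:E)%E.
Proof.
rewrite -(integral_level_interval ww tauP n.+2).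
rewrite -[in RHS](setIidr (level_interval_half_line tauP (k := n.+2))) integral_mkcondr.
by apply: eq_integral => t _; rewrite /patch; case: ifPn => //; rewrite mulr0.
Qed.

(** Telescoping: the part of the integral above [tau_(n+2)]. *)
Let bochner_partial n :
  bochner_integral X (restr (`[tau n.+2, +oo[%classic : set R) u) (f0 1%N - f0 n.+1).
Proof.
elim: n => [|n IHn].
  rewrite subrr; apply: (eq_bochner nX _ (bochner0 nX)) => t t0.
  rewrite /restr; case: ifPn => // /set_mem/=; rewrite in_itv/= andbT => t2.
  by rewrite u_high//; apply/negP; rewrite in_itv/= negb_and -!leNgt t2 orbT.
have Xd : X (d n) by have [] := XYd n.
have rho0 (t : T) : H t -> 0 <= (if (t : R) \in E n.+2 then v t `^ (- p) else 0).
  by move=> _; case: ifP => _; rewrite ?powR_ge0.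
have piece := bochner_scalar nX (normedZ nX (m n)^-1 Xd)
  (measurable_on (measurable_level_interval tau n.+2)) rho0 (integral_piece n).
rewrite scalerA mulfV ?gt_eqF// scale1r in piece.
have := bochnerD nX IHn piece; rewrite /d addrA subrK => sum.
apply: (eq_bochner nX _ sum) => t t0; rewrite /restr.
have le32 := lt_level_point ww tauP n.+2.
have inco (x : R) : (t \in (`[x, +oo[%classic : set R)) = (x <= t).
  by apply/idP/idP => [/set_mem|xt]; [|apply/mem_set]; rewrite /= in_itv/= andbT.
have inE2 : (t \in E n.+2) = (tau n.+3 <= t < tau n.+2).
  apply/idP/idP => [/set_mem|xt]; [|apply/mem_set]; rewrite /level_interval/= in_itv/=.
    by [].
  by [].
rewrite !inco inE2; have [tn|nt] := ltP t (tau n.+2); last first.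
  by rewrite (le_trans (ltW le32) nt) andbF scale0r addr0.
have [tn'|nt'] := ltP t (tau n.+3); first by rewrite scale0r addr0.
have Et : E n.+2 t by rewrite /level_interval/= in_itv/= nt' tn.
by rewrite (u_level Et) scalerA add0r.
Qed.

(** Hoelder's inequality: the part of the integral near [0] is small. *)
Let bochner_head (x : R) : 0 < x ->
  exists2 h, bochner_integral X (restr (`]0%R, x[%classic : set R) u) h &
    nrm X h <= 32 * M * Phi x `^ p^-1.
Proof.
move=> x0.
have DH : (`]0%R, x[%classic : set R) `<=` H by exact: itv0_half_line.
have mJ := measurable_Jnrm su; have J0 t : H t -> 0 <= Jnrm u t by rewrite Jnrm_ge0.
have le1 : (\int[mu]_(t in (`]0%R, x[%classic : set R)) ((t : R)^-1 * nrm X (u t))%:E <=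
    (32 * M * Phi x `^ p^-1)%:E)%E.
  apply: (le_trans (integral_nrm0_le _ DH)).
  apply: (le_trans (integral_le_weighted_norm q1 sv (measurable_leb_itv _) DH mJ J0)).
  rewrite (primitiveE ww x) poweR_EFin EFinM lee_wpmul2r//.
  by rewrite lee_fin powR_ge0.
have su0 := strongly_measurable_sub_space nXY nX (sub_space_capl nX nY) su.
have [|h hh hle] := bochner_exists_restr nX cX (measurable_leb_itv _) DH su0.
  exact: le_lt_trans le1 (ltry _).
by exists h => //; rewrite -lee_fin; exact: le_trans hle le1.
Qed.

Let a n : R := Phi (tau n) `^ p^-1.

Let a_cvg : a n @[n --> \oo] --> 0.
Proof.
have p0 := conj_exp_gt0 q1.
rewrite (_ : a = fun n => ((2^-1 : R) `^ p^-1) ^+ n * Phi 1 `^ p^-1).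
  rewrite -[X in _ --> X](mul0r (Phi 1 `^ p^-1)); apply: cvgMl.
  apply: cvg_expr; rewrite ger0_norm ?powR_ge0//.
  have e1 : (1 : R) `^ p^-1 = 1 by rewrite powR1.
  rewrite -[ltRHS]e1; apply: gt0_ltr_powR; rewrite ?invr_gt0 ?nnegrE ?invr_ge0 ?ler01 ?ler0n//.
  lra.
apply/funext => n; rewrite /a (level_point_primitive tauP).
rewrite powRM ?exprn_ge0 ?invr_ge0 ?(ltW P1)//; congr (_ * _).
by rewrite -powR_mulrn ?invr_ge0// -powRrM mulrC powRrM powR_mulrn// powR_ge0.
Qed.

(** The mass between [tau n.+1] and [tau n] forces the K-functional to vanish at
    [0]. *)
Let kappa_le n : kappa (tau n.+1) <= 2 * M * a n.+1.
Proof.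
have := @Lq_norm_primitive_ge R w ww q (fun t => kappa t) (tau n.+1) (tau n) M q1
  (tau0 _) (lt_level_point ww tauP n) M0 (fun t Ht => kappa_ge0 ((half_lineP t).1 Ht))
  (fun t => kappa_mono (tau0 _)) normM.
have Pn : 0 < Phi (tau n.+1) by exact: (primitive_gt0 ww).
have PE : Phi (tau n) = 2 * Phi (tau n.+1).
  by rewrite !(level_point_primitive tauP) exprS; field.
have -> : Phi (tau n) - Phi (tau n.+1) = Phi (tau n.+1) by rewrite PE; ring.
rewrite PE -ler_pdivlMr ?powR_gt0// => /le_trans; apply.
have aE : a n.+1 = Phi (tau n.+1) * Phi (tau n.+1) `^ (- r).
  rewrite /a -{2}(powRr1 (ltW Pn)) -powRD_gt0//; congr (_ `^ _).
  by rewrite (recipE q1) opprB addrC subrK.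
by rewrite aE powRN !mulrA [M * 2]mulrC.
Qed.

(** The integral differs from [f0 1] by its part below [tau n.+2] and by
    [f0 n.+1], both of which tend to [0]. *)
Let bochner_u : bochner_integral X u (f0 1%N).
Proof.
have [h hh _] := bochner_head ltr01.
have inoo (x t : R) : (t \in (`]0%R, x[%classic : set R)) = (0 < t < x).
  by apply/idP/idP => [/set_mem|xt]; [|apply/mem_set]; rewrite /= in_itv/=.
have inco (x t : R) : (t \in (`[x, +oo[%classic : set R)) = (x <= t).
  by apply/idP/idP => [/set_mem|xt]; [|apply/mem_set]; rewrite /= in_itv/= andbT.
have hu : bochner_integral X u h.
  apply: (eq_bochner nX _ hh) => t t0; rewrite /restr inoo t0/=.
  have [//|t1] := ltP t 1; rewrite u_high//; apply/negP.
  by rewrite in_itv/= negb_and -!leNgt (le_trans (level_point_le1 ww tauP 2) t1) orbT.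
have Xh : X h by have [] := hu.
have arith (x y k g b : R) : g <= 32 * x -> k <= 2 * y -> x <= y -> b <= 2 * k ->
    g + b <= 36 * y by move=> *; lra.
have hle n : nrm X (h - f0 1%N) <= 36 * M * a n.+1.
  have [g gg gle] := bochner_head (tau0 n.+2).
  have Xg : X g by have [] := gg.
  have hE : h = g + (f0 1%N - f0 n.+1).
    apply: (bochner_unique nX hu).
    apply: (eq_bochner nX _ (bochnerD nX gg (bochner_partial n))) => t t0.
    rewrite /restr inoo inco t0/=; have [tn|nt] := ltP t (tau n.+2).
      by rewrite addr0.
    by rewrite add0r.
  have -> : h - f0 1%N = g - f0 n.+1.
    by rewrite hE -addrA; congr (_ + _); rewrite addrAC subrr sub0r.
  apply: (le_trans (ler_nrmB nX Xg (Xf0 _))).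
  have a12 : a n.+2 <= a n.+1.
    apply: ge0_ler_powR; rewrite ?nnegrE ?(primitive_ge0 ww)// ?invr_ge0 ?(ltW (conj_exp_gt0 q1))//.
    exact/(le_primitive ww)/ltW/(lt_level_point ww tauP).
  have gle' : nrm X g <= 32 * (M * a n.+2) by rewrite mulrA.
  have kle : kappa (tau n.+1) <= 2 * (M * a n.+1) by rewrite mulrA kappa_le.
  have aM := ler_wpM2l M0 a12; have fle := nrm_f0 n.+1.
  by rewrite -mulrA; exact: (arith _ _ _ _ _ gle' kle aM fle).
have nrm_le0 : nrm X (h - f0 1%N) <= 0.
  have c0 : 36 * M * a n.+1 @[n --> \oo] --> 0.
    rewrite -[X in _ --> X](mulr0 (36 * M)); apply: cvgMr.
    by rewrite (cvg_shiftS a).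
  apply/ler_addgt0Pr => e e0; rewrite add0r.
  have [N _ /(_ N (leqnn N))/=] := cvg0_le c0 e0; exact: le_trans.
have : h - f0 1%N = 0.
  apply: (nrm_eq0 nX (normedB nX Xh (Xf0 _))); apply/eqP.
  by rewrite eq_le nrm_le0 (nrm_ge0 nX).
by move=> /subr0_eq <-.
Qed.

Lemma discretization_representation :
  exists2 u : T -> V, strongly_measurable XY u /\ bochner_integral X u (f0 1%N) &
    (weighted_norm q v (Jnrm u) <= (32 * M)%:E)%E.
Proof. by exists u. Qed.

End discretization.

Section K_to_J.
Context {R : realType} (C : compatible_couple R) (q : \bar R) (v : R -> R).
Hypothesis q1 : (1 < q)%E.

(** The telescoping integral represents [f0 1]; what remains of [f] is [f1 1],
    which lies in both spaces because [f] is in the first one, and is glued on. *)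
Lemma J_norm_le_K_norm : slowly_varying v -> weight (sv_density q v) ->
  exists2 K : R, 0 < K & forall f, X0 C f ->
    (J_norm q v f <= K%:E * ((nrm (X0 C) f)%:E + K_norm q (dual_weight q v) f))%E.
Proof.
move=> sv ww; have [tau tauP] := level_points_exist ww.
have nX := normed0_couple C; have nY := normed1_couple C.
have [K K0 glue] := glue_representation C q1 sv.
have t10 : 0 < tau 1%N by exact: (level_point_gt0 tauP).
have K'0 : 0 < K * (32 + (3 + 2 / tau 1%N)) by rewrite mulr_gt0// !addr_gt0// divr_gt0.
exists (K * (32 + (3 + 2 / tau 1%N))) => // f Xf.
have [Mfin|] := ltP (K_norm q (dual_weight q v) f) +oo%E; last first.
  by rewrite leye_eq => /eqP ->; rewrite addey// gt0_muley ?leey// lte_fin.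
have Mny : K_norm q (dual_weight q v) f != +oo%E by rewrite lt_eqF.
have [ME M0] := Lq_norm_finite Mny.
rewrite -/(K_norm q (dual_weight q v) f) in ME M0.
set M := fine (K_norm _ _ _) in ME M0; rewrite ME.
have Sf := (sub_space0_sum Xf).1.
have /choice[z hz] : forall k, exists z : ambient C * ambient C,
    [/\ X0 C z.1, X1 C z.2, f = z.1 + z.2 &
      nrm (X0 C) z.1 + tau k * nrm (X1 C) z.2 <= 2 * fine (Kfun f (tau k))].
  move=> k; have [f0 [f1 h]] := Kfun_near_optimal Sf (level_point_gt0 tauP k).
  by exists (f0, f1).
have normM : (Lq_norm q (fun t => (sv_density q v t `^ recip q *
    (primitive (sv_density q v) t)^-1 * fine (Kfun f t))%:E) <= M%:E)%E.
  rewrite -ME /K_norm (@eq_Lq_norm _ _ _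
    (fun t => (t `^ (- recip q) * dual_weight q v t)%:E * Kfun f t)%E) // => t /half_lineP t0.
  by rewrite EFinM -(KfunE Sf (ltW t0)) dual_weightE.
have [u [su hu] uM] := discretization_representation q1 sv ww tauP Xf hz M0 normM.
have [Xz Yz fE zle] := hz 1%N.
have gE : (z 1%N).2 = f - (z 1%N).1 by rewrite {1}fE addrAC subrr add0r.
have Xg : X0 C (z 1%N).2 by rewrite gE; exact: (normedB nX).
have [fu le] := glue _ _ _ su hu (conj Xg Yz); rewrite -fE in fu.
apply: (le_trans (J_norm_le q v fu)); apply: (le_trans le).
have kle : fine (Kfun f (tau 1%N)) <= nrm (X0 C) f.
  by rewrite -lee_fin -(KfunE Sf (ltW t10)); exact: Kfun_le_nrm0.
apply: (@le_trans _ _ (K%:E * ((32 * M)%:E + (nrm (X0 C) (z 1%N).2 + nrm (X1 C) (z 1%N).2)%:E))%E).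
  by rewrite lee_pmul2l ?lte_fin// leeD2r.
have z1 : nrm (X0 C) (z 1%N).1 <= 2 * nrm (X0 C) f.
  have := nrm_ge0 nY (z 1%N).2; move=> /(mulr_ge0 (ltW t10)); lra.
have z2 : nrm (X1 C) (z 1%N).2 <= 2 / tau 1%N * nrm (X0 C) f.
  rewrite mulrAC ler_pdivlMr// mulrC.
  have := nrm_ge0 nX (z 1%N).1; lra.
have gle : nrm (X0 C) (z 1%N).2 <= 3 * nrm (X0 C) f.
  rewrite gE; apply: (le_trans (ler_nrmB nX Xf Xz)); lra.
rewrite -!EFinD -!EFinM lee_fin -mulrA ler_pM2l//.
have n0 := nrm_ge0 nX f.
have c0 : 0 <= 3 + 2 / tau 1%N by rewrite addr_ge0// divr_ge0// ltW.
have := mulr_ge0 c0 M0; have := mulr_ge0 c0 n0; lra.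
Qed.

End K_to_J.

(** * Comparison of the spaces *)

Lemma space_eqI (R : realType) (V : topologicalLmodType R) (X Y : Defs.space R V)
    (K K' : R) : 0 < K -> 0 < K' ->
  (forall f, X f -> Y f /\ (snorm Y f <= K%:E * snorm X f)%E) ->
  (forall f, Y f -> X f /\ (snorm X f <= K'%:E * snorm Y f)%E) ->
  space_eq X Y.
Proof.
move=> K0 K'0 XY YX; split; first by move=> f; split => [/XY[]|/YX[]].
exists K^-1, K'; split => //; first by rewrite invr_gt0.
by move=> f Xf; have [Yf le] := XY f Xf; rewrite lee_pdivrMl//; have [_ ?] := YX f Yf.
Qed.

(** The sum of two norms is at most twice their maximum. *)
Lemma snorm_cap_le (R : realType) (V : topologicalLmodType R)
    (X Y Z : Defs.space R V) (K : R) f : normed X -> 0 < K -> X f ->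
  (0 <= snorm Y f)%E -> (snorm Z f <= K%:E * ((nrm X f)%:E + snorm Y f))%E ->
  (snorm Z f <= (K * 2)%:E * snorm (space_cap X Y) f)%E.
Proof.
move=> nX K0 Xf Y0 /le_trans; apply.
rewrite EFinM -muleA lee_pmul2l ?lte_fin// /= (snormE nX Xf).
rewrite (_ : 2 = 1 + 1 :> R)// EFinD ge0_muleDl// !mul1e.
by apply: leeD; rewrite le_max lexx ?orbT.
Qed.

Theorem corollary1p18 (R : realType) (C : compatible_couple R) (q : \bar R)
    (a alpha A : R -> R) :
  (1 < q)%E ->
  slowly_varying a ->
  (weight_integral q a (half_line R) < +oo)%E ->
  slowly_varying alpha ->
  (forall x : R, 0 < x -> (weight_integral q alpha `]0%R, x[ < +oo)%E) ->
  weight_integral q alpha (half_line R) = +oo%E ->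
  slowly_varying A ->
  (forall x : R, 0 < x <= 1 -> A x = a x) ->
  equiv_on `]1, +oo[ A alpha ->
  space_eq (J_space C q a) (space_cap (X0 C) (J_space C q A)) /\
  space_eq (space_cap (X0 C) (J_space C q A))
           (space_cap (X0 C) (K_space C q (dual_weight q A))).
Proof.
move=> q1 sa fin_a _ _ _ sA Aa _.
have nX := normed0_couple C.
have a1 : (weight_integral q a `]0%R, 1%R[ < +oo)%E.
  apply: le_lt_trans fin_a; apply: le_integral_subset.
  - exact: itv0_half_line.
  - move=> t /=; rewrite in_itv/= => /andP[t0 _].
    by rewrite lee_fin mulr_ge0 ?powR_ge0// invr_ge0 ltW.
  - by move=> t /half_lineP t0; rewrite lee_fin mulr_ge0 ?powR_ge0// invr_ge0 ltW.
  - by [].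
have aA (t : R) : 0 < t < 1 -> a t = A t by move=> /andP[t0 t1]; rewrite Aa// t0 ltW.
have A1 : (weight_integral q A `]0%R, 1%R[ < +oo)%E.
  suff <- : weight_integral q a `]0%R, 1%R[ = weight_integral q A `]0%R, 1%R[ by exact: a1.
  by apply: eq_integral => t /set_mem/=; rewrite in_itv/= => /aA ->.
have wA := sv_density_weight q1 sA A1.
have J0 v (f : ambient C) : (0 <= J_norm q v f)%E.
  by apply: le_J_norm => u _; exact: Lq_norm_ge0.
have N0 v (f : ambient C) : (0 <= K_norm q v f)%E by exact: Lq_norm_ge0.
have mulfin (K : R) (x : \bar R) : 0 < K -> (x < +oo -> K%:E * x < +oo)%E.
  by move=> K0 xfin; rewrite lte_mul_pinfty// lee_fin ltW.
have capE (Z : Defs.space R (ambient C)) f :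
    snorm (space_cap (X0 C) Z) f = Order.max (snorm (X0 C) f) (snorm Z f) by [].
have capfin (f : ambient C) (x : \bar R) : X0 C f -> (x < +oo)%E ->
    (Order.max (snorm (X0 C) f) x < +oo)%E.
  by move=> Xf xfin; rewrite gt_max xfin (snormE nX Xf) ltry.
have [K1 K10 h1] := J_space_sub_X0 C q1 sa fin_a.
have [K2 K20 h2] := J_norm_change_weight C q1 sa sA aA a1.
have [K3 K30 h3] := J_norm_change_weight C q1 sA sa (fun t ht => esym (aA t ht)) A1.
have [K4 K40 h4] := K_norm_le_J_norm C q1 sA wA.
have [K5 K50 h5] := J_norm_le_K_norm C q1 sA wA.
have K12 : 0 < K2 * (K1 + 1) by rewrite mulr_gt0// addr_gt0.
split.
  apply: (@space_eqI _ _ _ _ (K1 + K2 * (K1 + 1)) (K3 * 2)).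
  - by rewrite addr_gt0.
  - by rewrite mulr_gt0.
  - move=> f [Sf ffin]; have [Xf le1] := h1 f ffin; have Jge := J0 a f.
    have le2 : (J_norm q A f <= (K2 * (K1 + 1))%:E * J_norm q a f)%E.
      apply: (le_trans (h2 f Xf)); rewrite EFinM -muleA lee_pmul2l ?lte_fin//.
      by rewrite EFinD ge0_muleDl ?lee_fin ?(ltW K10)// mul1e leeD2r.
    split.
      by split => //; split => //; apply: (le_lt_trans le2); exact: mulfin.
    rewrite EFinD ge0_muleDl ?lee_fin ?(ltW K10) ?(ltW K12)//.
    rewrite capE (snormE nX Xf) ge_max; apply/andP; split.
      by rewrite -[leLHS]adde0 leeD// mule_ge0// lee_fin ltW.
    by rewrite -[leLHS]add0e leeD// mule_ge0// lee_fin ltW.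
  - move=> f [Xf [Sf ffin]].
    have le := snorm_cap_le (Y := J_space C q A) (Z := J_space C q a) nX K30 Xf (J0 A f) (h3 f Xf).
    split; last exact: le.
    split => //; apply: (le_lt_trans le); apply: mulfin; first by rewrite mulr_gt0.
    exact: (capfin _ _ Xf ffin).
apply: (@space_eqI _ _ _ _ (1 + K4) (1 + K5 * 2)).
- by rewrite addr_gt0.
- by rewrite addr_gt0// mulr_gt0.
- move=> f [Xf [Sf ffin]]; split.
    by split => //; split => //; apply: (le_lt_trans (h4 f)); exact: mulfin.
  have m0 : (0 <= snorm (space_cap (X0 C) (J_space C q A)) f)%E.
    by rewrite capE le_max J0 orbT.
  rewrite EFinD ge0_muleDl ?lee_fin ?(ltW K40)// mul1e.
  rewrite [leLHS]capE ge_max; apply/andP; split.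
    by rewrite -[leLHS]adde0 leeD ?mule_ge0 ?lee_fin ?(ltW K40)// capE le_max lexx.
  apply: (le_trans (h4 f)); rewrite -[leLHS]add0e leeD// lee_pmul2l ?lte_fin//.
  by rewrite capE le_max lexx orbT.
- move=> f [Xf [Sf ffin]].
  have le := snorm_cap_le (Y := K_space C q (dual_weight q A)) (Z := J_space C q A)
    nX K50 Xf (N0 _ f) (h5 f Xf).
  have c0 : (0 <= snorm (space_cap (X0 C) (K_space C q (dual_weight q A))) f)%E.
    by rewrite capE le_max N0 orbT.
  split.
    split => //; split => //; apply: (le_lt_trans le); apply: mulfin; first by rewrite mulr_gt0.
    exact: (capfin _ _ Xf ffin).
  rewrite EFinD ge0_muleDl ?lee_fin ?mulr_ge0 ?(ltW K50)// mul1e.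
  rewrite [leLHS]capE ge_max; apply/andP; split.
    rewrite -[leLHS]adde0 leeD ?mule_ge0 ?lee_fin ?mulr_ge0 ?(ltW K50)//.
    by rewrite capE le_max lexx.
  by apply: (le_trans le); rewrite -[leLHS]add0e leeD.
Qed.
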